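(* Let $d,n_S\ge1$, $\sigma>0$, $r>0$, let $X_S\in\mathbb{R}^{n_S\times d}$ be fixed with $\hat\Sigma_S:=X_S^\top X_S/n_S$ invertible, and let $\Sigma_T\in\mathbb{R}^{d\times d}$ be symmetric positive semidefinite. Observations are $\mathbf{y}_S=X_S\boldsymbol{\beta}^*+\mathbf{z}$, $\mathbf{z}\sim\mathcal{N}(0,\sigma^2I_{n_S})$, with $\boldsymbol{\beta}^*\in\mathcal{B}:=\{\boldsymbol{\beta}:\|\boldsymbol{\beta}\|_2\le r\}$. For an estimator $\hat{\boldsymbol{\beta}}$ (a measurable map $\mathbb{R}^{n_S}\to\mathbb{R}^d$) define $L_{\mathcal{B}}(\hat{\boldsymbol{\beta}}):=\max_{\boldsymbol{\beta}^*\in\mathcal{B}}\mathbb{E}_{\mathbf{z}}\|\Sigma_T^{1/2}(\hat{\boldsymbol{\beta}}(\mathbf{y}_S)-\boldsymbol{\beta}^* )\|_2^2$, and let $R_L(\mathcal{B}):=\inf_{A\in\mathbb{R}^{d\times n_S}}L_{\mathcal{B}}(\mathbf{y}_S\mapsto A\mathbf{y}_S)$ and $R_N(\mathcal{B}):=\inf_{\hat{\boldsymbol{\beta}}}L_{\mathcal{B}}(\hat{\boldsymbol{\beta}})$ (infimum over all measurable estimators). Let $\hat{\boldsymbol{\beta}}_{\mathrm{SS}}:=\frac1{n_S}\hat\Sigma_S^{-1}X_S^\top\mathbf{y}_S$ and let $(C^*,\tau^* )$ be an optimal solution of $$\min_{C\in\mathbb{R}^{d\times d},\,\tau\in\mathbb{R}}\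 r^2\tau+\frac{\sigma^2}{n_S}\operatorname{Tr}\big(\Sigma_T^{1/2}C\hat\Sigma_S^{-1}C^\top\Sigma_T^{1/2}\big)\quad\text{s.t.}\quad (C-I)^\top\Sigma_T(C-I)\preceq\tau I .$$ Set $\hat{\boldsymbol{\beta}}_{\mathrm{MM}}:=C^*\hat{\boldsymbol{\beta}}_{\mathrm{SS}}$. Then $L_{\mathcal{B}}(\hat{\boldsymbol{\beta}}_{\mathrm{MM}})=R_L(\mathcal{B})$. Moreover, if $\hat\Sigma_S$ and $\Sigma_T$ commute, or if $\Sigma_T$ has rank $1$, then $L_{\mathcal{B}}(\hat{\boldsymbol{\beta}}_{\mathrm{MM}})\le 1.25\,R_N(\mathcal{B})$.
   Context: $X_S$ is treated as fixed (deterministic); expectations are over the Gaussian noise only. $\preceq$ is the Loewner order on symmetric matrices. *)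

(* Defs.v *)
From HB Require Import structures.
From mathcomp Require Import all_boot all_order all_algebra.
From mathcomp Require Import all_classical all_reals all_analysis.
Set Implicit Arguments. Unset Strict Implicit. Unset Printing Implicit Defensive.
Import Order.TTheory GRing.Theory Num.Theory.
Local Open Scope classical_set_scope.
Local Open Scope ring_scope.

Section Defs.
Context {R : realType}.

Definition psd n (A : 'M[R]_n) : Prop :=
  A^T = A /\ forall v : 'cV[R]_n, 0 <= (v^T *m A *m v) 0 0.

Definition loewner_le n (A B : 'M[R]_n) : Prop := psd (B - A).

Definition sqnorm n (v : 'cV[R]_n) : R := (v^T *m v) 0 0.

(* conversions between tuples (the measurable model of R^n) and column vectors *)
Definition tcol n (t : n.-tuple R) : 'cV[R]_n := \col_i tnth t i.
Definition ctup n (v : 'cV[R]_n) : n.-tuple R := [tuple v i 0 | i < n].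

(* mu is the law of z ~ N(0, sigma^2 I_n) on R^n (= n.-tuple R, product
   Borel sigma-algebra): its value on every measurable rectangle is the
   product of the one-dimensional N(0, sigma^2) probabilities. *)
Definition iid_gaussian n (mu : probability (n.-tuple R) R) (sigma : R) : Prop :=
  forall A : 'I_n -> set R, (forall i, measurable (A i)) ->
    mu [set t | forall i, A i (tnth t i)] =
    (\prod_(i < n) normal_prob 0 sigma (A i))%E.

Definition measurable_estimator nS d (est : 'cV[R]_nS -> 'cV[R]_d) : Prop :=
  measurable_fun [set: nS.-tuple R] (fun t => ctup (est (tcol t))).

(* risk E_z || Sigma_T^{1/2} (est (X beta + z) - beta) ||^2, S12 = Sigma_T^{1/2} *)
Definition risk nS d (mu : probability (nS.-tuple R) R) (X : 'M[R]_(nS, d))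
  (S12 : 'M[R]_d) (est : 'cV[R]_nS -> 'cV[R]_d) (beta : 'cV[R]_d) : \bar R :=
  (\int[mu]_t (sqnorm (S12 *m (est (X *m beta + tcol t) - beta)))%:E)%E.

Definition LB nS d (mu : probability (nS.-tuple R) R) (X : 'M[R]_(nS, d))
  (S12 : 'M[R]_d) (r : R) (est : 'cV[R]_nS -> 'cV[R]_d) : \bar R :=
  ereal_sup [set risk mu X S12 est beta | beta in [set beta | sqnorm beta <= r ^+ 2]].

Definition RL nS d (mu : probability (nS.-tuple R) R) (X : 'M[R]_(nS, d))
  (S12 : 'M[R]_d) (r : R) : \bar R :=
  ereal_inf [set LB mu X S12 r (fun y => A *m y) | A in [set: 'M[R]_(d, nS)]].

Definition RN nS d (mu : probability (nS.-tuple R) R) (X : 'M[R]_(nS, d))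
  (S12 : 'M[R]_d) (r : R) : \bar R :=
  ereal_inf [set LB mu X S12 r est | est in
    [set est : 'cV[R]_nS -> 'cV[R]_d | measurable_estimator est]].

Definition SigmaS nS d (X : 'M[R]_(nS, d)) : 'M[R]_d := (nS%:R)^-1 *: (X^T *m X).

Definition beta_SS nS d (X : 'M[R]_(nS, d)) (y : 'cV[R]_nS) : 'cV[R]_d :=
  (nS%:R)^-1 *: (invmx (SigmaS X) *m X^T *m y).

Definition sdp_obj nS d (X : 'M[R]_(nS, d)) (S12 : 'M[R]_d) (sigma r : R)
  (C : 'M[R]_d) (tau : R) : R :=
  r ^+ 2 * tau + sigma ^+ 2 / nS%:R * \tr (S12 *m C *m invmx (SigmaS X) *m C^T *m S12).

Definition sdp_feas d (SigmaT C : 'M[R]_d) (tau : R) : Prop :=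
  loewner_le ((C - 1%:M)^T *m SigmaT *m (C - 1%:M)) (tau%:M).

Definition sdp_optimal nS d (X : 'M[R]_(nS, d)) (SigmaT S12 : 'M[R]_d) (sigma r : R)
  (C : 'M[R]_d) (tau : R) : Prop :=
  sdp_feas SigmaT C tau /\
  forall C' tau', sdp_feas SigmaT C' tau' ->
    sdp_obj X S12 sigma r C tau <= sdp_obj X S12 sigma r C' tau'.

End Defs.

(* Main.v *)
(* A linear estimator [A y] has risk [|S12 (A X - 1) beta|^2 + sigma^2 tr (S12 A A^T S12)].
   Its supremum over the ball is [r^2] times the top eigenvalue of the bias form, plus the
   variance; removing from [A] the part that annihilates the range of [X] keeps [A X] and
   can only lower the variance, so the best linear estimator is the one that solves the
   semidefinite program.

   For nonlinear estimators, restrict [beta] to a box inscribed in the ball whose axes have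
   orthogonal images under [X]. With a product prior the problem splits into bounded normal
   means, [|theta| <= tau] observed with unit noise, so it remains to find for each [tau] a
   finite prior whose Bayes risk is at least [4 / 5] of the linear minimax risk
   [tau^2 / (1 + tau^2)]. The Bayes risk is the integral of [W / m], with [m] the marginal
   density and [W] a combination of exponentials; the inequality [1 / m >= 2 g - g^2 m], for
   [g] a combination of Gaussian bumps, bounds it below by explicit Gaussian integrals. For
   [tau <= 6 / 5] the two-point prior suffices; beyond, finitely many priors cover the
   half-line, because a prior on [-tau, tau] is also one on any larger interval and the
   linear risk stays below [1].

   If the covariances commute, the box lies along a common eigenbasis and its sides are given
   by water-filling. If [SigmaT = w w^T], the box is a segment of length [2 r] in the direction
   [N (r^2 + N)^-1 w], where [N] is the covariance of the least-squares estimator. In both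
   cases the linear minimax risk of the box is the value of the program at an explicit point. *)
Require Import Defs.
From HB Require Import structures.
From mathcomp Require Import all_boot all_order all_algebra.
From mathcomp Require Import all_classical all_reals all_analysis measurable_realfun.
From Stdlib Require Import ZArith.
From mathcomp Require Import zify ssrZ ring lra.
Set Implicit Arguments. Unset Strict Implicit. Unset Printing Implicit Defensive.
Import Order.TTheory GRing.Theory Num.Theory numFieldNormedType.Exports.
Local Open Scope classical_set_scope.
Local Open Scope ring_scope.
(* [ZArith] rebinds [%N] to the binary natural numbers. *)
Delimit Scope nat_scope with N.

(** * Certified fixed-point exponentials and square roots *)

(** The worst ratio of linear to nonlinear minimax risk of a bounded normal mean is only slightly
    below [5 / 4], so crude bounds fail. The rows of the table are densest near half-width [8 / 5],
    where least can be given away. The bound [2 g - g^2 m] is exact at [g = 1 / m], and one or two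
    centred bumps come close enough to [1 / m]; all integrals then have closed forms, which are
    rounded in the safe direction in integer arithmetic.

    An estimator is an arbitrary measurable map and its risk may be infinite. Hence integrals are
    taken of nonnegative functions, and subtraction waits until values are known to be finite. A
    change of measure moves the parameter from the argument of the estimator into a density. All
    parameters then see the same value of the estimator, and the Bayes argument becomes a pointwise
    inequality in the observation, free of conditional expectations. *)

Section FixedPoint.
Context {R : realType}.

(* Locked, so that unification never unfolds large integers in unary. *)
Definition ofZ (z : Z) : R := locked (fun z => (int_of_Z z)%:~R) z.

Let ofZ_def z : ofZ z = (int_of_Z z)%:~R.
Proof. by rewrite /ofZ -lock. Qed.

Lemma ofZD x y : ofZ (x + y)%Z = ofZ x + ofZ y.
Proof. by rewrite !ofZ_def -rmorphD /=; congr (_%:~R); lia. Qed.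

Lemma ofZM x y : ofZ (x * y)%Z = ofZ x * ofZ y.
Proof. by rewrite !ofZ_def -rmorphM /=; congr (_%:~R); lia. Qed.

Lemma ofZN x : ofZ (- x)%Z = - ofZ x.
Proof. by rewrite !ofZ_def -rmorphN /=; congr (_%:~R); lia. Qed.

Lemma ofZB x y : ofZ (x - y)%Z = ofZ x - ofZ y.
Proof. by rewrite /Z.sub ofZD ofZN. Qed.

Lemma ofZ_le x y : (ofZ x <= ofZ y) = (x <=? y)%Z.
Proof. by rewrite !ofZ_def ler_int; lia. Qed.

Lemma ofZ_lt x y : (ofZ x < ofZ y) = (x <? y)%Z.
Proof. by rewrite !ofZ_def ltr_int; lia. Qed.

Lemma ofZ0 : ofZ 0 = 0. Proof. by rewrite ofZ_def. Qed.
Lemma ofZ1 : ofZ 1 = 1. Proof. by rewrite ofZ_def. Qed.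

Lemma ofZ_of_nat n : ofZ (Z.of_nat n) = n%:R.
Proof. by rewrite ofZ_def -[RHS]/(n%:Z%:~R) -[n%:Z]Z_of_intK. Qed.

Lemma ofZX z n : ofZ (z ^ Z.of_nat n) = ofZ z ^+ n.
Proof.
elim: n => [|n IH]; first by rewrite expr0 -ofZ1.
rewrite exprS -IH Nat2Z.inj_succ Z.pow_succ_r; last exact: Nat2Z.is_nonneg.
by rewrite ofZM.
Qed.

Lemma ofZ_gt0 x : (0 < x)%Z -> 0 < ofZ x.
Proof. by rewrite -ofZ0 ofZ_lt; lia. Qed.

Lemma ofZ_ge0 x : (0 <= x)%Z -> 0 <= ofZ x.
Proof. by rewrite -ofZ0 ofZ_le; lia. Qed.

Lemma ofZ_div_le x d : (0 < d)%Z -> ofZ (x / d) <= ofZ x / ofZ d.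
Proof.
move=> d0; rewrite ler_pdivlMr ?ofZ_gt0// -ofZM ofZ_le.
by have := Z.mul_div_le x d d0; lia.
Qed.

Lemma ofZ_div_ge x d : (0 < d)%Z -> ofZ x / ofZ d <= ofZ (x / d) + 1.
Proof.
move=> d0; rewrite ler_pdivrMr ?ofZ_gt0// -ofZ1 -ofZD -ofZM ofZ_le.
by have := Z.mul_succ_div_gt x d d0; lia.
Qed.

(** Scale of the fixed-point numbers: [u] stands for [u / 2^48]. *)
Definition prec : Z := (2 ^ 48)%Z.

Definition sqfix (u : Z) : Z := Z.shiftr (u * u) 48.

Let sqfixE u : sqfix u = (u * u / prec)%Z.
Proof. by rewrite /sqfix Z.shiftr_div_pow2. Qed.

(* From [1 + y <= exp y] at [y = n / (d * 2^20)], raised to the power [2^20]. *)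
Definition explo (n d : Z) : Z :=
  let base := (prec + n * prec / (d * 2 ^ 20))%Z in
  if (base <? 0)%Z then 0%Z else ssrnat.iter 20 sqfix base.

(* The junk value [0] signals a failure of the lower bound on [exp (- n / d)]. *)
Definition exphi (n d : Z) : Z :=
  let e := explo (- n) d in if (e <=? 0)%Z then 0%Z else (prec * prec / e + 1)%Z.

Lemma sqfix_le (u : Z) (x : R) :
  (0 <= u)%Z -> ofZ u / ofZ prec <= x -> ofZ (sqfix u) / ofZ prec <= x ^+ 2.
Proof.
move=> u0 ux; have p0 : 0 < ofZ prec by exact: ofZ_gt0.
apply: (@le_trans _ _ ((ofZ u / ofZ prec) ^+ 2)); last first.
  by rewrite ler_pXn2r// ?nnegrE ?(le_trans _ ux) ?divr_ge0 ?ofZ_ge0 ?ltW.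
rewrite sqfixE expr2 mulrACA mulrA ler_pM2r ?invr_gt0//.
by rewrite (le_trans (ofZ_div_le _ _))// ofZM.
Qed.

Lemma explo_le (n d : Z) : (0 < d)%Z ->
  ofZ (explo n d) / ofZ prec <= expR (ofZ n / ofZ d).
Proof.
move=> d0; rewrite /explo; case: Z.ltb_spec => [_|b0].
  by rewrite ofZ0 mul0r expR_ge0.
set base := (prec + _)%Z in b0 *.
have p0 : 0 < ofZ prec by exact: ofZ_gt0.
have D0 : 0 < ofZ d by exact: ofZ_gt0.
(* Each squaring doubles the exponent; rounding down preserves a lower bound because the numbers
   stay nonnegative. *)
have step k (u : Z) (x : R) : (0 <= u)%Z -> ofZ u / ofZ prec <= expR x ->
    ofZ (ssrnat.iter k sqfix u) / ofZ prec <= expR (x * 2 ^+ k).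
  move=> u0 ux.
  suff: (0 <= ssrnat.iter k sqfix u)%Z /\
    ofZ (ssrnat.iter k sqfix u) / ofZ prec <= expR (x * 2 ^+ k) by case.
  elim: k => [|k [IH0 IH]]; first by rewrite expr0 mulr1.
  split=> /=; first by rewrite sqfixE; apply: Z.div_pos => //; nia.
  rewrite exprSr mulrA (_ : 2 = 1 + 1)// mulrDr mulr1 expRD -expr2.
  exact: sqfix_le.
have k20 : ofZ (2 ^ 20) = 2 ^+ 20.
  have two : ofZ 2 = 2 := ofZ_of_nat 2.
  by rewrite -two; exact: (ofZX 2 20).
have -> : ofZ n / ofZ d = ofZ n / ofZ (d * 2 ^ 20) * 2 ^+ 20.
  by rewrite ofZM k20 invfM -!mulrA mulVf ?mulr1// expf_neq0.
apply: step => //; apply: le_trans (expR_ge1Dx _).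
rewrite ofZD mulrDl divff ?gt_eqF// lerD2l ler_pdivrMr//.
rewrite (le_trans (ofZ_div_le _ _))//; first by lia.
by rewrite ofZM mulrAC.
Qed.

(** The reciprocal of a lower bound on [exp (- n / d)]; the [+ 1] in [exphi] absorbs the floor of
    the integer division. *)
Lemma exphi_ge (n d : Z) : (0 < d)%Z -> (0 < exphi n d)%Z ->
  expR (ofZ n / ofZ d) <= ofZ (exphi n d) / ofZ prec.
Proof.
move=> d0; rewrite /exphi; case: Z.leb_spec => // e0 _.
have p0 : 0 < ofZ prec by exact: ofZ_gt0.
have E0 := ofZ_gt0 e0; have := explo_le (- n) d0.
rewrite ofZN mulNr expRN ler_pdivrMr// mulrC ler_pdivlMr ?expR_gt0// => le.
rewrite ler_pdivlMr// ofZD ofZ1.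
apply: le_trans (ofZ_div_ge _ e0); rewrite ofZM ler_pdivlMr// mulrAC.
by rewrite ler_pM2r// mulrC.
Qed.

(* [rsqrt100 S] approximates [sqrt (100 / S)] from below, in units of [2^-20]. *)
Definition rsqrt100 (S : Z) : Z := Z.sqrt (100 * 2 ^ 40 / S).

Lemma rsqrt100_le (S : Z) : (0 < S)%Z ->
  ofZ (rsqrt100 S) / ofZ (2 ^ 20) <= Num.sqrt (ofZ 100 / ofZ S).
Proof.
move=> S0; have SS := ofZ_gt0 S0.
have p0 : 0 < ofZ (2 ^ 20) by exact: ofZ_gt0.
have q0 : (0 <= 100 * 2 ^ 40 / S)%Z by apply: Z.div_pos; lia.
have r0 := Z.sqrt_nonneg (100 * 2 ^ 40 / S).
rewrite -(@ler_pXn2r _ 2%N)// ?nnegrE ?sqrtr_ge0 ?divr_ge0 ?ofZ_ge0//.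
rewrite sqr_sqrtr ?divr_ge0 ?ofZ_ge0//; last by lia.
rewrite expr_div_n ler_pdivrMr ?exprn_gt0// mulrAC !expr2 -!ofZM.
rewrite (_ : 100 * (2 ^ 20 * 2 ^ 20) = 100 * 2 ^ 40)%Z//.
apply: le_trans (ofZ_div_le _ S0); rewrite ofZ_le; apply/Z.leb_spec0.
have [] := Z.sqrt_spec _ q0; rewrite /rsqrt100; lia.
Qed.

Lemma rsqrt100_ge (S : Z) : (0 < S)%Z ->
  Num.sqrt (ofZ 100 / ofZ S) <= ofZ (rsqrt100 S + 1) / ofZ (2 ^ 20).
Proof.
move=> S0; have SS := ofZ_gt0 S0.
have p0 : 0 < ofZ (2 ^ 20) by exact: ofZ_gt0.
have q0 : (0 <= 100 * 2 ^ 40 / S)%Z by apply: Z.div_pos; lia.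
have r0 := Z.sqrt_nonneg (100 * 2 ^ 40 / S).
rewrite -(@ler_pXn2r _ 2%N)// ?nnegrE ?sqrtr_ge0 ?divr_ge0 ?ofZ_ge0//; last first.
  by rewrite /rsqrt100; lia.
rewrite sqr_sqrtr ?divr_ge0 ?ofZ_ge0//; last by lia.
rewrite expr_div_n ler_pdivlMr ?exprn_gt0// mulrAC !expr2 -!ofZM.
rewrite (_ : 100 * (2 ^ 20 * 2 ^ 20) = 100 * 2 ^ 40)%Z//.
apply: le_trans (ofZ_div_ge _ S0) _; rewrite -ofZ1 -ofZD ofZ_le.
apply/Z.leb_spec0; have [] := Z.sqrt_spec _ q0; rewrite /rsqrt100; lia.
Qed.

End FixedPoint.

(** * The Bayes risk of a bounded normal mean *)

(* A finitely supported prior is a sequence of pairs (atom, weight); a bump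
   [(c, s)] stands for the function [c * exp (- s x^2 / 2)]. *)
Section Terms.
Variable A : pzRingType.
Implicit Types (p b : seq (A * A)).

(* A triple [(k, a, q)] stands for [k * exp (a x - q / 2)]; the sum over all pairs of
   atoms is the numerator of the posterior variance. *)
Fixpoint pairs p : seq (A * A * A) :=
  if p is (t, w) :: p' then
    [seq (w * u.2 * ((t - u.1) * (t - u.1)), t + u.1, t * t + u.1 * u.1)
       | u <- p'] ++ pairs p'
  else [::].

Definition terms (l : seq (A * A * A)) b : seq (A * A * A * A) :=
  [seq (m.1.1 * v.1, m.1.2, v.2, m.2) | m <- l, v <- b].

(* Since [1 / m >= 2 g - g^2 m], a posterior variance [W / m] is at least
   [2 g W - g^2 m W]: [terms1] expands [2 g W] and [terms2] expands [g^2 m W]. The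
   unit [one] of the rates is [1], or [100] in the scaled integer computation. *)
Definition terms1 (one : A) p b : seq (A * A * A * A) :=
  terms (pairs p) [seq (v.1 + v.1, one + v.2) | v <- b].

Definition terms2 (one : A) p b : seq (A * A * A * A) :=
  terms [seq (m.1.1 * t.2, m.1.2 + t.1, m.2 + t.1 * t.1) | m <- pairs p, t <- p]
        [seq (v.1 * v'.1, one + (v.2 + v'.2)) | v <- b, v' <- b].

End Terms.

Section Bayes.
Context {R : realType}.
Implicit Types (p b : seq (R * R)) (x : R).

(** Density of [N(t, 1)] relative to [N(0, 1)]. *)
Definition lik (t x : R) : R := expR (t * x - t ^+ 2 / 2).

Definition moment (k : nat) p x : R := \sum_(t <- p) t.2 * t.1 ^+ k * lik t.1 x.

(* Marginal density of the observation, relative to N(0, 1), times the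
   variance of the posterior. *)
Definition postvar p x : R :=
  (moment 2 p x * moment 0 p x - moment 1 p x ^+ 2) / moment 0 p x.

Definition is_prior p : Prop :=
  (forall t, t \in p -> 0 <= t.2) /\ \sum_(t <- p) t.2 = 1.

Lemma lik_gt0 t x : 0 < lik t x. Proof. exact: expR_gt0. Qed.

Lemma moment0_gt0 p x : is_prior p -> 0 < moment 0 p x.
Proof.
move=> [p0 p1]; rewrite lt_neqAle; apply/andP; split; last first.
  rewrite /moment big_seq sumr_ge0// => t tp.
  by rewrite expr0 mulr1 mulr_ge0 ?p0// ltW ?lik_gt0.
apply/negP => /eqP/esym/eqP; rewrite /moment big_seq psumr_eq0; last first.
  by move=> t tp; rewrite expr0 mulr1 mulr_ge0 ?p0// ltW ?lik_gt0.
move=> /allP h; have := oner_neq0 R; rewrite -p1 big_seq big1 ?eqxx// => t tp.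
have := h t tp; rewrite tp/= expr0 mulr1 mulf_eq0 (gt_eqF (lik_gt0 _ _)) orbF.
by move/eqP.
Qed.

Lemma moment_cons k t p x :
  moment k (t :: p) x = t.2 * t.1 ^+ k * lik t.1 x + moment k p x.
Proof. by rewrite /moment big_cons. Qed.

(** Lagrange's identity for the variance of a weighted sum: only pairs of distinct positions
    contribute, each with a nonnegative term. *)
Lemma moments_pairs p x :
  moment 2 p x * moment 0 p x - moment 1 p x ^+ 2 =
  \sum_(u <- pairs p) u.1.1 * expR (u.1.2 * x - u.2 / 2).
Proof.
elim: p => [|[t w] p IH]; first by rewrite /moment !big_nil expr2 !mul0r subrr.
rewrite /= big_cat big_map/= -IH !moment_cons/=.
have -> : \sum_(u <- p) w * u.2 * ((t - u.1) * (t - u.1)) *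
    expR ((t + u.1) * x - (t * t + u.1 * u.1) / 2) =
  w * lik t x * (t ^+ 2 * moment 0 p x - 2 * t * moment 1 p x + moment 2 p x).
  rewrite /moment !mulr_sumr -sumrB -big_split/= mulr_sumr.
  apply: eq_bigr => u _.
  have -> : (t + u.1) * x - (t * t + u.1 * u.1) / 2 =
    (t * x - t ^+ 2 / 2) + (u.1 * x - u.1 ^+ 2 / 2) by ring.
  rewrite expRD -/(lik t x) -/(lik u.1 x); ring.
by move: (moment 0 p x) (moment 1 p x) (moment 2 p x) => m0 m1 m2; ring.
Qed.

Lemma pairs_ge0 p u : (forall t, t \in p -> 0 <= t.2) ->
  u \in pairs p -> 0 <= u.1.1.
Proof.
elim: p => [//|[t w] p IH] p0 /=; rewrite mem_cat => /orP[/mapP[v vp ->]/=|].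
  apply: mulr_ge0; last by rewrite -expr2 sqr_ge0.
  apply: mulr_ge0; first by apply: (p0 (t, w)); rewrite mem_head.
  by apply: p0; rewrite in_cons vp orbT.
by move=> up; apply: (IH _ up) => v vp; apply: p0; rewrite in_cons vp orbT.
Qed.

Lemma variance_ge0 p x : (forall t, t \in p -> 0 <= t.2) ->
  0 <= moment 2 p x * moment 0 p x - moment 1 p x ^+ 2.
Proof.
move=> p0; rewrite moments_pairs big_seq sumr_ge0// => u up.
by rewrite mulr_ge0 ?expR_ge0// (pairs_ge0 p0).
Qed.

Lemma postvar_ge0 p x : is_prior p -> 0 <= postvar p x.
Proof.
by move=> pp; rewrite divr_ge0 ?variance_ge0 ?ltW ?moment0_gt0//; case: pp.
Qed.

(** The right side is a quadratic in [y], minimal at the posterior mean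
    [moment 1 p x / moment 0 p x], where it equals the left side. *)
Lemma postvar_le p x y : is_prior p ->
  postvar p x <= \sum_(t <- p) t.2 * lik t.1 x * (y - t.1) ^+ 2.
Proof.
move=> pp; have m0 := moment0_gt0 x pp.
have -> : \sum_(t <- p) t.2 * lik t.1 x * (y - t.1) ^+ 2 =
    y ^+ 2 * moment 0 p x - 2 * y * moment 1 p x + moment 2 p x.
  rewrite /moment !mulr_sumr -sumrB -big_split/=; apply: eq_bigr => t _; ring.
rewrite /postvar ler_pdivrMr//.
have := sqr_ge0 (y * moment 0 p x - moment 1 p x).
move: (moment 0 p x) (moment 1 p x) (moment 2 p x) => a c e; nra.
Qed.

Definition bumps b x : R := \sum_(v <- b) v.1 * expR (- (v.2 * x ^+ 2 / 2)).

(** The [- 1] takes out the quadratic part of the standard normal density, against which the term is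
    integrated; the product is a Gaussian of rate [m.1.2]. *)
Definition gterm (m : R * R * R * R) x : R :=
  m.1.1.1 * expR (m.1.1.2 * x - (m.1.2 - 1) * x ^+ 2 / 2 - m.2 / 2).

Lemma sum_terms l b x :
  \sum_(m <- terms l [seq (v.1, 1 + v.2) | v <- b]) gterm m x =
  (\sum_(u <- l) u.1.1 * expR (u.1.2 * x - u.2 / 2)) * bumps b x.
Proof.
rewrite /terms big_allpairs_dep big_distrl/=; apply: eq_bigr => u _.
rewrite big_map /bumps mulr_sumr; apply: eq_bigr => v _.
rewrite /gterm/= (_ : 1 + v.2 - 1 = v.2); last by ring.
have -> : u.1.2 * x - v.2 * x ^+ 2 / 2 - u.2 / 2 =
  (u.1.2 * x - u.2 / 2) + - (v.2 * x ^+ 2 / 2) by ring.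
rewrite expRD; ring.
Qed.

(** Amounts to [(g * f - 1) ^ 2 >= 0] for the marginal [f]. With no subtraction, both sides
    integrate as nonnegative functions. *)
Lemma postvar_terms p b x : is_prior p ->
  \sum_(m <- terms1 1 p b) gterm m x <=
  postvar p x + \sum_(m <- terms2 1 p b) gterm m x.
Proof.
move=> pp; have m0 := moment0_gt0 x pp; have W0 := variance_ge0 x pp.1.
set W := _ - _ in W0; set g := bumps b x; set f := moment 0 p x in m0.
have -> : \sum_(m <- terms1 1 p b) gterm m x = W * (2 * g).
  rewrite /terms1 (_ : [seq _ | v <- b] =
    [seq (v.1, 1 + v.2) | v <- [seq (v.1 + v.1, v.2) | v <- b]]); last first.
    by rewrite -map_comp.
  rewrite sum_terms -moments_pairs -/W; congr (_ * _).
  rewrite /bumps big_map mulr_sumr; apply: eq_bigr => v _ /=; ring.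
have -> : \sum_(m <- terms2 1 p b) gterm m x = W * g ^+ 2 * f.
  rewrite /terms2 (_ : [seq _ | v <- b, v' <- b] =
    [seq (v.1, 1 + v.2) |
       v <- [seq (v.1 * v'.1, v.2 + v'.2) | v <- b, v' <- b]]); last first.
    by rewrite map_allpairs.
  rewrite sum_terms mulrAC; congr (_ * _).
    rewrite big_allpairs_dep /W moments_pairs big_distrl/=; apply: eq_bigr => u _.
    rewrite /f /moment mulr_sumr; apply: eq_bigr => t _ /=.
    have -> : (u.1.2 + t.1) * x - (u.2 + t.1 * t.1) / 2 =
      (u.1.2 * x - u.2 / 2) + (t.1 * x - t.1 ^+ 2 / 2) by ring.
    rewrite expRD -/(lik t.1 x); ring.
  rewrite {1}/bumps big_allpairs_dep [g ^+ 2]expr2 {1}/g /bumps big_distrl/=.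
  apply: eq_bigr => v _; rewrite mulr_sumr; apply: eq_bigr => v' _ /=.
  have -> : - ((v.2 + v'.2) * x ^+ 2 / 2) =
    - (v.2 * x ^+ 2 / 2) + - (v'.2 * x ^+ 2 / 2) by ring.
  rewrite expRD; ring.
rewrite /postvar -/f -/W -lerBlDr.
have -> : W / f = W * f^-1 by [].
have -> : W * (2 * g) - W * g ^+ 2 * f = W * (2 * g - g ^+ 2 * f) by ring.
apply: ler_wpM2l => //; rewrite -[leRHS]mul1r ler_pdivlMr//.
have := sqr_ge0 (g * f - 1); nra.
Qed.

End Bayes.

(** * Integrals against normal laws *)

Section Density.
Local Open Scope ereal_scope.
Context d (T : measurableType d) (R : realType).
Variables (mu nu : {measure set T -> \bar R}) (g : T -> R).
Hypothesis mg : measurable_fun [set: T] g.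
Hypothesis g0 : forall x, (0 <= g x)%R.
Hypothesis nuE : forall A, measurable A -> nu A = \int[mu]_(x in A) (g x)%:E.

Import HBNNSimple.

(** Holds for simple functions by the hypothesis on [nu], then in general by monotone convergence on
    both sides. *)
Lemma ge0_integral_density (f : T -> \bar R) :
  measurable_fun [set: T] f -> (forall x, 0 <= f x) ->
  \int[nu]_x f x = \int[mu]_x (f x * (g x)%:E).
Proof.
move=> mf f0; pose f_ := nnsfun_approx measurableT mf.
transitivity (limn (fun n => \int[nu]_x (f_ n x)%:E)).
  rewrite -monotone_convergence//.
  - apply: eq_integral => y _; apply/esym/cvg_lim => //.
    exact: cvg_nnsfun_approx.
  - by move=> n; exact/measurable_EFinP/measurable_funP.
  - by move=> n y _; rewrite lee_fin.
  - by move=> y _ m n mn; rewrite lee_fin; exact/lefP/nd_nnsfun_approx.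
rewrite [X in limn X](_ : _ =
    (fun n => \int[mu]_x ((f_ n x)%:E * (g x)%:E))).
  rewrite -monotone_convergence//; last 3 first.
  - move=> n; apply: emeasurable_funM; first exact/measurable_EFinP/measurable_funP.
    exact/measurable_EFinP.
  - by move=> n x _; rewrite -EFinM lee_fin mulr_ge0.
  - move=> x _ m n mn; rewrite -!EFinM lee_fin ler_wpM2r//.
    exact/lefP/nd_nnsfun_approx.
  apply: eq_integral => x _; apply/cvg_lim => //.
  apply: cvgeZr => //; exact: cvg_nnsfun_approx.
apply/funext => n.
rewrite integralT_nnsfun sintegralE.
transitivity (\sum_(k \in range (f_ n))
    \int[mu]_x (k * \1_(f_ n @^-1` [set k]) x * g x)%:E).
  apply: eq_fsbigr => k _.
  have mk : measurable (f_ n @^-1` [set k]) by exact: measurable_sfunP.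
  have [k0|k0] := ltP k 0%R.
    rewrite preimage_nnfun0// measure0 mule0 integral0_eq// => x _.
    by rewrite indic0 mulr0 mul0r.
  under eq_integral do rewrite -mulrA EFinM.
  rewrite ge0_integralZl_EFin//; last 2 first.
  - by move=> x _; rewrite lee_fin mulr_ge0.
  - exact/measurable_EFinP/measurable_funM.
  congr (_ * _); rewrite nuE// [LHS]integral_mkcond.
  apply: eq_integral => x _; rewrite patchE indicE.
  by case: ifPn => _; rewrite ?mul1r ?mul0r.
under [RHS]eq_integral do rewrite -EFinM fimfunE.
rewrite -ge0_integral_fsum//.
- apply: eq_integral => x _; rewrite fsumEFin//; congr EFin.
  by rewrite mulr_fsuml.
- move=> k; apply/measurable_EFinP/measurable_funM => //.
  exact: measurable_funM.
- by move=> k x _; rewrite lee_fin mulr_ge0// -lee_fin EFinM nnfun_muleindic_ge0.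
Qed.

End Density.

Section LebesgueAffine.
Local Open Scope ereal_scope.
Context {R : realType}.
Notation leb := (@lebesgue_measure R).
Variables (a c : R).
Hypothesis c0 : (0 < c)%R.

Let aff (x : measurableTypeR R) : measurableTypeR R := (a + c * x)%R.

Let maff : measurable_fun setT aff.
Proof. by apply: measurable_funD => //; exact: measurable_funM. Qed.

Let image : {measure set (measurableTypeR R) -> \bar R} :=
  measure_function_pushforward__canonical__measure_function_Measure leb maff.

Lemma lebesgue_measure_affine (A : set (measurableTypeR R)) : measurable A ->
  leb A = mscale (NngNum (ltW c0)) image A.
Proof.
move=> mA; apply: lebesgue_measure_unique => //= _ [[x y]] _ <-.
rewrite /mscale/= /pushforward.
rewrite (_ : aff @^-1` _ =
    `]((x - a) / c)%R, ((y - a) / c)%R]%classic); last first.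
  apply/seteqP; split=> z /=; rewrite !in_itv/= /aff ltr_pdivrMr// ler_pdivlMr//;
    rewrite ltrBlDl lerBrDl mulrC//.
rewrite !lebesgue_measure_itv/= !lte_fin ltr_pM2r ?invr_gt0// ltrD2r.
case: ifPn => _; last by rewrite mule0.
rewrite -!EFinD -EFinM; congr EFin; field; exact: lt0r_neq0.
Qed.

Lemma ge0_integral_affine (f : R -> \bar R) :
  measurable_fun [set: R] f -> (forall x, 0 <= f x) ->
  \int[leb]_x f x = c%:E * \int[leb]_x f (a + c * x)%R.
Proof.
move=> mf f0.
transitivity (\int[mscale (NngNum (ltW c0)) image]_x f x).
  by apply: eq_measure_integral => /= A mA _; exact: lebesgue_measure_affine.
rewrite ge0_integral_mscale//=; congr (_ * _).
by rewrite ge0_integral_pushforward//= => y _; exact: f0.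
Qed.

End LebesgueAffine.

Section Normal.
Local Open Scope ereal_scope.
Context {R : realType}.
Notation leb := (@lebesgue_measure R).
Implicit Types (m s a b c x y : R) (f : R -> \bar R).

Lemma normal_pdfE' m s x : (s != 0)%R ->
  normal_pdf m s x = (normal_peak s * normal_fun m s x)%R.
Proof. by move=> s0; rewrite normal_pdfE. Qed.

Lemma integral_normal_prob m s f :
  measurable_fun [set: R] f -> (forall x, 0 <= f x) ->
  \int[normal_prob m s]_x f x = \int[leb]_x (f x * (normal_pdf m s x)%:E).
Proof.
move=> mf f0; apply: ge0_integral_density => //.
- exact: measurable_normal_pdf.
- by move=> x; exact: normal_pdf_ge0.
Qed.

Lemma integral_normal_affine s b m f : (0 < s)%R -> (0 < b)%R ->
  measurable_fun [set: R] f -> (forall x, 0 <= f x) ->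
  \int[normal_prob 0%R s]_x f (m + b * x)%R = \int[normal_prob m (b * s)%R]_x f x.
Proof.
move=> s0 b0 mf f0; have bs0 : (0 < b * s)%R by exact: mulr_gt0.
have maff : measurable_fun [set: R] (fun x : R => (m + b * x)%R).
  by apply: measurable_funD => //; exact: measurable_funM.
have mfa : measurable_fun [set: R] (fun x : R => f (m + b * x)%R).
  exact: (measurableT_comp mf).
rewrite (integral_normal_prob _ _ mfa (fun=> f0 _)).
rewrite (integral_normal_prob _ _ mf f0) [RHS](ge0_integral_affine m b0); last 2 first.
- apply: (emeasurable_funM mf); apply/measurable_EFinP.
  exact: measurable_normal_pdf.
- by move=> x; rewrite mule_ge0// lee_fin normal_pdf_ge0.
rewrite -ge0_integralZl_EFin//; last 3 first.
- by move=> x _; rewrite mule_ge0// lee_fin normal_pdf_ge0.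
- apply: (emeasurable_funM mfa); apply/measurable_EFinP.
  by apply: (measurableT_comp _ maff); exact: measurable_normal_pdf.
- exact: ltW.
apply: eq_integral => x _; rewrite muleCA -EFinM; congr (_ * _%:E).
rewrite !normal_pdfE' ?gt_eqF// mulrA; congr (_ * _)%R.
  rewrite /normal_peak.
  have -> : ((b * s) ^+ 2 * pi *+ 2 = b ^+ 2 * (s ^+ 2 * pi *+ 2))%R by ring.
  rewrite sqrtrM ?sqr_ge0// sqrtr_sqr gtr0_norm// invfM mulrA divff ?mul1r//.
  exact: lt0r_neq0.
rewrite /normal_fun; congr expR; field.
by rewrite !lt0r_neq0.
Qed.

(** One-dimensional Cameron-Martin formula: the factor is the density of [N(c, s^2)] relative to
    [N(0, s^2)]. *)
Lemma integral_normal_shift s c f : (0 < s)%R ->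
  measurable_fun [set: R] f -> (forall x, 0 <= f x) ->
  \int[normal_prob 0%R s]_x f (x + c)%R =
  \int[normal_prob 0%R s]_x
    (f x * (expR (c * x / s ^+ 2 - c ^+ 2 / (s ^+ 2 *+ 2)))%:E).
Proof.
move=> s0 mf f0.
have mE : measurable_fun [set: R]
    (fun x => expR (c * x / s ^+ 2 - c ^+ 2 / (s ^+ 2 *+ 2))).
  apply: measurableT_comp => //; apply: measurable_funB => //.
  by apply: measurable_funM => //; exact: measurable_funM.
transitivity (\int[normal_prob 0%R s]_x f (c + 1 * x)%R).
  by apply: eq_integral => x _; rewrite mul1r addrC.
rewrite (integral_normal_affine _ s0 ltr01 mf f0) mul1r.
rewrite (integral_normal_prob _ _ mf f0) integral_normal_prob.
- apply: eq_integral => x _; rewrite -muleA -EFinM; congr (_ * _%:E).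
  rewrite !normal_pdfE' ?gt_eqF// mulrCA; congr (_ * _)%R.
  rewrite /normal_fun -expRD; congr expR; field; exact: lt0r_neq0.
- by apply: emeasurable_funM => //; exact/measurable_EFinP.
- by move=> x; rewrite mule_ge0// lee_fin expR_ge0.
Qed.

Lemma integral_normal_opp s f : (0 < s)%R ->
  measurable_fun [set: R] f -> (forall x, 0 <= f x) ->
  \int[normal_prob 0%R s]_x f (- x)%R = \int[normal_prob 0%R s]_x f x.
Proof.
move=> s0 mf f0.
have mop : measurable_fun [set: R] (fun x : R => f (- x)%R).
  by apply: measurableT_comp => //.
have mp : measurable_fun [set: R] (fun x => (normal_pdf 0%R s x)%:E).
  by apply/measurable_EFinP; exact: measurable_normal_pdf.
rewrite (integral_normal_prob _ _ mop (fun=> f0 _)).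
rewrite (integral_normal_prob _ _ mf f0).
transitivity (\int[pushforward leb (-%R : measurableTypeR R -> measurableTypeR R)]_x
    (f x * (normal_pdf 0%R s x)%:E)).
  rewrite [RHS]ge0_integral_pushforward.
  - apply: eq_integral => x _ /=; rewrite /=; congr (_ * _%:E).
    by rewrite !normal_pdfE' ?gt_eqF// /normal_fun !subr0 sqrrN.
  - exact: oppr_measurable.
  - exact: measurableT.
  - exact: emeasurable_funM mf mp.
  - by move=> y _; rewrite mule_ge0// lee_fin normal_pdf_ge0.
by apply: eq_measure_integral => //= A mA _; exact: lebesgue_measureN.
Qed.

(** The joint density of [x] and [w = a x + b y] disintegrated both ways: law of [x] times [w] given
    [x], and law of [w] times [x] given [w]. *)
Lemma normal_pdf_conv s a b w x : (0 < s)%R -> (0 < b)%R ->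
  let c := Num.sqrt (a ^+ 2 + b ^+ 2) in
  (normal_pdf 0 s x * normal_pdf (a * x) (b * s) w =
   normal_pdf 0 (c * s) w * normal_pdf (a * w / c ^+ 2) (b * s / c) x)%R.
Proof.
move=> s0 b0 c.
have c20 : (0 < a ^+ 2 + b ^+ 2)%R by rewrite ltr_wpDl ?sqr_ge0// exprn_gt0.
have c0 : (0 < c)%R by rewrite sqrtr_gt0.
have c2 : (c ^+ 2 = a ^+ 2 + b ^+ 2)%R by rewrite sqr_sqrtr// ltW.
clearbody c.
have nn (y : R) : (0 <= y ^+ 2 * pi *+ 2)%R.
  by rewrite mulrn_wge0// mulr_ge0 ?sqr_ge0 ?pi_ge0.
rewrite !normal_pdfE' ?gt_eqF// ?divr_gt0 ?mulr_gt0//.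
rewrite mulrACA [RHS]mulrACA; congr (_ * _)%R.
  rewrite /normal_peak -!invfM -!sqrtrM ?nn//.
  congr (Num.sqrt _)^-1%R; field; exact: lt0r_neq0.
rewrite /normal_fun -!expRD; congr expR.
have -> : ((c * s) ^+ 2 = (a ^+ 2 + b ^+ 2) * s ^+ 2)%R by rewrite exprMn c2.
have -> : ((b * s / c) ^+ 2 = b ^+ 2 * s ^+ 2 / (a ^+ 2 + b ^+ 2))%R.
  by rewrite -c2; field; exact: lt0r_neq0.
rewrite c2; field; by rewrite !lt0r_neq0.
Qed.

(** Stability of the normal law: substitute [w = a x + b y], exchange the integrals by Tonelli, and
    integrate out [x] by [normal_pdf_conv]. *)
Lemma integral_normal_conv s a b f : (0 < s)%R ->
  measurable_fun [set: R] f -> (forall x, 0 <= f x) ->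
  \int[normal_prob 0%R s]_x \int[normal_prob 0%R s]_y f (a * x + b * y)%R =
  \int[normal_prob 0%R s]_x f (Num.sqrt (a ^+ 2 + b ^+ 2) * x)%R.
Proof.
move=> s0 mf f0.
have mlin (u v : R) : measurable_fun [set: R] (fun x : R => (u + v * x)%R).
  by apply: measurable_funD => //; exact: measurable_funM.
wlog b0 : b / (0 <= b)%R.
  move=> wl; have [b0|b0] := leP 0%R b; first exact: wl.
  have Nb0 : (0 <= - b)%R by rewrite oppr_ge0 ltW.
  have := wl _ Nb0; rewrite sqrrN => <-; apply: eq_integral => x _.
  rewrite -(integral_normal_opp s0 _ (fun=> f0 _)); last first.
    exact: (measurableT_comp mf (mlin _ _)).
  by apply: eq_integral => y _; rewrite mulrN mulNr.
(* At [b = 0] the variable [w] has no density given [x], so this case is direct. *)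
move: b0; rewrite le_eqVlt => /predU1P[<-|b0].
  rewrite expr0n addr0 sqrtr_sqr.
  transitivity (\int[normal_prob 0%R s]_x f (a * x)%R).
    apply: eq_integral => x _.
    under eq_integral do rewrite mul0r addr0.
    by rewrite integral_cst//= probability_setT mule1.
  have [a0|a0] := leP 0%R a; first by rewrite ger0_norm.
  rewrite ltr0_norm// -(integral_normal_opp s0 _ (fun=> f0 _)); last first.
    by apply: (measurableT_comp mf); exact: measurable_funM.
  by apply: eq_integral => y _; rewrite mulrN mulNr.
set c := Num.sqrt _.
have c0 : (0 < c)%R by rewrite sqrtr_gt0 ltr_wpDl ?sqr_ge0// exprn_gt0.
transitivity (\int[normal_prob 0%R s]_x f (0 + c * x)%R); last first.
  by apply: eq_integral => x _; rewrite add0r.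
rewrite (integral_normal_affine _ s0 c0 mf f0) (integral_normal_prob _ _ mf f0).
have bs0 : (b * s != 0)%R by rewrite mulf_neq0 ?gt_eqF.
have mpdf : measurable_fun [set: R * R] (fun z : R * R =>
    (normal_pdf 0 s z.1 * normal_pdf (a * z.1) (b * s) z.2)%:E).
  apply/measurable_EFinP; apply: measurable_funM.
    apply: measurableT_comp; [exact: measurable_normal_pdf|exact: measurable_fst].
  under eq_fun do rewrite normal_pdfE'//.
  apply: measurable_funM => //; apply: measurableT_comp => //.
  apply: measurable_funM => //; apply: measurableT_comp => //.
  apply: measurable_funX; apply: measurable_funB => //.
  exact: measurable_funM.
transitivity (\int[leb]_x \int[leb]_w (f w *
    (normal_pdf 0 s x * normal_pdf (a * x) (b * s) w)%:E)).
  have mF : measurable_fun [set: R]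
      (fun x => \int[normal_prob 0%R s]_y f (a * x + b * y)%R).
    apply: (@measurable_fun_fubini_tonelli_F _ _ _ _ _ (normal_prob 0%R s)
      (fun z : R * R => f (a * z.1 + b * z.2)%R)) => //.
    apply: (measurableT_comp mf); apply: measurable_funD; exact: measurable_funM.
  rewrite (integral_normal_prob _ _ mF); last by move=> x; apply: integral_ge0.
  apply: eq_integral => x _.
  rewrite (integral_normal_affine _ s0 b0 mf f0) (integral_normal_prob _ _ mf f0).
  rewrite -ge0_integralZr//=; last 3 first.
  - by apply: (emeasurable_funM mf); apply/measurable_EFinP; exact: measurable_normal_pdf.
  - by move=> w _; rewrite mule_ge0// lee_fin normal_pdf_ge0.
  - by rewrite lee_fin normal_pdf_ge0.
  by apply: eq_integral => w _; rewrite -muleA -EFinM mulrC.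
transitivity (\int[leb]_w \int[leb]_x (f w *
    (normal_pdf 0 s x * normal_pdf (a * x) (b * s) w)%:E)).
  apply: (@fubini_tonelli _ _ _ _ R leb leb (fun z : R * R => f z.2 *
    (normal_pdf 0 s z.1 * normal_pdf (a * z.1) (b * s) z.2)%:E)).
  - apply: emeasurable_funM => //; exact: (measurableT_comp mf).
  - by move=> z; rewrite mule_ge0// lee_fin mulr_ge0// normal_pdf_ge0.
apply: eq_integral => w _.
under eq_integral do rewrite normal_pdf_conv// EFinM muleA.
rewrite -/c ge0_integralZl//=; last 3 first.
- by apply/measurable_EFinP; exact: measurable_normal_pdf.
- by move=> x _; rewrite lee_fin normal_pdf_ge0.
- by rewrite mule_ge0// lee_fin normal_pdf_ge0.
by rewrite integral_normal_pdf mule1.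
Qed.

End Normal.

(** * Evaluation of the Bayes bound by Gaussian integrals *)

Section BayesRisk.
Context {R : realType}.
Implicit Types (p b : seq (R * R)) (x : R).

Lemma measurable_lik t : measurable_fun [set: R] (@lik R t).
Proof.
apply: measurableT_comp => //; exact: measurable_funB.
Qed.

Lemma measurable_moment k p : measurable_fun [set: R] (moment k p).
Proof.
rewrite /moment.
apply: measurable_sum => t; apply: measurable_funM => //.
exact: measurable_lik.
Qed.

Lemma measurable_postvar p : is_prior p -> measurable_fun [set: R] (postvar p).
Proof.
move=> pp; rewrite /postvar.
(* The marginal is positive, so its reciprocal is [exp (- ln)], a composition of measurable
   functions. *)
have -> : (fun x => (moment 2 p x * moment 0 p x - moment 1 p x ^+ 2) /
    moment 0 p x) = (fun x => (moment 2 p x * moment 0 p x - moment 1 p x ^+ 2) *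
    expR (- ln (moment 0 p x))).
  by apply/funext => x; rewrite expRN lnK// posrE moment0_gt0.
apply: measurable_funM.
  by apply: measurable_funB; [apply: measurable_funM|apply: measurable_funX];
    exact: measurable_moment.
apply: measurableT_comp => //; apply: measurableT_comp => //.
apply: measurableT_comp; first exact: measurable_ln.
exact: measurable_moment.
Qed.

Definition gval (m : R * R * R * R) : R :=
  m.1.1.1 * (Num.sqrt (m.1.2^-1) * expR (m.1.1.2 ^+ 2 / (2 * m.1.2) - m.2 / 2)).

Lemma measurable_gterm m : measurable_fun [set: R] (@gterm R m).
Proof.
apply: measurable_funM => //; apply: measurableT_comp => //.
apply: measurable_funB => //; apply: measurable_funB; first exact: measurable_funM.
by apply: measurable_funM => //; apply: measurable_funM => //; exact: measurable_funX.
Qed.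

(** Completing the square makes the integrand a multiple of the density of [N(a / S, 1 / S)]. *)
Lemma integral_gterm m : 0 <= m.1.1.1 -> 0 < m.1.2 ->
  (\int[normal_prob 0 1]_x (gterm m x)%:E)%E = (gval m)%:E.
Proof.
case: m => [[[K a] S] q]; rewrite /gterm/gval/= => K0 S0.
have S'0 : S != 0 by exact: lt0r_neq0.
have mE := measurable_gterm (K, a, S, q); rewrite /gterm/= in mE.
rewrite integral_normal_prob; last 2 first.
- exact/measurable_EFinP.
- by move=> x; rewrite lee_fin mulr_ge0// expR_ge0.
set v := Num.sqrt S^-1.
have v0 : 0 < v by rewrite sqrtr_gt0 invr_gt0.
have v2 : v ^+ 2 = S^-1 by rewrite sqr_sqrtr// invr_ge0 ltW.
transitivity (\int[lebesgue_measure]_x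
  ((K * (v * expR (a ^+ 2 / (2 * S) - q / 2)))%:E * (normal_pdf (a / S) v x)%:E))%E.
  apply: eq_integral => x _; rewrite -!EFinM; congr EFin.
  rewrite -2!(mulrA K); congr (K * _).
  rewrite !normal_pdfE' ?gt_eqF ?oner_neq0//.
  have -> : normal_peak v = v^-1 * normal_peak 1.
    rewrite /normal_peak expr1n mul1r -mulrnAr sqrtrM ?sqr_ge0//.
    by rewrite sqrtr_sqr gtr0_norm// invfM.
  have e : expR (a * x - (S - 1) * x ^+ 2 / 2 - q / 2) * normal_fun 0 1 x =
      expR (a ^+ 2 / (2 * S) - q / 2) * normal_fun (a / S) v x.
    rewrite /normal_fun -!expRD v2; congr expR; field; exact: lt0r_neq0.
  by rewrite [LHS]mulrCA e; field; exact: lt0r_neq0.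
rewrite ge0_integralZl_EFin//.
- by rewrite integral_normal_pdf mule1.
- by move=> x _; rewrite lee_fin normal_pdf_ge0.
- by apply/measurable_EFinP; exact: measurable_normal_pdf.
- by rewrite !mulr_ge0// ?expR_ge0 ?ltW.
Qed.

Definition wf_bumps b : Prop := forall v, v \in b -> 0 <= v.1 /\ 0 <= v.2.

Lemma terms1_ge0 p b m : is_prior p -> wf_bumps b -> m \in terms1 1 p b ->
  0 <= m.1.1.1 /\ 0 < m.1.2.
Proof.
move=> [p0 _] b0 /allpairsP[[u v] /= [up /mapP[w /b0[w1 w2] ->] ->]] /=.
by split; [rewrite mulr_ge0 ?addr_ge0// (pairs_ge0 p0)|rewrite ltr_wpDr].
Qed.

Lemma terms2_ge0 p b m : is_prior p -> wf_bumps b -> m \in terms2 1 p b ->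
  0 <= m.1.1.1 /\ 0 < m.1.2.
Proof.
move=> [p0 _] b0 /allpairsP[[u v] /=]; rewrite /allpairs_dep/=.
move=> [/allpairsP[[u' t] /= [up tp ->]] /allpairsP[[w w'] /= []]].
move=> /b0[? ?] /b0[? ?] -> ->/=; split; last by rewrite ltr_wpDr// addr_ge0.
by rewrite !mulr_ge0// ?(pairs_ge0 p0)// p0.
Qed.

Lemma integral_sum_gterm (l : seq (R * R * R * R)) :
  (forall m, m \in l -> 0 <= m.1.1.1 /\ 0 < m.1.2) ->
  (\int[normal_prob 0 1]_x (\sum_(m <- l) gterm m x)%:E)%E =
  (\sum_(m <- l) gval m)%:E.
Proof.
elim: l => [|m l IH] l0.
  rewrite big_nil; under eq_integral do rewrite big_nil; exact: integral0.
have [m1 m2] := l0 m (mem_head _ _).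
under eq_integral do rewrite big_cons EFinD.
rewrite big_cons EFinD ge0_integralD//.
- by rewrite integral_gterm// IH// => m' m'l; apply: l0; rewrite in_cons m'l orbT.
- by move=> x _; rewrite lee_fin mulr_ge0// expR_ge0.
- by apply/measurable_EFinP; exact: measurable_gterm.
- move=> x _; rewrite lee_fin big_seq sumr_ge0// => m' m'l.
  have [? _] : 0 <= m'.1.1.1 /\ 0 < m'.1.2 by apply: l0; rewrite in_cons m'l orbT.
  by rewrite mulr_ge0// expR_ge0.
- apply/measurable_EFinP; apply: measurable_sum => m'; exact: measurable_gterm.
Qed.

Definition bayes_bound p b : R :=
  \sum_(m <- terms1 1 p b) gval m - \sum_(m <- terms2 1 p b) gval m.

Lemma bayes_bound_le p b : is_prior p -> wf_bumps b ->
  ((bayes_bound p b)%:E <= \int[normal_prob 0 1]_x (postvar p x)%:E)%E.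
Proof.
move=> pp b0; rewrite /bayes_bound EFinB leeBlDr//.
have t1 m := @terms1_ge0 _ _ m pp b0; have t2 m := @terms2_ge0 _ _ m pp b0.
rewrite -!integral_sum_gterm// -ge0_integralD//.
- apply: ge0_le_integral => //.
  + move=> x _; rewrite lee_fin big_seq sumr_ge0// => m /t1[? _].
    by rewrite mulr_ge0// expR_ge0.
  + apply/measurable_EFinP; apply: measurable_sum => m; exact: measurable_gterm.
  + apply: emeasurable_funD; apply/measurable_EFinP; first exact: measurable_postvar.
    by apply: measurable_sum => m; exact: measurable_gterm.
  + by move=> x _; rewrite -EFinD lee_fin postvar_terms.
- by move=> x _; rewrite lee_fin postvar_ge0.
- by apply/measurable_EFinP; exact: measurable_postvar.
- move=> x _; rewrite lee_fin big_seq sumr_ge0// => m /t2[? _].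
  by rewrite mulr_ge0// expR_ge0.
- apply/measurable_EFinP; apply: measurable_sum => m; exact: measurable_gterm.
Qed.

End BayesRisk.

(** * A certified table of priors *)

Definition sumZ (l : seq Z) : Z := foldr Z.add 0%Z l.

(* In a term [(k, a, s, q)], [a] is in units of 1/2000, [s] in units of 1/100 and
   [q] in units of 1/2000^2. *)
Definition expo (m : Z * Z * Z * Z) : Z * Z :=
  let: (_, a, s, q) := m in (100 * (a * a) - q * s, 8000000 * s)%Z.

Definition term_lo (m : Z * Z * Z * Z) : Z :=
  (m.1.1.1 * (explo (expo m).1 (expo m).2 * rsqrt100 m.1.2))%Z.

Definition term_hi (m : Z * Z * Z * Z) : Z :=
  (m.1.1.1 * (exphi (expo m).1 (expo m).2 * (rsqrt100 m.1.2 + 1)))%Z.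

Definition term_ok (m : Z * Z * Z * Z) : bool :=
  (0 <=? m.1.1.1)%Z && (0 <? m.1.2)%Z.

(** The integral of a term depends on [a] only through its square, so the mirror images produced by
    a symmetric prior can share one exponential. *)
Fixpoint insert (m : Z * Z * Z * Z) (l : seq (Z * Z * Z * Z)) :=
  if l is m' :: l' then
    if [&& m'.1.1.2 * m'.1.1.2 =? m.1.1.2 * m.1.1.2, m'.1.2 =? m.1.2 & m'.2 =? m.2]%Z
    then (m.1.1.1 + m'.1.1.1, m.1.1.2, m.1.2, m.2)%Z :: l' else m' :: insert m l'
  else [:: m].

Definition merge_terms (l : seq (Z * Z * Z * Z)) := foldr insert [::] l.

(** Common denominator of the [terms2] bounds: three weights, two bump coefficients and one squared
    distance of atoms give [1000^5 * 2000^2 = 4 * 10^21]; the rest is the scale of the exponential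
    and of the root. In [terms1] one weight and one coefficient fewer occur, whence the factor
    [10^6] in [check_bound]. *)
Definition row_unit : Z := (4 * 10 ^ 21 * (prec * 2 ^ 20))%Z.

(** Certifies a Bayes risk of at least [num / den]; the positivity of [hi] excludes the junk value
    of [exphi]. *)
Definition check_bound (T : Z) (p b : seq (Z * Z)) (num den : Z) : bool :=
  let l1 := merge_terms (terms1 100%Z p b) in
  let l2 := merge_terms (terms2 100%Z p b) in
  let hi := map term_hi l2 in
  [&& all (fun t => (Z.abs t.1 <=? T) && (0 <=? t.2))%Z p,
      (sumZ (map snd p) =? 1000)%Z,
      all (fun v => (0 <=? v.1) && (0 <=? v.2))%Z b,
      all term_ok l1, all term_ok l2, all (Z.ltb 0) hi &
      (num * row_unit <=? den * (10 ^ 6 * sumZ (map term_lo l1) - sumZ hi))%Z].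

(* Each row lists atoms (in units of 1/2000) with weights (1/1000), bumps with
   coefficients (1/1000) and rates (1/100), and the half-width up to which the
   resulting bound suffices, where the next row takes over. *)
Definition table : seq (seq (Z * Z) * seq (Z * Z) * Z) := (
  [::
    ([:: (2400, 428); ((-2400), 428); (0, 144)], [:: (843, 42); (934, 154)], 2528);
    ([:: (2528, 404); ((-2528), 404); (0, 192)], [:: (830, 43); (964, 147)], 2621);
    ([:: (2621, 390); ((-2621), 390); (0, 220)], [:: (802, 43); (1009, 142)], 2693);
    ([:: (2693, 379); ((-2693), 379); (0, 242)], [:: (797, 44); (1020, 137)], 2750);
    ([:: (2750, 372); ((-2750), 372); (0, 256)], [:: (777, 44); (1051, 134)], 2798);
    ([:: (2798, 366); ((-2798), 366); (0, 268)], [:: (758, 44); (1077, 131)], 2838);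
    ([:: (2838, 361); ((-2838), 361); (0, 278)], [:: (745, 44); (1096, 129)], 2873);
    ([:: (2873, 357); ((-2873), 357); (0, 286)], [:: (731, 44); (1115, 127)], 2904);
    ([:: (2904, 354); ((-2904), 354); (0, 292)], [:: (716, 44); (1136, 125)], 2932);
    ([:: (2932, 351); ((-2932), 351); (0, 298)], [:: (702, 44); (1154, 123)], 2957);
    ([:: (2957, 348); ((-2957), 348); (0, 304)], [:: (695, 44); (1164, 122)], 2980);
    ([:: (2980, 346); ((-2980), 346); (0, 308)], [:: (679, 44); (1183, 120)], 3001);
    ([:: (3001, 344); ((-3001), 344); (0, 312)], [:: (670, 44); (1195, 119)], 3021);
    ([:: (3021, 342); ((-3021), 342); (0, 316)], [:: (662, 44); (1206, 118)], 3040);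
    ([:: (3040, 340); ((-3040), 340); (0, 320)], [:: (654, 44); (1217, 117)], 3058);
    ([:: (3058, 339); ((-3058), 339); (0, 322)], [:: (642, 44); (1233, 116)], 3075);
    ([:: (3075, 337); ((-3075), 337); (0, 326)], [:: (635, 44); (1241, 115)], 3091);
    ([:: (3091, 336); ((-3091), 336); (0, 328)], [:: (624, 44); (1255, 114)], 3107);
    ([:: (3107, 335); ((-3107), 335); (0, 330)], [:: (614, 44); (1269, 113)], 3123);
    ([:: (3123, 333); ((-3123), 333); (0, 334)], [:: (607, 44); (1276, 112)], 3138);
    ([:: (3138, 332); ((-3138), 332); (0, 336)], [:: (596, 44); (1289, 111)], 3153);
    ([:: (3153, 331); ((-3153), 331); (0, 338)], [:: (585, 44); (1303, 110)], 3168);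
    ([:: (3168, 330); ((-3168), 330); (0, 340)], [:: (582, 44); (1310, 110)], 3183);
    ([:: (3183, 329); ((-3183), 329); (0, 342)], [:: (571, 44); (1323, 109)], 3198);
    ([:: (3198, 328); ((-3198), 328); (0, 344)], [:: (542, 43); (1358, 108)], 3213);
    ([:: (3213, 327); ((-3213), 327); (0, 346)], [:: (531, 43); (1371, 107)], 3228);
    ([:: (3228, 326); ((-3228), 326); (0, 348)], [:: (519, 43); (1384, 106)], 3243);
    ([:: (3243, 324); ((-3243), 324); (0, 352)], [:: (521, 43); (1383, 106)], 3259);
    ([:: (3259, 323); ((-3259), 323); (0, 354)], [:: (509, 43); (1398, 105)], 3275);
    ([:: (3275, 322); ((-3275), 322); (0, 356)], [:: (497, 43); (1412, 104)], 3292);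
    ([:: (3292, 321); ((-3292), 321); (0, 358)], [:: (467, 42); (1447, 103)], 3309);
    ([:: (3309, 320); ((-3309), 320); (0, 360)], [:: (454, 42); (1462, 102)], 3327);
    ([:: (3327, 319); ((-3327), 319); (0, 362)], [:: (441, 42); (1478, 101)], 3346);
    ([:: (3346, 318); ((-3346), 318); (0, 364)], [:: (427, 42); (1496, 100)], 3366);
    ([:: (3366, 316); ((-3366), 316); (0, 368)], [:: (411, 41); (1516, 100)], 3387);
    ([:: (3387, 315); ((-3387), 315); (0, 370)], [:: (396, 41); (1535, 99)], 3409);
    ([:: (3409, 314); ((-3409), 314); (0, 372)], [:: (381, 41); (1554, 98)], 3433);
    ([:: (3433, 313); ((-3433), 313); (0, 374)], [:: (351, 40); (1591, 97)], 3459);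
    ([:: (3459, 311); ((-3459), 311); (0, 378)], [:: (337, 40); (1606, 96)], 3487);
    ([:: (3487, 310); ((-3487), 310); (0, 380)], [:: (307, 39); (1645, 95)], 3517);
    ([:: (3517, 308); ((-3517), 308); (0, 384)], [:: (281, 38); (1676, 94)], 3550);
    ([:: (3550, 307); ((-3550), 307); (0, 386)], [:: (240, 37); (1722, 92)], 3586);
    ([:: (3586, 305); ((-3586), 305); (0, 390)], [:: (215, 36); (1755, 91)], 3625);
    ([:: (3625, 303); ((-3625), 303); (0, 394)], [:: (190, 35); (1787, 90)], 3668);
    ([:: (3668, 301); ((-3668), 301); (0, 398)], [:: (165, 34); (1821, 89)], 3715);
    ([:: (3715, 300); ((-3715), 300); (0, 400)], [:: (138, 33); (1861, 88)], 3767);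
    ([:: (3767, 298); ((-3767), 298); (0, 404)], [:: (110, 31); (1901, 87)], 3824);
    ([:: (3824, 296); ((-3824), 296); (0, 408)], [:: (93, 29); (1938, 87)], 3886);
    ([:: (3886, 294); ((-3886), 294); (0, 412)], [:: (70, 27); (1976, 86)], 3953);
    ([:: (3953, 292); ((-3953), 292); (0, 416)], [:: (50, 25); (2011, 85)], 4023);
    ([:: (4023, 290); ((-4023), 290); (0, 420)], [:: (40, 23); (2046, 85)], 4095);
    ([:: (4095, 288); ((-4095), 288); (0, 424)], [:: (24, 20); (2075, 84)], 4165);
    ([:: (4165, 287); ((-4165), 287); (0, 426)], [:: (17, 18); (2108, 84)], 4229);
    ([:: (4229, 285); ((-4229), 285); (0, 430)], [:: (13, 16); (2132, 84)], 4284);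
    ([:: (4284, 284); ((-4284), 284); (0, 432)], [:: (10, 15); (2154, 84)], 4328);
    ([:: (4328, 259); ((-4328), 259); (946, 241); ((-946), 241)], [:: (2088, 86); (51, 30)], 4435);
    ([:: (4435, 250); ((-4435), 250); (1069, 250); ((-1069), 250)], [:: (2107, 86); (49, 31)], 4568);
    ([:: (4568, 240); ((-4568), 240); (1197, 260); ((-1197), 260)], [:: (2132, 86); (45, 32)], 4743);
    ([:: (4743, 229); ((-4743), 229); (1338, 271); ((-1338), 271)], [:: (2173, 87); (49, 34)], 4994);
    ([:: (4994, 215); ((-4994), 215); (1504, 285); ((-1504), 285)], [:: (2224, 87); (43, 36)], 5401);
    ([:: (5401, 198); ((-5401), 198); (1719, 302); ((-1719), 302)], [:: (2319, 87); (28, 37)], 6202);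
    ([:: (6202, 179); ((-6202), 179); (2041, 321); ((-2041), 321)], [:: (2516, 87); (4, 34)], 8345)])%Z.

(** Its Bayes risk reaches [4 / 5] itself, which is above [4 / 5] of any linear risk, so it serves
    all larger half-widths. *)
Definition last_row : seq (Z * Z) * seq (Z * Z) := (
  ([:: (8345, 118); ((-8345), 118); (4105, 237); ((-4105), 237); (0, 290)], [:: (2953, 90)]))%Z.

(** A row is compared with the linear risk at the right end [T'] of its interval, where that risk is
    largest. *)
Fixpoint check_table (T : Z) (rows : seq (seq (Z * Z) * seq (Z * Z) * Z)) : bool :=
  if rows is (p, b, T') :: rows' then
    check_bound T p b (4 * (T' * T')) (5 * (2000 * 2000 + T' * T')) &&
    check_table T' rows'
  else check_bound T last_row.1 last_row.2 4 5.

Lemma check_table_ok : check_table 2400 table.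
Proof. by vm_cast_no_check (erefl true). Qed.

Section CheckBound.
Context {R : realType}.

Definition atomZ (t : Z * Z) : R * R := (ofZ t.1 / 2000, ofZ t.2 / 1000).
Definition bumpZ (v : Z * Z) : R * R := (ofZ v.1 / 1000, ofZ v.2 / 100).

Definition scale (c : R) (m : Z * Z * Z * Z) : R * R * R * R :=
  (ofZ m.1.1.1 / c, ofZ m.1.1.2 / 2000, ofZ m.1.2 / 100, ofZ m.2 / 2000 ^+ 2).

Lemma pairs_atomZ (p : seq (Z * Z)) :
  pairs (map atomZ p) = [seq (ofZ u.1.1 / (10 ^+ 6 * 2000 ^+ 2), ofZ u.1.2 / 2000,
    ofZ u.2 / 2000 ^+ 2) | u <- pairs p].
Proof.
elim: p => [//|[t w] p IH] /=; rewrite map_cat -IH; congr (_ ++ _).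
rewrite -!map_comp; apply: eq_map => u /=.
(* [pairs] over [Z] is built from the operations of the ring structure, so the morphism laws are
   restated for these. *)
have ofZm : forall x y : Z, ofZ (x * y)%R = ofZ x * ofZ y :> R by exact: ofZM.
have ofZd : forall x y : Z, ofZ (x + y)%R = ofZ x + ofZ y :> R by exact: ofZD.
have ofZn : forall x : Z, ofZ (- x)%R = - ofZ x :> R by exact: ofZN.
by rewrite !(ofZm, ofZd, ofZn); congr (_, _, _); field.
Qed.

Let ofZm (x y : Z) : ofZ (x * y)%R = ofZ x * ofZ y :> R.
Proof. exact: ofZM. Qed.
Let ofZd (x y : Z) : ofZ (x + y)%R = ofZ x + ofZ y :> R.
Proof. exact: ofZD. Qed.
Let ofZ100 : ofZ 100 = 100 :> R. Proof. exact: (ofZ_of_nat 100). Qed.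

Lemma terms1_atomZ (p b : seq (Z * Z)) :
  terms1 1 (map atomZ p) (map bumpZ b) =
  map (scale (4 * 10 ^+ 15)) (terms1 100%Z p b).
Proof.
rewrite /terms1 /terms pairs_atomZ allpairs_mapl map_allpairs !allpairs_mapr.
apply: eq_allpairs => u v /=.
by rewrite /scale/= !(ofZm, ofZd) ofZ100; congr (_, _, _, _); field.
Qed.

Lemma terms2_atomZ (p b : seq (Z * Z)) :
  terms2 1 (map atomZ p) (map bumpZ b) =
  map (scale (4 * 10 ^+ 21)) (terms2 100%Z p b).
Proof.
have eA : [seq (m.1.1 * t.2, m.1.2 + t.1, m.2 + t.1 * t.1) |
      m <- pairs (map atomZ p), t <- map atomZ p] =
    [seq (ofZ m.1.1 / (10 ^+ 9 * 2000 ^+ 2), ofZ m.1.2 / 2000, ofZ m.2 / 2000 ^+ 2) |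
      m <- [seq (u.1.1 * t.2, u.1.2 + t.1, u.2 + t.1 * t.1) | u <- pairs p, t <- p]].
  rewrite pairs_atomZ allpairs_mapl allpairs_mapr map_allpairs.
  apply: eq_allpairs => u t /=.
  by rewrite !(ofZm, ofZd); congr (_, _, _); field.
have eB : [seq (v.1 * v'.1, 1 + (v.2 + v'.2)) | v <- map bumpZ b, v' <- map bumpZ b] =
    [seq (ofZ v.1 / 10 ^+ 6, ofZ v.2 / 100) |
      v <- [seq (v.1 * v'.1, 100%Z + (v.2 + v'.2)) | v <- b, v' <- b]].
  rewrite allpairs_mapl allpairs_mapr map_allpairs; apply: eq_allpairs => u t /=.
  by rewrite !(ofZm, ofZd) ofZ100; congr (_, _); field.
rewrite /terms2 eA eB.
move: [seq _ | _ <- pairs p, _ <- p] [seq _ | _ <- b, _ <- b] => l1 l2.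
rewrite /terms allpairs_mapl allpairs_mapr map_allpairs.
apply: eq_allpairs => u v /=.
by rewrite /scale/= !ofZm; congr (_, _, _, _); field.
Qed.

Let dyad : R := ofZ (prec * 2 ^ 20).

Let dyad_gt0 : 0 < dyad. Proof. exact: ofZ_gt0. Qed.

Lemma gval_scale c m : 0 < c -> (0 < m.1.2)%Z ->
  gval (scale c m) = ofZ m.1.1.1 / c *
    (Num.sqrt (ofZ 100 / ofZ m.1.2) * expR (ofZ (expo m).1 / ofZ (expo m).2)).
Proof.
case: m => [[[k a] s] q] c0 s0.
have -> : (expo (k, a, s, q)).1 = (100 * (a * a) - q * s)%Z by [].
have -> : (expo (k, a, s, q)).2 = (8000000 * s)%Z by [].
rewrite /gval /scale [_.1.1.1]/= [_.1.1.2]/= [_.1.2]/= [_.2]/= ofZB !ofZM ofZ100.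
rewrite invf_div; congr (_ * (_ * expR _)).
have -> : ofZ 8000000 = 2 * 2000 ^+ 2 :> R.
  rewrite -[8000000%Z]/(2 * (2000 * 2000))%Z !ofZM expr2.
  by congr (_ * (_ * _)); [exact: (ofZ_of_nat 2)|..]; exact: (ofZ_of_nat 2000).
by rewrite [X in _ - X / 2]/=; field; rewrite lt0r_neq0// ofZ_gt0.
Qed.

Let expo2_gt0 (m : Z * Z * Z * Z) : (0 < m.1.2)%Z -> (0 < (expo m).2)%Z.
Proof.
by case: m => [[[k a] s] q] s0; rewrite -[(expo _).2]/(8000000 * s)%Z; exact: Z.mul_pos_pos.
Qed.

Lemma term_lo_le c m : 0 < c -> term_ok m ->
  ofZ (term_lo m) / (c * dyad) <= gval (scale c m).
Proof.
move=> c0 /andP[/Z.leb_spec0 k0 /Z.ltb_spec0 s0]; rewrite gval_scale//.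
have e0 := expo2_gt0 s0.
rewrite /term_lo /dyad (ofZM prec) (ofZM m.1.1.1) (ofZM (explo _ _)) invfM mulrACA.
rewrite ler_wpM2l ?divr_ge0 ?ofZ_ge0 ?(ltW c0)//.
have r0 : 0 <= ofZ (rsqrt100 m.1.2) / ofZ (2 ^ 20) :> R.
  by rewrite divr_ge0 ?ofZ_ge0//; exact: Z.sqrt_nonneg.
rewrite -mulf_div [leRHS]mulrC (le_trans (ler_wpM2r r0 (explo_le _ e0)))//.
by rewrite ler_wpM2l ?expR_ge0// rsqrt100_le.
Qed.

Lemma term_hi_ge c m : 0 < c -> term_ok m -> (0 < term_hi m)%Z ->
  gval (scale c m) <= ofZ (term_hi m) / (c * dyad).
Proof.
move=> c0 /andP[/Z.leb_spec0 k0 /Z.ltb_spec0 s0]; rewrite gval_scale// => hi0.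
have e0 := expo2_gt0 s0.
have sq0 : (0 <= rsqrt100 m.1.2)%Z by exact: Z.sqrt_nonneg.
have h0 : (0 < exphi (expo m).1 (expo m).2)%Z by rewrite /term_hi in hi0; nia.
rewrite /term_hi /dyad (ofZM prec) (ofZM m.1.1.1) (ofZM (exphi _ _)) invfM.
rewrite [leRHS]mulrACA ler_wpM2l ?divr_ge0 ?ofZ_ge0 ?(ltW c0)//.
rewrite -mulf_div [leLHS]mulrC ler_pM ?sqrtr_ge0 ?expR_ge0//; first exact: exphi_ge.
exact: rsqrt100_ge.
Qed.

Lemma sum_merge_terms (F : Z * Z * Z * Z -> R) (l : seq (Z * Z * Z * Z)) :
  (forall k k' a a' s q, (a' * a' = a * a)%Z ->
     F (k + k', a, s, q)%Z = F (k, a, s, q) + F (k', a', s, q)) ->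
  \sum_(m <- merge_terms l) F m = \sum_(m <- l) F m.
Proof.
move=> FD; elim: l => [//|m l IH]; rewrite big_cons -IH /merge_terms/=.
elim: (foldr _ _ l) => [|m' l' IH']; first by rewrite /= !big_cons.
rewrite /= big_cons; case: ifPn => [|_]; last by rewrite big_cons IH' addrCA.
case: m m' {IH'} => [[[k a] s] q] [[[k' a'] s'] q'] /and3P[/Z.eqb_spec aa].
move=> /Z.eqb_spec/= -> /Z.eqb_spec/= ->; rewrite big_cons addrA.
by congr (_ + _); exact: FD.
Qed.

Lemma sum_gval_merge c (l : seq (Z * Z * Z * Z)) :
  \sum_(m <- merge_terms l) gval (scale c m) = \sum_(m <- l) gval (scale c m).
Proof.
apply: (sum_merge_terms (F := fun m => gval (scale c m))).
move=> k k' a a' s q aa.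
have e : (ofZ a' / 2000) ^+ 2 = (ofZ a / 2000) ^+ 2 :> R.
  by rewrite !expr_div_n [in LHS]expr2 [in RHS](expr2 (ofZ a)) -!ofZM aa.
by rewrite /gval /scale [_.1.1.1]/= [_.1.1.2]/= [_.1.2]/= [_.2]/= e ofZD 2!mulrDl.
Qed.

Lemma check_bound_le (T : Z) (p b : seq (Z * Z)) (num den : Z) : (0 < den)%Z ->
  check_bound T p b num den ->
  [/\ is_prior (map atomZ p),
      forall t, t \in map atomZ p -> `|t.1| <= ofZ T / 2000 &
      ((ofZ num / ofZ den)%:E <=
        \int[normal_prob 0 1]_x (postvar (map atomZ p) x)%:E)%E].
Proof.
move=> den0; rewrite /check_bound; set l1 := merge_terms _; set l2 := merge_terms _.
move=> /and5P[/allP pT /Z.eqb_spec psum /allP b0 /allP ok1 /and3P[/allP ok2 /allP hi0]].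
move=> /Z.leb_spec0 bnd.
have sumZE (l : seq Z) : ofZ (sumZ l) = \sum_(z <- l) ofZ z :> R.
  elim: l => [|z l IH]; first by rewrite big_nil ofZ0.
  by rewrite big_cons -IH -ofZD.
have pp : is_prior (map atomZ p).
  split=> [_ /mapP[t /pT/andP[_ /Z.leb_spec0 t0] ->]|].
    by rewrite /= mulr_ge0 ?ofZ_ge0 ?invr_ge0 ?ler0n.
  rewrite big_map -mulr_suml -(big_map snd xpredT ofZ) -sumZE psum.
  have -> : ofZ 1000 = 1000 :> R := ofZ_of_nat 1000.
  by apply: divff; rewrite pnatr_eq0.
split => //.
  move=> _ /mapP[t /pT/andP[/Z.leb_spec0 tT _] ->]/=.
  have i0 : 0 < 2000^-1 :> R by rewrite invr_gt0 ltr0n.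
  rewrite normrM (gtr0_norm i0) (ler_pM2r i0) ler_norml -ofZN !ofZ_le.
  by apply/andP; split; apply/Z.leb_spec0; lia.
apply: le_trans (bayes_bound_le pp (b := map bumpZ b) _); last first.
  move=> _ /mapP[v /b0/andP[/Z.leb_spec0 v1 /Z.leb_spec0 v2] ->].
  by split; rewrite /= mulr_ge0 ?ofZ_ge0 ?invr_ge0 ?ler0n.
rewrite lee_fin /bayes_bound terms1_atomZ terms2_atomZ !big_map.
rewrite -(sum_gval_merge _ (terms1 _ _ _)) -(sum_gval_merge _ (terms2 _ _ _)).
rewrite -/l1 -/l2.
have c1 : 0 < 4 * 10 ^+ 15 :> R by rewrite mulr_gt0.
have c2 : 0 < 4 * 10 ^+ 21 :> R by rewrite mulr_gt0.
have lo : ofZ (sumZ (map term_lo l1)) / (4 * 10 ^+ 15 * dyad) <=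
    \sum_(m <- l1) gval (scale (4 * 10 ^+ 15) m).
  rewrite sumZE big_map mulr_suml big_seq [leRHS]big_seq.
  by apply: ler_sum => m /ok1; exact: term_lo_le.
have hi : \sum_(m <- l2) gval (scale (4 * 10 ^+ 21) m) <=
    ofZ (sumZ (map term_hi l2)) / (4 * 10 ^+ 21 * dyad).
  rewrite sumZE big_map mulr_suml big_seq [leRHS]big_seq.
  apply: ler_sum => m ml; apply: term_hi_ge => //; first exact: ok2.
  by have /Z.ltb_spec0 := hi0 _ (map_f term_hi ml).
apply: le_trans (lerB lo hi); have d0 := ofZ_gt0 (R := R) den0.
have unitE : ofZ row_unit = 4 * 10 ^+ 21 * dyad.
  rewrite /row_unit (ofZM (4 * 10 ^ 21)) (ofZM 4); congr (_ * _ * _).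
    exact: (ofZ_of_nat 4).
  have ten : ofZ 10 = 10 :> R := ofZ_of_nat 10.
  by rewrite -ten; exact: (ofZX 10 21).
have ten6 : ofZ (10 ^ 6) = 10 ^+ 6 :> R.
  have ten : ofZ 10 = 10 :> R := ofZ_of_nat 10.
  by rewrite -ten; exact: (ofZX 10 6).
move: bnd => /Z.leb_spec0; rewrite -(ofZ_le (R := R)).
move: (sumZ _) (sumZ _) => h g.
rewrite (ofZM num) (ofZM den) ofZB (ofZM _ g) unitE ten6.
rewrite ler_pdivrMr//.
have -> : (ofZ g / (4 * 10 ^+ 15 * dyad) - ofZ h / (4 * 10 ^+ 21 * dyad)) * ofZ den =
    ofZ den * (10 ^+ 6 * ofZ g - ofZ h) / (4 * 10 ^+ 21 * dyad).
  by field; exact: lt0r_neq0.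
by rewrite ler_pdivlMr// mulr_gt0.
Qed.

Definition bounded_mean_prior (tau : R) (p : seq (R * R)) : Prop :=
  [/\ is_prior p, forall t, t \in p -> `|t.1| <= tau &
      ((4 / 5 * (tau ^+ 2 / (1 + tau ^+ 2)))%:E <=
        \int[normal_prob 0 1]_x (postvar p x)%:E)%E].

Lemma linear_risk_mono (s t : R) : 0 <= s -> s <= t ->
  s ^+ 2 / (1 + s ^+ 2) <= t ^+ 2 / (1 + t ^+ 2).
Proof.
move=> s0 st.
have st2 : s ^+ 2 <= t ^+ 2 by rewrite ler_pXn2r// nnegrE (le_trans s0).
have p (u : R) : 0 < 1 + u ^+ 2 by rewrite ltr_wpDr ?sqr_ge0.
rewrite ler_pdivrMr// mulrAC ler_pdivlMr// !mulrDr !mulr1 [t ^+ 2 * _]mulrC.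
by rewrite lerD2r.
Qed.

Lemma check_table_le (rows : seq (seq (Z * Z) * seq (Z * Z) * Z)) (T : Z) (tau : R) :
  check_table T rows -> 0 <= tau -> ofZ T / 2000 <= tau ->
  exists p, bounded_mean_prior tau p.
Proof.
move=> + tau0; have q0 (u : R) : 0 < 1 + u ^+ 2 by rewrite ltr_wpDr ?sqr_ge0.
elim: rows T => [|[[p b] T'] rows IH] T.
  move=> /(check_bound_le (erefl : (0 < 5)%Z)) [pp supp bnd] Ttau.
  exists (map atomZ last_row.1); split => //.
    by move=> t /supp/le_trans; apply.
  apply: le_trans bnd; rewrite lee_fin.
  have -> : ofZ 4 = 4 :> R := ofZ_of_nat 4.
  have -> : ofZ 5 = 5 :> R := ofZ_of_nat 5.
  rewrite ler_piMr// ler_pdivrMr// mul1r lerDr//.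
move=> /andP[chk rest] Ttau.
have [tT|/ltW] := leP tau (ofZ T' / 2000); last exact: IH.
have den0 : (0 < 5 * (2000 * 2000 + T' * T'))%Z.
  apply: Z.mul_pos_pos => //; apply: Z.add_pos_nonneg => //.
  exact: Z.square_nonneg.
have [pp supp bnd] := check_bound_le den0 chk.
exists (map atomZ p); split => //; first by move=> t /supp/le_trans; apply.
apply: le_trans bnd; rewrite lee_fin.
have -> : ofZ (4 * (T' * T')) / ofZ (5 * (2000 * 2000 + T' * T')) =
    4 / 5 * ((ofZ T' / 2000) ^+ 2 / (1 + (ofZ T' / 2000) ^+ 2)) :> R.
  rewrite (ofZM 4) (ofZM T') (ofZM 5) ofZD (ofZM T') (ofZM 2000).
  have -> : ofZ 4 = 4 :> R := ofZ_of_nat 4.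
  have -> : ofZ 5 = 5 :> R := ofZ_of_nat 5.
  have -> : ofZ 2000 = 2000 :> R := ofZ_of_nat 2000.
  have k0 : 0 < 2000 :> R by rewrite ltr0n.
  move: (2000 : R) k0 => k k0.
  have h : k * k + ofZ T' * ofZ T' != 0.
    by apply: lt0r_neq0; rewrite ltr_pwDl ?mulr_gt0// -expr2 sqr_ge0.
  field; rewrite -!expr2 in h; rewrite h lt0r_neq0//.
by rewrite ler_wpM2l ?linear_risk_mono.
Qed.

Lemma bounded_mean_large (tau : R) : 6 / 5 <= tau -> exists p, bounded_mean_prior tau p.
Proof.
move=> h; apply: (check_table_le check_table_ok); first by apply: le_trans h.
have -> : ofZ 2400 = 2400 :> R := ofZ_of_nat 2400.
by apply: le_trans h; lra.
Qed.

End CheckBound.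

(** * The two-point prior on short intervals *)

Section Small.
Context {R : realType}.
Implicit Types t tau : R.

(** Convexity: on [[0, a]] the function lies below its chord. *)
Lemma expR_chord (t a b : R) : 0 <= t -> t <= a -> 0 < a ->
  expR (b * t) <= 1 + t / a * (expR (b * a) - 1).
Proof.
move=> t0 ta a0.
have l0 : 0 <= t / a by rewrite divr_ge0// ltW.
have l1 : t / a <= 1 by rewrite ler_pdivrMr// mul1r.
have := @convex_expR R (Itv01 l0 l1) (b * a) 0.
rewrite !convRE /= expR0 mulr0 addr0 /unstable.onem mulr1.
have -> : t / a * (b * a) = b * t by field; exact: lt0r_neq0.
move=> h; apply: (le_trans h); lra.
Qed.

Lemma bounded_mean_small tau : 0 <= tau -> tau <= 6 / 5 -> exists p, bounded_mean_prior tau p.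
Proof.
move=> tau0 tau1; set t := tau ^+ 2.
have t0 : 0 <= t by exact: sqr_ge0.
have t1 : t <= 36 / 25.
  by rewrite (_ : 36 / 25 = (6 / 5) ^+ 2); [rewrite ler_pXn2r// nnegrE; lra|field].
pose q : R := Num.sqrt (32 / 65); have q2 : q ^+ 2 = 32 / 65.
  by rewrite sqr_sqrtr//; lra.
pose E := expR (t / 2 - 8 * t / 49).
pose p : seq (R * R) := [:: (tau, 1 / 2); (- tau, 1 / 2)].
(* The rate makes [1 + 2 * (33 / 32) = (7 / 4)^2] a square. For a coefficient [c] the bound has the
   form [2 c A - c^2 B], and the chosen one is its maximiser [A / B]. *)
pose b : seq (R * R) := [:: (7 / 4 * q * E, 33 / 32)].
have pp : is_prior p.
  split; last by rewrite !big_cons big_nil /=; field.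
  by move=> u; rewrite !inE => /orP[]/eqP-> /=.
have b0 : wf_bumps b.
  move=> v; rewrite inE => /eqP->; split => //=.
  by rewrite !mulr_ge0 ?sqrtr_ge0 ?expR_ge0.
exists p; split => //.
  by move=> u; rewrite !inE => /orP[]/eqP-> /=; rewrite ?normrN ger0_norm.
apply: le_trans (bayes_bound_le pp b0); rewrite lee_fin.
have -> : bayes_bound p b = 56 / 65 * t * expR (- (65 / 98 * t)).
  rewrite /bayes_bound /terms1 /terms2 /terms /p /b /= !big_cons !big_nil !addr0.
  rewrite /gval /=.
  have -> : (1 + 33 / 32)^-1 = 32 / 65 :> R by field.
  have -> : (1 + (33 / 32 + 33 / 32))^-1 = (4 / 7) ^+ 2 :> R by field.
  rewrite sqrtr_sqr ger0_norm// -/q.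
  have -> : (tau - tau) ^+ 2 / (2 * (1 + 33 / 32)) - (tau * tau + - tau * - tau) / 2 =
    - t by rewrite /t; field.
  have -> : (tau - tau + tau) ^+ 2 / (2 * (1 + (33 / 32 + 33 / 32))) -
    (tau * tau + - tau * - tau + tau * tau) / 2 = 8 * t / 49 - 3 * t / 2.
    by rewrite /t; field.
  have -> : (tau - tau - tau) ^+ 2 / (2 * (1 + (33 / 32 + 33 / 32))) -
    (tau * tau + - tau * - tau + - tau * - tau) / 2 = 8 * t / 49 - 3 * t / 2.
    by rewrite /t; field.
  have E1 : E * expR (- t) = expR (- (65 / 98 * t)).
    by rewrite /E -expRD; congr expR; field.
  have E2 : E * E * expR (8 * t / 49 - 3 * t / 2) = expR (- (65 / 98 * t)).
    by rewrite /E -!expRD; congr expR; field.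
  transitivity (7 / 2 * t * q ^+ 2 * (E * expR (- t)) -
    7 / 4 * t * q ^+ 2 * (E * E * expR (8 * t / 49 - 3 * t / 2))).
    by rewrite /t; field.
  by rewrite E1 E2 q2; field.
(* The goal with denominators cleared, as [14 / 13 = (56 / 65) * (5 / 4)]. The right side is affine
   in [t], so the chord over [[0, 36 / 25]] suffices. *)
have key : expR (65 / 98 * t) <= 14 / 13 * (1 + t).
  apply: le_trans (expR_chord (a := 36 / 25) (65 / 98) t0 t1 _) _; first by lra.
  have -> : 65 / 98 * (36 / 25) = ofZ 234 / ofZ 245 :> R.
    have -> : ofZ 234 = 234 :> R := ofZ_of_nat 234.
    have -> : ofZ 245 = 245 :> R := ofZ_of_nat 245.
    by field.
  have bnd : expR (ofZ 234 / ofZ 245) <= 13 / 5 :> R.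
    apply: le_trans (exphi_ge (erefl : (0 < 245)%Z) (erefl : (0 < exphi 234 245)%Z)) _.
    rewrite ler_pdivrMr ?ofZ_gt0// mulrAC ler_pdivlMr//.
    have <- : ofZ 13 = 13 :> R := ofZ_of_nat 13.
    have <- : ofZ 5 = 5 :> R := ofZ_of_nat 5.
    by rewrite -!ofZM ofZ_le; vm_cast_no_check (erefl true).
  rewrite -[t / _]/(t * _); nra.
have F0 := expR_gt0 (- (65 / 98 * t)).
have FF : expR (65 / 98 * t) * expR (- (65 / 98 * t)) = 1 by exact: expRxMexpNx_1.
have T0 : 0 < 1 + t by rewrite ltr_wpDr.
rewrite mulrA ler_pdivrMr// -/t.
have : 1 <= 14 / 13 * (1 + t) * expR (- (65 / 98 * t)).
  by rewrite -[leLHS]FF ler_pM2r.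
move: (expR _) => F; nra.
Qed.

Theorem bounded_normal_mean tau : 0 <= tau -> exists p, bounded_mean_prior tau p.
Proof.
move=> tau0; have [small|/ltW large] := leP tau (6 / 5); first exact: bounded_mean_small.
exact: bounded_mean_large.
Qed.

End Small.

(** * Gaussian vectors *)

Section TupleMeasure.
Context {R : realType}.

Definition rectangle n (A : 'I_n -> set R) : set (n.-tuple R) :=
  [set t | forall i, A i (tnth t i)].

Definition rectangles n : set (set (n.-tuple R)) :=
  [set B | exists2 A : 'I_n -> set R, forall i, measurable (A i) & B = rectangle A].

Lemma measurable_rectangle n (A : 'I_n -> set R) :
  (forall i, measurable (A i)) -> measurable (rectangle A).
Proof.
move=> mA; have -> : rectangle A = \bigcap_(i in [set: 'I_n]) ((@tnth n R)^~ i @^-1` A i).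
  by apply/seteqP; split=> t /= h i => [_|]; apply: h.
apply: fin_bigcap_measurable => [|i _]; first exact: finite_finset.
by rewrite -[X in measurable X]setTI; exact: measurable_tnth.
Qed.

Lemma measurable_tuple_rectangles n :
  (measurable : set (set (n.-tuple R))) = <<s @rectangles n >>.
Proof.
apply/seteqP; split.
  apply: smallest_sub; first exact: smallest_sigma_algebra.
  rewrite -bigcup_seq => _ [i _ [A mA <-]]; apply: sub_sigma_algebra.
  exists (fun j => if j == i then A else setT); first by move=> j; case: ifP.
  rewrite setTI; apply/seteqP; split=> t /= h; last by have := h i; rewrite eqxx.
  by move=> j; case: ifPn => // /eqP->.
apply: smallest_sub; first exact: sigma_algebra_measurable.
by move=> _ [A mA ->]; exact: measurable_rectangle.
Qed.

(** Rectangles are stable under intersection and generate the sigma-algebra; hence [iid_gaussian]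
    determines the law. *)
Lemma rectangle_measure_unique n (m1 m2 : {measure set (n.-tuple R) -> \bar R}) :
  (forall A : 'I_n -> set R, (forall i, measurable (A i)) ->
     m1 (rectangle A) = m2 (rectangle A)) ->
  (m1 setT < +oo)%E -> forall B, measurable B -> m1 B = m2 B.
Proof.
move=> m12 fin; apply: (measure_unique (@rectangles n) (fun=> setT)) => //.
- exact: measurable_tuple_rectangles.
- move=> _ _ [A mA ->] [B mB ->]; exists (fun i => A i `&` B i).
    by move=> i; exact: measurableI.
  apply/seteqP; split=> t /=; first by move=> [h1 h2] i; split.
  by move=> h; split=> i; have [] := h i.
- by move=> i; exists (fun=> setT) => //; apply/seteqP; split.
- exact: bigcup_const.
- by move=> _ [A mA ->]; exact: m12.
Qed.

Definition cons_tuple n (x : R * n.-tuple R) : n.+1.-tuple R :=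
  [tuple of x.1 :: x.2].

Lemma measurable_cons_tuple n : measurable_fun setT (@cons_tuple n).
Proof. exact: (measurable_cons measurable_fst measurable_snd). Qed.

Lemma tnth_cons0 n (x : R * n.-tuple R) : tnth (cons_tuple x) ord0 = x.1.
Proof. by rewrite (tnth_nth 0). Qed.

Lemma tnth_consS n (x : R * n.-tuple R) i : tnth (cons_tuple x) (lift ord0 i) = tnth x.2 i.
Proof. by rewrite !(tnth_nth 0). Qed.

Section Decomposition.
Variables (sigma : R) (n : nat) (mu : probability (n.+1.-tuple R) R).
Hypothesis gmu : iid_gaussian mu sigma.

Let tl (t : n.+1.-tuple R) : n.-tuple R := [tuple of behead t].
Let mtl : measurable_fun setT tl. Proof. exact: measurable_behead. Qed.
Let tlE t i : tnth (tl t) i = tnth t (lift ord0 i).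
Proof.
by rewrite tnth_behead; congr (tnth t _); apply/val_inj; rewrite /= inordK// ltnS.
Qed.
Let tlX : {mfun (n.+1.-tuple R) >-> (n.-tuple R)} :=
  HB.pack tl (isMeasurableFun.Build _ _ _ _ _ mtl).

Definition mu_behead : probability (n.-tuple R) R := distribution mu tlX.

Lemma iid_gaussian_behead : iid_gaussian mu_behead sigma.
Proof.
move=> A mA.
(* The rectangle is padded with the whole line in the first coordinate, a factor of probability
   [1]. *)
pose B := fun i : 'I_n.+1 => if unlift ord0 i is Some j then A j else setT.
have mB i : measurable (B i) by rewrite /B; case: unliftP.
have := gmu mB; rewrite big_ord_recl {2}/B unlift_none probability_setT mul1e => h.
transitivity (mu [set t | forall i, B i (tnth t i)]).
  rewrite /mu_behead /distribution /pushforward /=; congr (mu _).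
  apply/seteqP; split=> t /= h' i.
    by rewrite /B; case: unliftP => // j ->; rewrite -tlE; exact: h'.
  by have := h' (lift ord0 i); rewrite /B liftK -tlE.
by rewrite h; apply: eq_bigr => i _; rewrite /B liftK.
Qed.

(** By uniqueness on rectangles, [mu] is the image of a product measure, and Tonelli peels off the
    first coordinate. This is the induction step for everything in dimension [n]. *)
Lemma integral_cons_gaussian (H : n.+1.-tuple R -> \bar R) :
  measurable_fun setT H -> (forall t, 0 <= H t)%E ->
  (\int[mu]_t H t = \int[normal_prob 0%R sigma]_x \int[mu_behead]_t H (cons_tuple (x, t)))%E.
Proof.
move=> mH H0.
pose prod : {measure set (measurableTypeR R * n.-tuple R) -> \bar R} :=
  (normal_prob (0 : R) sigma \x mu_behead)%E.
have mcons : measurable_fun [set: measurableTypeR R * n.-tuple R] (@cons_tuple n).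
  exact: measurable_cons_tuple.
pose nu : {measure set (n.+1.-tuple R) -> \bar R} :=
  measure_function_pushforward__canonical__measure_function_Measure
    prod mcons.
have nuE B : measurable B -> mu B = nu B.
  apply: rectangle_measure_unique => [A mA|]; last first.
    exact: le_lt_trans (probability_le1 mu measurableT) (ltry 1).
  apply: (eq_trans (gmu mA)); rewrite /nu/= /pushforward.
  have -> : cons_tuple (n := n) @^-1` rectangle A =
      A ord0 `*` rectangle (fun i => A (lift ord0 i)).
    apply/seteqP; split=> -[x t] /=.
      move=> h; split => [|i]; first by have := h ord0; rewrite tnth_cons0.
      by have := h (lift ord0 i); rewrite tnth_consS.
    move=> [h0 h] i; case: (unliftP ord0 i) => [j ->|->]; last by rewrite tnth_cons0.
    by rewrite tnth_consS; exact: h.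
  rewrite /prod product_measure1E; [|exact: mA|exact: measurable_rectangle].
  rewrite big_ord_recl; congr (_ * _)%E; apply: esym.
  exact: (iid_gaussian_behead (fun i => mA _)).
transitivity (\int[nu]_t H t)%E.
  by apply: eq_measure_integral => B mB _; exact: nuE.
transitivity (\int[prod]_z H (cons_tuple z))%E.
  have := @ge0_integral_pushforward _ _ _ _ R _ mcons prod
    setT H measurableT mH (fun t _ => H0 t).
  by rewrite preimage_setT.
apply: (@fubini_tonelli1 _ _ (measurableTypeR R) (n.-tuple R) R
  (normal_prob (0 : R) sigma) mu_behead (fun z => H (cons_tuple z))) => //.
exact: (measurableT_comp mH mcons).
Qed.

End Decomposition.

End TupleMeasure.

Section GaussianVector.
Context {R : realType}.
Variable sigma : R.
Hypothesis sigma0 : 0 < sigma.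

Definition shift_tuple n (c : 'I_n -> R) (t : n.-tuple R) : n.-tuple R :=
  [tuple tnth t i + c i | i < n].

Lemma measurable_shift_tuple n (c : 'I_n -> R) : measurable_fun setT (shift_tuple c).
Proof.
apply/measurable_fun_tnthP => i; rewrite /comp /shift_tuple.
under eq_fun do rewrite tnth_mktuple.
by apply: measurable_funD => //; exact: measurable_tnth.
Qed.

Lemma shift_cons_tuple n (c : 'I_n.+1 -> R) (x : R) (t : n.-tuple R) :
  shift_tuple c (cons_tuple (x, t)) =
  cons_tuple (x + c ord0, shift_tuple (c \o lift ord0) t).
Proof.
apply: eq_from_tnth => i; rewrite tnth_mktuple.
case: (unliftP ord0 i) => [j ->|->]; last by rewrite !tnth_cons0.
by rewrite !tnth_consS tnth_mktuple.
Qed.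

(** Density of [N(c, sigma^2 I)] relative to [N(0, sigma^2 I)]. *)
Definition tilt n (c : 'I_n -> R) (t : n.-tuple R) : R :=
  expR (\sum_(i < n) (c i * tnth t i / sigma ^+ 2 - c i ^+ 2 / (sigma ^+ 2 *+ 2))).

Lemma measurable_tilt n (c : 'I_n -> R) : measurable_fun setT (tilt c).
Proof.
apply: measurableT_comp => //; apply: measurable_sum => i.
apply: measurable_funB => //; apply: measurable_funM => //.
by apply: measurable_funM => //; exact: measurable_tnth.
Qed.

Lemma integral_shift n (mu : probability (n.-tuple R) R) (c : 'I_n -> R)
    (H : n.-tuple R -> \bar R) : iid_gaussian mu sigma ->
  measurable_fun setT H -> (forall t, 0 <= H t)%E ->
  (\int[mu]_t H (shift_tuple c t) = \int[mu]_t (H t * (tilt c t)%:E))%E.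
Proof.
elim: n => [|n IH] in mu c H *.
  move=> _ mH H0; apply: eq_integral => t _.
  by rewrite /tilt big_ord0 expR0 mule1 (tuple0 t) tuple0.
move=> gmu mH H0; set c' := c \o lift ord0.
have mtilt := measurable_tilt c.
rewrite (integral_cons_gaussian gmu); last 2 first.
- exact: (measurableT_comp mH (measurable_shift_tuple c)).
- by move=> t; exact: H0.
rewrite [RHS](integral_cons_gaussian gmu); last 2 first.
- by apply: emeasurable_funM => //; exact/measurable_EFinP.
- by move=> t; rewrite mule_ge0// lee_fin expR_ge0.
have mcons : measurable_fun [set: measurableTypeR R * n.-tuple R] (@cons_tuple R n).
  exact: measurable_cons_tuple.
have msec (x : R) : measurable_fun setT (fun t : n.-tuple R => cons_tuple (x, t)).
  by apply: (measurableT_comp mcons); exact: measurable_pair1.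
pose G (y : R) := (\int[mu_behead mu]_t (H (cons_tuple (y, t)) * (tilt c' t)%:E))%E.
transitivity (\int[normal_prob 0%R sigma]_x G (x + c ord0)%R)%E.
  apply: eq_integral => x _; under eq_integral do rewrite shift_cons_tuple.
  apply: (IH _ _ (fun t => H (cons_tuple (x + c ord0, t)))) => //.
  - exact: iid_gaussian_behead.
  - exact: (measurableT_comp mH (msec _)).
have mG : measurable_fun [set: R] G.
  apply: (@measurable_fun_fubini_tonelli_F _ _ (measurableTypeR R) (n.-tuple R) R
    (mu_behead mu) (fun z => H (cons_tuple z) * (tilt c' z.2)%:E)%E).
    apply: emeasurable_funM; first exact: (measurableT_comp mH mcons).
    by apply/measurable_EFinP; apply: (measurableT_comp (measurable_tilt c')).
  by move=> z; rewrite mule_ge0// lee_fin expR_ge0.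
rewrite (integral_normal_shift _ sigma0 mG); last first.
  by move=> y; apply: integral_ge0 => t _; rewrite mule_ge0// lee_fin expR_ge0.
apply: eq_integral => x _; rewrite -ge0_integralZr.
- apply: eq_integral => t _; rewrite -muleA -EFinM; congr (_ * _%:E)%E.
  rewrite /tilt -expRD big_ord_recl !tnth_cons0 addrC; congr (expR (_ + _)).
  by apply: eq_bigr => i _; rewrite tnth_consS.
- exact: measurableT.
- apply: emeasurable_funM; first exact: (measurableT_comp mH (msec _)).
  by apply/measurable_EFinP; exact: measurable_tilt.
- by move=> t _; rewrite mule_ge0// lee_fin expR_ge0.
- by rewrite lee_fin expR_ge0.
Qed.

(** A linear form of the noise is normal. Scaling the variable instead of the law keeps the
    degenerate case [u = 0] within the statement. *)
Lemma integral_linear_form n (mu : probability (n.-tuple R) R) (u : 'I_n -> R)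
    (F : R -> \bar R) : iid_gaussian mu sigma ->
  measurable_fun setT F -> (forall x, 0 <= F x)%E ->
  (\int[mu]_t F (\sum_(i < n) u i * tnth t i)%R =
   \int[normal_prob 0%R sigma]_x F (Num.sqrt (\sum_(i < n) u i ^+ 2) * x)%R)%E.
Proof.
have mlin k (v : 'I_k -> R) (a : R) : measurable_fun setT
    (fun t : k.-tuple R => a + \sum_(i < k) v i * tnth t i).
  apply: measurable_funD => //; apply: measurable_sum => i.
  by apply: measurable_funM => //; exact: measurable_tnth.
have mlin0 k (v : 'I_k -> R) : measurable_fun setT
    (fun t : k.-tuple R => \sum_(i < k) v i * tnth t i).
  by have := mlin k v 0; under eq_fun do rewrite add0r.
elim: n => [|n IH] in mu u F *.
  move=> _ mF F0; under eq_integral do rewrite big_ord0.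
  under [RHS]eq_integral do rewrite big_ord0 sqrtr0 mul0r.
  rewrite !integral_cst//= !probability_setT//.
move=> gmu mF F0; rewrite (integral_cons_gaussian gmu); last 2 first.
- exact: (measurableT_comp mF (mlin0 _ _)).
- by move=> t; exact: F0.
rewrite [in RHS]big_ord_recl.
rewrite -[X in _ + X]sqr_sqrtr; last by apply: sumr_ge0 => i _; exact: sqr_ge0.
rewrite -integral_normal_conv//; apply: eq_integral => x _.
transitivity (\int[mu_behead mu]_t F (u ord0 * x +
    \sum_(i < n) (u \o lift ord0) i * tnth t i)%R)%E.
  apply: eq_integral => t _; rewrite big_ord_recl tnth_cons0.
  by congr (F (_ + _)); apply: eq_bigr => i _; rewrite tnth_consS.
apply: (IH _ _ (fun y => F (u ord0 * x + y)%R)) => //.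
- exact: iid_gaussian_behead.
- by apply: (measurableT_comp mF); exact: measurable_funD.
Qed.

End GaussianVector.

(** * The second moment of the normal law *)

Section SecondMoment.
Context {R : realType}.

Let N := normal_prob (0 : R) 1.

Let integral_gauss (S : R) : 0 < S ->
  (\int[N]_x (expR ((1 - S) * x ^+ 2 / 2))%:E = (Num.sqrt S^-1)%:E)%E.
Proof.
move=> S0; have := @integral_gterm R (1, 0, S, 0) ler01 S0.
rewrite /gterm /gval/= mul1r expr0n/= !mul0r subr0 expR0 mulr1 => <-.
apply: eq_integral => x _; by rewrite mul1r mul0r; congr (expR _)%:E; field.
Qed.

Let M := (\int[N]_x (x ^+ 2)%:E)%E.

Let mx2 : measurable_fun [set: R] (fun x : R => (x ^+ 2)%:E).
Proof. by apply/measurable_EFinP; exact: measurable_funX. Qed.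

Let mexp (S : R) : measurable_fun [set: R] (fun x : R => (expR ((1 - S) * x ^+ 2 / 2))%:E).
Proof.
apply/measurable_EFinP; apply: measurableT_comp => //.
by apply: measurable_funM => //; apply: measurable_funM.
Qed.

Let M_ge0 : (0 <= M)%E. Proof. by apply: integral_ge0 => x _; rewrite lee_fin sqr_ge0. Qed.

Let affM (u : R) : 0 <= u -> (\int[N]_x (1 + u * x ^+ 2)%:E = 1 + u%:E * M)%E.
Proof.
move=> u0; under eq_integral do rewrite EFinD EFinM.
rewrite ge0_integralD//.
- rewrite integral_cst//= probability_setT mule1 ge0_integralZl_EFin//.
  by move=> x _; rewrite lee_fin sqr_ge0.
- by move=> x _; rewrite lee_fin mulr_ge0 ?sqr_ge0.
- by apply/measurable_EFinP; apply: measurable_funM.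
Qed.

(** Squeeze: integrate [1 + y <= exp y] at [y = u x^2 / 2] and at [y = - s x^2 / 2]. Both
    exponentials have closed-form integrals, and the moment lies between [1 - s] and [1 + 2 u] for
    all small [s] and [u]. *)
Lemma normal_second_moment : (\int[N]_x (x ^+ 2)%:E = 1)%E.
Proof.
have ub (u : R) : 0 < u -> u <= 1 / 2 -> (M <= (1 + 2 * u)%:E)%E.
  move=> u0 u1; have S0 : 0 < 1 - u by lra.
  have : (1 + (u / 2)%:E * M <= (Num.sqrt (1 - u)^-1)%:E)%E.
    rewrite -integral_gauss// -affM; last by lra.
    apply: ge0_le_integral => //.
    - by move=> x _; rewrite lee_fin addr_ge0// mulr_ge0 ?sqr_ge0//; lra.
    - apply/measurable_EFinP; apply: measurable_funD => //.
      by apply: measurable_funM => //; exact: measurable_funX.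
    - exact: mexp.
    - move=> x _; rewrite lee_fin.
      have := expR_ge1Dx ((1 - (1 - u)) * x ^+ 2 / 2); lra.
  have : Num.sqrt (1 - u)^-1 <= 1 + u / 2 + u ^+ 2.
    rewrite -[leRHS]ger0_norm; last by nra.
    rewrite -sqrtr_sqr ler_wsqrtr// -[leLHS]mul1r ler_pdivrMr//.
    have -> : (1 + u / 2 + u ^+ 2) ^+ 2 * (1 - u) =
      1 + u ^+ 2 * (5 / 4 - 5 / 4 * u - u ^+ 3) by field.
    rewrite lerDl mulr_ge0 ?sqr_ge0//.
    have : u ^+ 3 <= 1 / 8 by rewrite !exprS expr0; nra.
    lra.
  move: M_ge0; rewrite /M; case: (\int[N]_x _)%E => [r||].
    rewrite -EFinM -EFinD !lee_fin => _ h1 h2; nra.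
    by rewrite gt0_muley ?lte_fin ?divr_gt0// addey.
  by rewrite leNgt ltNyr.
have lb (s : R) : 0 < s -> s <= 1 / 2 -> ((1 - s)%:E <= M)%E.
  move=> s0 s1; have S0 : 0 < 1 + s by lra.
  have : (1 <= (Num.sqrt (1 + s)^-1)%:E + (s / 2)%:E * M)%E.
    rewrite -integral_gauss// -ge0_integralZl_EFin//; last 2 first.
    - by move=> x _; rewrite lee_fin sqr_ge0.
    - by lra.
    have ms : measurable_fun [set: R] (fun x : R => (s / 2)%:E * (x ^+ 2)%:E)%E.
      by apply/measurable_EFinP; apply: measurable_funM.
    rewrite -ge0_integralD; [|exact: measurableT| |exact: mexp| |exact: ms]; last 2 first.
    - by move=> x _; rewrite lee_fin expR_ge0.
    - by move=> x _; rewrite mule_ge0// lee_fin ?sqr_ge0//; lra.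
    apply: (@le_trans _ _ (\int[N]_x (cst 1 x))%E).
      by rewrite integral_cst//= probability_setT mule1.
    apply: ge0_le_integral => //.
    - exact: emeasurable_funD (mexp _) ms.
    - move=> x _; rewrite -EFinM -EFinD lee_fin.
      have := expR_ge1Dx ((1 - (1 + s)) * x ^+ 2 / 2); lra.
  have : Num.sqrt (1 + s)^-1 <= 1 - s / 2 + s ^+ 2 / 2.
    rewrite -[leRHS]ger0_norm; last by nra.
    rewrite -sqrtr_sqr ler_wsqrtr// -[leLHS]mul1r ler_pdivrMr//.
    have -> : (1 - s / 2 + s ^+ 2 / 2) ^+ 2 * (1 + s) =
      1 + s ^+ 2 * (1 / 4 + 3 / 4 * s - s ^+ 2 / 4 + s ^+ 3 / 4) by field.
    rewrite lerDl mulr_ge0 ?sqr_ge0//.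
    have : 0 <= s ^+ 3 by rewrite exprn_ge0 ?ltW.
    nra.
  move: M_ge0; rewrite /M; case: (\int[N]_x _)%E => [r||].
    rewrite -EFinM -EFinD !lee_fin => _ h1 h2; nra.
    by move=> *; rewrite leey.
  by rewrite leNgt ltNyr.
move: M_ge0 ub lb; rewrite /M; case: (\int[N]_x _)%E => [r||].
- move=> _ ub lb; congr EFin; apply/eqP; rewrite eq_le; apply/andP.
  split; apply/ler_addgt0Pr => e e0.
    have [e1|e1] := leP (e / 2) (1 / 2).
      by have := ub _ (divr_gt0 e0 (ltr0n _ 2)) e1; rewrite lee_fin; lra.
    by have := ub (1 / 2) ltac:(lra) (lexx _); rewrite lee_fin; lra.
  have [e1|e1] := leP e (1 / 2).
    by have := lb _ e0 e1; rewrite lee_fin; lra.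
  by have := lb (1 / 2) ltac:(lra) (lexx _); rewrite lee_fin; lra.
- by move=> _ ub; have := ub (1 / 2) ltac:(lra) (lexx _).
- by rewrite leNgt ltNyr.
Qed.

Lemma normal_affine_second_moment (sigma a m : R) : 0 < sigma ->
  (\int[normal_prob 0 sigma]_x ((a * x + m) ^+ 2)%:E =
   (a ^+ 2 * sigma ^+ 2 + m ^+ 2)%:E)%E.
Proof.
move=> s0.
have maff (b : R) : measurable_fun [set: R] (fun x : R => ((b * x + m) ^+ 2)%:E).
  apply/measurable_EFinP; apply: measurable_funX; apply: measurable_funD => //.
have pos (b x : R) : (0 <= ((b * x + m) ^+ 2)%:E)%E by rewrite lee_fin sqr_ge0.
have -> : (\int[normal_prob 0 sigma]_x ((a * x + m) ^+ 2)%:E =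
    \int[N]_x (((a * sigma) * x + m) ^+ 2)%:E)%E.
  have := integral_normal_affine 0 (ltr01 : 0 < 1 :> R) s0 (maff a) (pos a).
  rewrite mulr1 => <-; apply: eq_integral => x _; congr (_ ^+ 2)%:E; ring.
set b := a * sigma.
(* Adding the integrands at [x] and [- x] cancels the cross term, with no signed integral. *)
have e1 : (\int[N]_x ((b * x + m) ^+ 2)%:E = \int[N]_x (((- b) * x + m) ^+ 2)%:E)%E.
  rewrite -(integral_normal_opp ltr01 (maff b) (pos b)).
  by apply: eq_integral => x _; rewrite mulrN mulNr.
have e2 : (\int[N]_x ((b * x + m) ^+ 2)%:E + \int[N]_x ((b * x + m) ^+ 2)%:E =
    (2 * (b ^+ 2 + m ^+ 2))%:E)%E.
  rewrite {2}e1 -ge0_integralD; [|exact: measurableT|by []|exact: maff|by []|exact: maff].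
  transitivity ((2 * m ^+ 2)%:E + (2 * b ^+ 2)%:E * \int[N]_x (x ^+ 2)%:E)%E.
    have c0 : 0 <= 2 * b ^+ 2 by rewrite mulr_ge0// sqr_ge0.
    have mm : measurable_fun [set: R] (fun x : R => (2 * b ^+ 2)%:E * (x ^+ 2)%:E)%E.
      by apply/measurable_EFinP; apply: measurable_funM.
    rewrite -ge0_integralZl_EFin//; last by move=> x _; rewrite lee_fin sqr_ge0.
    have -> : ((2 * m ^+ 2)%:E = \int[N]_x (cst (2 * m ^+ 2)%:E x))%E.
      by rewrite integral_cst//= probability_setT mule1.
    rewrite -ge0_integralD; [|exact: measurableT| | | |exact: mm].
    - apply: eq_integral => x _; rewrite -EFinM -!EFinD; congr EFin; ring.
    - by move=> x _; rewrite lee_fin mulr_ge0// sqr_ge0.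
    - exact: measurable_cst.
    - by move=> x _; rewrite mule_ge0// lee_fin sqr_ge0.
  rewrite normal_second_moment mule1 -EFinD; congr EFin; ring.
rewrite -exprMn -/b.
move: e2; case: (\int[N]_x _)%E => [r [r2]||]//.
by congr EFin; lra.
Qed.

End SecondMoment.

(** * The lower bound over an orthogonal box *)

Section Vectors.
Context {R : realType}.

Definition dot n (u v : 'cV[R]_n) : R := (u^T *m v) 0 0.

Lemma dotE n (u v : 'cV[R]_n) : dot u v = \sum_i u i 0 * v i 0.
Proof. by rewrite /dot mxE; apply: eq_bigr => i _; rewrite mxE. Qed.

Lemma sqnorm_dot n (v : 'cV[R]_n) : sqnorm v = dot v v.
Proof. by []. Qed.

Lemma sqnormE n (v : 'cV[R]_n) : sqnorm v = \sum_i v i 0 ^+ 2.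
Proof. by rewrite sqnorm_dot dotE; apply: eq_bigr => i _; rewrite expr2. Qed.

Lemma sqnorm_ge0 n (v : 'cV[R]_n) : 0 <= sqnorm v.
Proof. by rewrite sqnormE sumr_ge0// => i _; rewrite sqr_ge0. Qed.

Lemma dotC n (u v : 'cV[R]_n) : dot u v = dot v u.
Proof. by rewrite !dotE; apply: eq_bigr => i _; rewrite mulrC. Qed.

Lemma dotDr n (u v w : 'cV[R]_n) : dot u (v + w) = dot u v + dot u w.
Proof. by rewrite /dot mulmxDr mxE. Qed.

Lemma dotZr n a (u v : 'cV[R]_n) : dot u (a *: v) = a * dot u v.
Proof. by rewrite /dot -scalemxAr mxE. Qed.

Lemma dotZl n a (u v : 'cV[R]_n) : dot (a *: u) v = a * dot u v.
Proof. by rewrite dotC dotZr dotC. Qed.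

Lemma dot_sumr n k (u : 'cV[R]_n) (v : 'I_k -> 'cV[R]_n) :
  dot u (\sum_i v i) = \sum_i dot u (v i).
Proof. by rewrite /dot mulmx_sumr summxE. Qed.

Lemma dot_suml n k (u : 'cV[R]_n) (v : 'I_k -> 'cV[R]_n) :
  dot (\sum_i v i) u = \sum_i dot (v i) u.
Proof. by rewrite dotC dot_sumr; apply: eq_bigr => i _; rewrite dotC. Qed.

Lemma tcol_shift n (c : 'cV[R]_n) (t : n.-tuple R) :
  tcol (shift_tuple (fun i => c i 0) t) = c + tcol t.
Proof. by apply/matrixP => i j; rewrite !ord1 !mxE tnth_mktuple addrC. Qed.

Lemma measurable_sqnorm n m (A : 'M[R]_(n, m)) d (T : measurableType d)
    (f : T -> 'cV[R]_m) :
  (forall l, measurable_fun setT (fun x => f x l 0)) ->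
  measurable_fun setT (fun x => sqnorm (A *m f x)).
Proof.
move=> mf; under eq_fun do rewrite sqnormE.
apply: measurable_sum => i; apply: measurable_funX.
under eq_fun do rewrite mxE.
by apply: measurable_sum => j; apply: measurable_funM.
Qed.

Lemma measurable_est n d (est : 'cV[R]_n -> 'cV[R]_d) l : measurable_estimator est ->
  measurable_fun setT (fun t : n.-tuple R => est (tcol t) l 0).
Proof.
move=> mest; have := measurableT_comp (measurable_tnth l) mest.
by apply: eq_measurable_fun => t _ /=; rewrite tnth_mktuple.
Qed.

End Vectors.

Section ProductPrior.
Context {R : realType}.
Variables (k m : nat) (p : 'I_k -> seq (R * R)).
Hypothesis pp : forall i, is_prior (p i).
Hypothesis pm : forall i, (size (p i) <= m)%N.

Let atom i (j : 'I_m) : R := (nth (0, 0) (p i) j).1.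
Let weight i (j : 'I_m) : R := (nth (0, 0) (p i) j).2.

(** Priors of different lengths share the index type ['I_m]: past the end, the default [(0, 0)] is
    an atom of weight zero. *)
Lemma sum_atoms i (F : R * R -> R) : F (0, 0) = 0 ->
  \sum_(u <- p i) F u = \sum_(j < m) F (nth (0, 0) (p i) j).
Proof.
move=> F0; rewrite (big_nth (0, 0)) big_mkord.
rewrite (big_ord_widen _ (fun j => F (nth (0, 0) (p i) j)) (pm i)) big_mkcond.
apply: eq_bigr => j _; case: ifPn => //; rewrite -leqNgt => h.
by rewrite nth_default.
Qed.

Definition joint_weight (f : {ffun 'I_k -> 'I_m}) : R := \prod_i weight i (f i).

Lemma weight_ge0 i j : 0 <= weight i j.
Proof.
have [h|h] := ltnP j (size (p i)); last by rewrite /weight nth_default.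
by have [p0 _] := pp i; apply: p0; exact: mem_nth.
Qed.

Lemma joint_weight_ge0 f : 0 <= joint_weight f.
Proof. by apply: prodr_ge0 => i _; exact: weight_ge0. Qed.

Lemma sum_weight i : \sum_j weight i j = 1.
Proof. by have [_ <-] := pp i; rewrite (@sum_atoms i snd). Qed.

Lemma sum_joint (F : 'I_k -> 'I_m -> R) :
  \sum_(f : {ffun 'I_k -> 'I_m}) \prod_i F i (f i) = \prod_i \sum_j F i j.
Proof. by rewrite bigA_distr_bigA. Qed.

Lemma sum_joint_weight : \sum_f joint_weight f = 1.
Proof. by rewrite sum_joint big1// => i _; exact: sum_weight. Qed.

(* The posterior risk of coordinate [i], given all the observations [x], is at
   least its posterior variance; the other coordinates are integrated out by
   moving the [i]-th atom to [0], where the likelihood is [1]. *)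
Lemma joint_postvar i (x : 'I_k -> R) (y : R) :
  \sum_f joint_weight f *
    (\prod_j lik (if j == i then 0 else atom j (f j)) (x j)) * postvar (p i) (x i) <=
  \sum_f joint_weight f * (\prod_j lik (atom j (f j)) (x j)) * (y - atom i (f i)) ^+ 2.
Proof.
have -> : \sum_f joint_weight f *
    (\prod_j lik (if j == i then 0 else atom j (f j)) (x j)) * postvar (p i) (x i) =
    (\prod_(j | j != i) moment 0 (p j) (x j)) * postvar (p i) (x i).
  rewrite -mulr_suml; congr (_ * _).
  transitivity (\sum_(f : {ffun 'I_k -> 'I_m})
      \prod_j (weight j (f j) * lik (if j == i then 0 else atom j (f j)) (x j))).
    by apply: eq_bigr => f _; rewrite big_split.
  rewrite (sum_joint (fun j a => weight j a * lik (if j == i then 0 else atom j a) (x j))).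
  rewrite (bigD1 i)//= eqxx.
  have -> : \sum_j weight i j * lik 0 (x i) = 1.
    rewrite -mulr_suml sum_weight /lik mul0r expr0n/= mul0r subr0 expR0 mulr1//.
  rewrite mul1r; apply: eq_bigr => j /negPf ji; rewrite ji.
  rewrite /moment (@sum_atoms j (fun t => t.2 * t.1 ^+ 0 * lik t.1 (x j)))/=.
    by apply: eq_bigr => a _; rewrite expr0 mulr1.
  by rewrite !mul0r.
have -> : \sum_f joint_weight f * (\prod_j lik (atom j (f j)) (x j)) *
      (y - atom i (f i)) ^+ 2 =
    (\prod_(j | j != i) moment 0 (p j) (x j)) *
      \sum_(t <- p i) t.2 * lik t.1 (x i) * (y - t.1) ^+ 2.
  (* The squared error goes into the [i]-th factor, so that the sum over [f] is again a sum of
     products. *)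
  transitivity (\sum_(f : {ffun 'I_k -> 'I_m}) \prod_j (weight j (f j) *
      lik (atom j (f j)) (x j) * (if j == i then (y - atom i (f j)) ^+ 2 else 1))).
    apply: eq_bigr => f _; rewrite big_split/= big_split/=; congr (_ * _).
    by rewrite (bigD1 i)//= eqxx big1 ?mulr1// => j /negPf ->.
  rewrite (sum_joint (fun j a => weight j a * lik (atom j a) (x j) *
    (if j == i then (y - atom i a) ^+ 2 else 1))).
  rewrite (bigD1 i)//= mulrC eqxx; congr (_ * _).
    apply: eq_bigr => j /negPf ji; rewrite ji.
    rewrite /moment (@sum_atoms j (fun t => t.2 * t.1 ^+ 0 * lik t.1 (x j)))/=.
      by apply: eq_bigr => a _; rewrite expr0 !mulr1.
    by rewrite !mul0r.
  by rewrite (@sum_atoms i (fun t => t.2 * lik t.1 (x i) * (y - t.1) ^+ 2))//= !mul0r.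
apply: ler_wpM2l; last exact: postvar_le.
by apply: prodr_ge0 => j _; rewrite ltW// moment0_gt0.
Qed.

End ProductPrior.

Lemma integral_lincomb {R : realType} d (T : measurableType d)
    (mu : {measure set T -> \bar R}) (I : finType) (c : I -> R) (F : I -> T -> R) :
  (forall i, 0 <= c i) -> (forall i x, 0 <= F i x) ->
  (forall i, measurable_fun setT (F i)) ->
  (\int[mu]_x (\sum_i c i * F i x)%:E = \sum_i (c i)%:E * \int[mu]_x (F i x)%:E)%E.
Proof.
move=> c0 F0 mF; under eq_integral do rewrite -sumEFin.
rewrite ge0_integral_sum//.
- apply: eq_bigr => i _; under eq_integral do rewrite EFinM.
  rewrite ge0_integralZl_EFin//; last by apply/measurable_EFinP.
  by move=> x _; rewrite lee_fin.
- move=> i; apply/measurable_EFinP; exact: measurable_funM.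
- by move=> i x _; rewrite lee_fin mulr_ge0.
Qed.

Section LowerBound.
Context {R : realType}.
Variables (n d k : nat) (sigma r : R) (X : 'M[R]_(n, d)) (S12 : 'M[R]_d).
Variables (mu : probability (n.-tuple R) R) (est : 'cV[R]_n -> 'cV[R]_d).
Variables (v l : 'I_k -> 'cV[R]_d) (a kappa w : 'I_k -> R).
Hypothesis sigma0 : 0 < sigma.
Hypothesis gmu : iid_gaussian mu sigma.
Hypothesis mest : measurable_estimator est.
Hypothesis kappa0 : forall i, 0 < kappa i.
Hypothesis a0 : forall i, 0 <= a i.
Hypothesis w0 : forall i, 0 <= w i.
Hypothesis orth : forall i j,
  dot (X *m v i) (X *m v j) = if i == j then kappa i else 0.
Hypothesis ball : forall theta : 'I_k -> R, (forall i, `|theta i| <= a i) ->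
  sqnorm (\sum_i theta i *: v i) <= r ^+ 2.
(** [l i] reads the [i]-th coordinate off an estimate. An inequality is enough, and the axes [v i]
    need not span the space. *)
Hypothesis loss : forall (b : 'cV[R]_d) (theta : 'I_k -> R),
  \sum_i w i * (dot (l i) b - theta i) ^+ 2 <=
  sqnorm (S12 *m (b - \sum_i theta i *: v i)).

(** Standard deviation of the least-squares estimate of [theta i]. *)
Let s i := sigma / Num.sqrt (kappa i).
Let s0 i : 0 < s i. Proof. by rewrite divr_gt0// sqrtr_gt0. Qed.

Let s2 i : s i ^+ 2 = sigma ^+ 2 / kappa i.
Proof. by rewrite expr_div_n sqr_sqrtr// ltW. Qed.

(** Sufficient statistic for [theta i], standardised to be [N(0, 1)] under pure noise. *)
Let U i (t : n.-tuple R) : R := dot (X *m v i) (tcol t) * s i / sigma ^+ 2.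

Let beta (theta : 'I_k -> R) : 'cV[R]_d := \sum_i theta i *: v i.

Let Xbeta theta : X *m beta theta = \sum_i theta i *: (X *m v i).
Proof. by rewrite mulmx_sumr; apply: eq_bigr => i _; rewrite scalemxAr. Qed.

Let mean theta := fun j : 'I_n => (X *m beta theta) j 0.

(** By orthogonality the squared norm of the mean has no cross terms, so the density factors into
    one-dimensional likelihoods. *)
Lemma tilt_mean theta t : tilt sigma (mean theta) t =
  \prod_i lik (theta i / s i) (U i t).
Proof.
rewrite /tilt -expR_sum; congr expR.
transitivity (dot (X *m beta theta) (tcol t) / sigma ^+ 2 -
    sqnorm (X *m beta theta) / (sigma ^+ 2 *+ 2)).
  rewrite dotE sqnormE !mulr_suml -sumrB; apply: eq_bigr => i _.
  by rewrite /mean [tcol t i 0]mxE.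
have -> : sqnorm (X *m beta theta) = \sum_i theta i ^+ 2 * kappa i.
  rewrite sqnorm_dot {1}Xbeta dot_suml; apply: eq_bigr => i _.
  rewrite Xbeta dot_sumr (bigD1 i)//= big1 => [|j ji].
    by rewrite addr0 dotZl dotZr orth eqxx; ring.
  by rewrite dotZl dotZr orth eq_sym (negPf ji) !mulr0.
rewrite Xbeta dot_suml !mulr_suml -sumrB; apply: eq_bigr => i _.
rewrite dotZl /U; have := s2 i; move: (s0 i) => si0 si2.
have -> : kappa i = sigma ^+ 2 / s i ^+ 2.
  by rewrite si2; field; rewrite !lt0r_neq0.
by field; rewrite !lt0r_neq0.
Qed.

Lemma U_shift i theta t : theta i = 0 -> U i (shift_tuple (mean theta) t) = U i t.
Proof.
move=> ti; rewrite /U (tcol_shift (X *m beta theta)) dotDr Xbeta dot_sumr.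
rewrite big1 ?add0r// => j _; rewrite dotZr orth; case: eqP => [<-|_].
  by rewrite ti mul0r.
by rewrite mulr0.
Qed.

Lemma measurable_U i : measurable_fun setT (U i).
Proof.
have -> : U i = fun t => \sum_(j < n)
    ((X *m v i) j 0 * s i / sigma ^+ 2) * tnth t j.
  apply/funext => t; rewrite /U dotE !mulr_suml; apply: eq_bigr => j _.
  by rewrite [tcol t j 0]mxE; ring.
apply: measurable_sum => j; apply: measurable_funM => //; exact: measurable_tnth.
Qed.

Lemma integral_U i (F : R -> \bar R) : measurable_fun setT F -> (forall x, 0 <= F x)%E ->
  (\int[mu]_t F (U i t) = \int[normal_prob 0%R 1%R]_x F x)%E.
Proof.
move=> mF F0.
have UE t : U i t = \sum_(j < n) ((X *m v i) j 0 * s i / sigma ^+ 2) * tnth t j.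
  rewrite /U dotE !mulr_suml; apply: eq_bigr => j _; rewrite [tcol t j 0]mxE; ring.
under eq_integral do rewrite UE.
rewrite (integral_linear_form sigma0 _ gmu mF F0).
have -> : \sum_(j < n) ((X *m v i) j 0 * s i / sigma ^+ 2) ^+ 2 = sigma^-1 ^+ 2.
  have -> : \sum_(j < n) ((X *m v i) j 0 * s i / sigma ^+ 2) ^+ 2 =
      kappa i * s i ^+ 2 / sigma ^+ 4.
    have := orth i i; rewrite eqxx dotE => <-; rewrite !mulr_suml.
    by apply: eq_bigr => j _; field; rewrite lt0r_neq0.
  by rewrite s2; field; rewrite !lt0r_neq0.
have -> : Num.sqrt (sigma^-1 ^+ 2) = sigma^-1.
  by rewrite sqrtr_sqr ger0_norm// invr_ge0 ltW.
have mF' : measurable_fun [set: R] (fun x : R => F (sigma^-1 * x)%R).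
  by apply: (measurableT_comp mF); exact: measurable_funM.
have E x : sigma^-1 * (0 + sigma * x) = x.
  by rewrite add0r mulrA mulVf ?mul1r// lt0r_neq0.
have := integral_normal_affine 0 ltr01 sigma0 mF' (fun x => F0 _).
rewrite mulr1 => /esym ->; apply: eq_integral => x _.
by rewrite E.
Qed.

Let delta i (t : n.-tuple R) : R := dot (l i) (est (tcol t)).

Let mdelta i : measurable_fun setT (delta i).
Proof.
have -> : delta i = fun t => \sum_j l i j 0 * est (tcol t) j 0.
  by apply/funext => t; rewrite /delta dotE.
by apply: measurable_sum => j; apply: measurable_funM => //; exact: measurable_est.
Qed.

Let quad theta t := \sum_i w i * (delta i t - theta i) ^+ 2.

Let mquad theta : measurable_fun setT (quad theta).
Proof.
apply: measurable_sum => i; apply: measurable_funM => //.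
by apply: measurable_funX; apply: measurable_funB.
Qed.

Let quad_ge0 theta t : 0 <= quad theta t.
Proof. by apply: sumr_ge0 => i _; rewrite mulr_ge0// sqr_ge0. Qed.

(** After [integral_shift], [theta] occurs only in the loss and in the density, and the estimator is
    evaluated at the bare observation; risks at different parameters can then be averaged under one
    integral. *)
Lemma risk_ge theta : (forall i, `|theta i| <= a i) ->
  (\int[mu]_t (quad theta t * tilt sigma (mean theta) t)%:E <= LB mu X S12 r est)%E.
Proof.
move=> ta; apply: (@le_trans _ _ (risk mu X S12 est (beta theta))); last first.
  by apply: ereal_sup_ubound; exists (beta theta) => //=; exact: ball.
under eq_integral do rewrite EFinM.
rewrite -(integral_shift sigma0 (mean theta) gmu (H := fun t => (quad theta t)%:E));
  last 2 first.
- by apply/measurable_EFinP; exact: mquad.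
- by move=> t; rewrite lee_fin.
apply: ge0_le_integral => //.
- by move=> t _; rewrite lee_fin.
- apply/measurable_EFinP; apply: (measurableT_comp (mquad theta)).
  exact: measurable_shift_tuple.
- apply/measurable_EFinP.
  apply: (measurable_sqnorm S12 (f := fun t => est (X *m beta theta + tcol t) - beta theta)).
  move=> j; under eq_fun do rewrite mxE -tcol_shift.
  apply: measurable_funD => //.
  exact: (measurableT_comp (measurable_est j mest) (measurable_shift_tuple _)).
- move=> t _; rewrite lee_fin /quad /delta.
  by rewrite (tcol_shift (X *m beta theta)); exact: loss.
Qed.

Theorem minimax_lower_bound :
  ((\sum_i 4 / 5 * (w i * (a i ^+ 2 * s i ^+ 2 / (a i ^+ 2 + s i ^+ 2))))%:E <=
    LB mu X S12 r est)%E.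
Proof.
have /choice[p pb] i : exists p, bounded_mean_prior (a i / s i) p.
  by apply: bounded_normal_mean; rewrite divr_ge0// ltW.
have pp i : is_prior (p i) by have [] := pb i.
pose m := \max_i size (p i).
have pm i : (size (p i) <= m)%N by exact: leq_bigmax.
pose th (f : {ffun 'I_k -> 'I_m}) i := s i * (nth (0, 0) (p i) (f i)).1.
pose wt := @joint_weight R k m p.
have wt0 f : 0 <= wt f by exact: joint_weight_ge0.
have wt1 : \sum_f wt f = 1 by exact: sum_joint_weight.
pose V i t := postvar (p i) (U i t).
have V0 i t : 0 <= V i t by exact: postvar_ge0.
have mV i : measurable_fun setT (V i).
  by apply: (measurableT_comp (measurable_postvar (pp i))); exact: measurable_U.
(* Shifting by the mean of [th0 f i] leaves [U i] in place, since its [i]-th coordinate is zero. *)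
pose th0 f i := fun j => if j == i then 0 else th f j.
have key t : \sum_i w i * s i ^+ 2 * (\sum_f wt f * (tilt sigma (mean (th0 f i)) t * V i t)) <=
    \sum_f wt f * (quad (th f) t * tilt sigma (mean (th f)) t).
  have -> : \sum_f wt f * (quad (th f) t * tilt sigma (mean (th f)) t) =
    \sum_i w i * s i ^+ 2 * (\sum_f wt f * (\prod_j lik (nth (0, 0) (p j) (f j)).1 (U j t)) *
      (delta i t / s i - (nth (0, 0) (p i) (f i)).1) ^+ 2).
    under [RHS]eq_bigr do rewrite mulr_sumr.
    rewrite [RHS]exchange_big/=; apply: eq_bigr => f _.
    rewrite tilt_mean /quad mulr_suml mulr_sumr; apply: eq_bigr => i _.
    under eq_bigr => j _ do rewrite /th mulrAC mulfV ?lt0r_neq0// mul1r.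
    rewrite /th; have := s0 i; move: (s i) => si si0.
    by field; rewrite lt0r_neq0.
  apply: ler_sum => i _; apply: ler_wpM2l; first by rewrite mulr_ge0// sqr_ge0.
  apply: le_trans (joint_postvar pp pm i (U^~ t) (delta i t / s i)).
  rewrite le_eqVlt; apply/orP; left; apply/eqP; apply: eq_bigr => f _.
  rewrite tilt_mean -mulrA; congr (_ * (_ * _)); apply: eq_bigr => j _.
  rewrite /th0; case: eqP => _; first by rewrite mul0r.
  by rewrite /th mulrAC mulfV ?mul1r// lt0r_neq0.
have th_le f i : `|th f i| <= a i.
  have [_ + _] := pb i; rewrite /th.
  have [h /(_ _ (mem_nth (0, 0) h))|h _] := ltnP (f i) (size (p i)).
    by rewrite normrM (ger0_norm (ltW (s0 i))) ler_pdivlMr// mulrC.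
  by rewrite nth_default// mulr0 normr0.
apply: (@le_trans _ _ (\sum_f (wt f)%:E * LB mu X S12 r est)%E); last first.
  rewrite -ge0_sume_distrl; last by move=> f _; rewrite lee_fin.
  by rewrite sumEFin wt1 mul1e.
apply: (@le_trans _ _ (\sum_f (wt f)%:E *
    \int[mu]_t (quad (th f) t * tilt sigma (mean (th f)) t)%:E)%E); last first.
  apply: lee_sum => f _; apply: lee_wpmul2l; first by rewrite lee_fin.
  by apply: risk_ge => i; exact: th_le.
have qt0 f t : 0 <= quad (th f) t * tilt sigma (mean (th f)) t.
  by rewrite mulr_ge0// expR_ge0.
have mqt f : measurable_fun setT (fun t => quad (th f) t * tilt sigma (mean (th f)) t).
  by apply: measurable_funM => //; exact: measurable_tilt.
have Vt0 f i t : 0 <= tilt sigma (mean (th0 f i)) t * V i t.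
  by rewrite mulr_ge0// expR_ge0.
have mVt f i : measurable_fun setT (fun t => tilt sigma (mean (th0 f i)) t * V i t).
  by apply: measurable_funM => //; exact: measurable_tilt.
have ws0 i : 0 <= w i * s i ^+ 2 by rewrite mulr_ge0// sqr_ge0.
have sum0 i t : 0 <= \sum_f wt f * (tilt sigma (mean (th0 f i)) t * V i t).
  by apply: sumr_ge0 => f _; rewrite mulr_ge0.
have msum i : measurable_fun setT
    (fun t => \sum_f wt f * (tilt sigma (mean (th0 f i)) t * V i t)).
  by apply: measurable_sum => f; apply: measurable_funM.
rewrite -integral_lincomb//.
apply: (@le_trans _ _ (\int[mu]_t (\sum_i w i * s i ^+ 2 *
   (\sum_f wt f * (tilt sigma (mean (th0 f i)) t * V i t)))%:E)%E); last first.
  apply: ge0_le_integral => //.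
  - by move=> t _; rewrite lee_fin sumr_ge0// => i _; rewrite mulr_ge0.
  - by apply/measurable_EFinP; apply: measurable_sum => i; apply: measurable_funM.
  - by apply/measurable_EFinP; apply: measurable_sum => i; apply: measurable_funM.
  - by move=> t _; rewrite lee_fin.
rewrite integral_lincomb// -sumEFin; apply: lee_sum => i _.
rewrite integral_lincomb//.
(* Undoing the tilt leaves the law of [U i] standard normal for every [f], and the weights sum to
   [1]. *)
have -> : (\sum_f (wt f)%:E * \int[mu]_t (tilt sigma (mean (th0 f i)) t * V i t)%:E =
   \int[normal_prob 0 1]_x (postvar (p i) x)%:E)%E.
  transitivity (\sum_f (wt f)%:E * \int[normal_prob 0 1]_x (postvar (p i) x)%:E)%E.
    apply: eq_bigr => f _; congr (_ * _)%E.
    under eq_integral do rewrite mulrC EFinM.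
    rewrite -(integral_shift sigma0 (mean (th0 f i)) gmu (H := fun t => (V i t)%:E));
      last 2 first.
    + by apply/measurable_EFinP.
    + by move=> t; rewrite lee_fin.
    under eq_integral => t _.
      rewrite /V U_shift; last by rewrite /th0 eqxx.
      over.
    apply: (integral_U i (F := fun x => (postvar (p i) x)%:E)).
    + by apply/measurable_EFinP; exact: measurable_postvar.
    + by move=> x; rewrite lee_fin postvar_ge0.
  rewrite -ge0_sume_distrl; last by move=> f _; rewrite lee_fin.
  by rewrite sumEFin wt1 mul1e.
have [_ _ h] := pb i.
apply: le_trans (lee_wpmul2l _ h); last by rewrite lee_fin.
rewrite -EFinM lee_fin le_eqVlt; apply/orP; left; apply/eqP.
have := s0 i; move: (s i) => si si0.
have e1 : si ^+ 2 + a i ^+ 2 != 0 by rewrite gt_eqF// ltr_wpDr ?sqr_ge0// exprn_gt0.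
have e2 : a i ^+ 2 + si ^+ 2 != 0 by rewrite addrC.
by field; rewrite ?e1 ?e2 lt0r_neq0.
Qed.

End LowerBound.

(** * Linear estimators and the semidefinite program *)

Section LinearRisk.
Context {R : realType}.

Lemma mxtrace_gram m n (B : 'M[R]_(m, n)) : \tr (B *m B^T) = \sum_i \sum_j B i j ^+ 2.
Proof.
apply: eq_bigr => i _; rewrite mxE; apply: eq_bigr => j _.
by rewrite mxE expr2.
Qed.

Lemma mxtrace_gram_ge0 m n (B : 'M[R]_(m, n)) : 0 <= \tr (B *m B^T).
Proof.
by rewrite mxtrace_gram; apply: sumr_ge0 => i _; apply: sumr_ge0 => j _; rewrite sqr_ge0.
Qed.

Lemma sqnorm_mul n m (B : 'M[R]_(n, m)) (x : 'cV[R]_m) :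
  sqnorm (B *m x) = (x^T *m (B^T *m B) *m x) 0 0.
Proof. by rewrite /sqnorm trmx_mul !mulmxA. Qed.

Lemma sqnormZ n c (x : 'cV[R]_n) : sqnorm (c *: x) = c ^+ 2 * sqnorm x.
Proof. by rewrite !sqnorm_dot dotZl dotZr mulrA. Qed.

Lemma sqnorm_gt0 n (x : 'cV[R]_n) : x != 0 -> 0 < sqnorm x.
Proof.
move=> x0; rewrite lt_neqAle sqnorm_ge0 andbT eq_sym; apply: contra x0 => /eqP h.
apply/eqP/matrixP => i j; rewrite ord1 mxE; apply/eqP; rewrite -sqrf_eq0; apply/eqP.
by have := h; rewrite sqnormE => /psumr_eq0P -> // k _; rewrite sqr_ge0.
Qed.

Variables (n : nat) (sigma : R) (mu : probability (n.-tuple R) R).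
Hypothesis sigma0 : 0 < sigma.
Hypothesis gmu : iid_gaussian mu sigma.

Lemma integral_sqnorm_affine d (B : 'M[R]_(d, n)) (m : 'cV[R]_d) :
  (\int[mu]_t (sqnorm (B *m tcol t + m))%:E =
   (sqnorm m + sigma ^+ 2 * \tr (B *m B^T))%:E)%E.
Proof.
pose f i (t : n.-tuple R) := \sum_j B i j * tnth t j.
have mf i : measurable_fun setT (f i).
  by apply: measurable_sum => j; apply: measurable_funM => //; exact: measurable_tnth.
transitivity (\int[mu]_t (\sum_i 1 * (f i t + m i 0) ^+ 2)%:E)%E.
  apply: eq_integral => t _; rewrite sqnormE; congr (_%:E); apply: eq_bigr => i _.
  rewrite mul1r !mxE; congr ((_ + _) ^+ 2); apply: eq_bigr => j _.
  by rewrite mxE.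
rewrite integral_lincomb//; last 2 first.
- by move=> i t; rewrite sqr_ge0.
- by move=> i; apply: measurable_funX; apply: measurable_funD.
rewrite mxtrace_gram sqnormE mulr_sumr -big_split/= -sumEFin.
apply: eq_bigr => i _; rewrite mul1e.
rewrite (integral_linear_form sigma0 (fun j => B i j)
  (F := fun y => ((y + m i 0) ^+ 2)%:E) gmu); last 2 first.
- by apply/measurable_EFinP; apply: measurable_funX; apply: measurable_funD.
- by move=> y; rewrite lee_fin sqr_ge0.
rewrite normal_affine_second_moment// sqr_sqrtr.
  by rewrite addrC mulrC.
by apply: sumr_ge0 => j _; rewrite sqr_ge0.
Qed.

Variables (d : nat) (r : R) (X : 'M[R]_(n, d)) (SigmaT S12 : 'M[R]_d).
Hypothesis r0 : 0 < r.
Hypothesis d0 : (0 < d)%nat.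
Hypothesis S12T : S12^T = S12.
Hypothesis S12sq : S12 *m S12 = SigmaT.

Let variance (A : 'M[R]_(d, n)) := sigma ^+ 2 * \tr (S12 *m A *m A^T *m S12).

Let bias (C : 'M[R]_d) (b : 'cV[R]_d) :=
  (b^T *m ((C - 1%:M)^T *m SigmaT *m (C - 1%:M)) *m b) 0 0.

Lemma linear_risk (A : 'M[R]_(d, n)) (b : 'cV[R]_d) :
  risk mu X S12 (fun y => A *m y) b = (bias (A *m X) b + variance A)%:E.
Proof.
rewrite /risk; have e t : S12 *m (A *m (X *m b + tcol t) - b) =
    (S12 *m A) *m tcol t + S12 *m (A *m X - 1%:M) *m b.
  rewrite -!mulmxA -mulmxDr; congr (_ *m _).
  by rewrite mulmxDr mulmxBl mul1mx -!mulmxA addrAC addrC addrA.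
under eq_integral do rewrite e.
rewrite integral_sqnorm_affine sqnorm_mul; congr EFin; congr (_ + _ * _).
  by rewrite /bias trmx_mul S12T -S12sq !mulmxA.
by congr (\tr _); rewrite trmx_mul S12T !mulmxA.
Qed.

Lemma bias_ge0 C b : 0 <= bias C b.
Proof.
rewrite /bias -S12sq.
have -> : (C - 1%:M)^T *m (S12 *m S12) *m (C - 1%:M) =
    (S12 *m (C - 1%:M))^T *m (S12 *m (C - 1%:M)).
  by rewrite trmx_mul S12T !mulmxA.
by rewrite -sqnorm_mul sqnorm_ge0.
Qed.

Lemma biasZ C c b : bias C (c *: b) = c ^+ 2 * bias C b.
Proof.
by rewrite /bias [(c *: b)^T]linearZ/= -!scalemxAl -scalemxAr !mxE mulrA.
Qed.

Lemma sdp_feasP C tau :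
  sdp_feas SigmaT C tau <-> forall b, bias C b <= tau * sqnorm b.
Proof.
have e b : (b^T *m (tau%:M - (C - 1%:M)^T *m SigmaT *m (C - 1%:M)) *m b) 0 0 =
    tau * sqnorm b - bias C b.
  rewrite /bias mulmxBr mulmxBl mxE [X in _ + X]mxE; congr (_ - _).
  by rewrite mul_mx_scalar -scalemxAl mxE.
split=> [[_ h] b|h]; first by have := h b; rewrite e subr_ge0.
split=> [|b]; last by rewrite e subr_ge0.
rewrite linearB/= tr_scalar_mx; congr (_ - _).
by rewrite -S12sq !trmx_mul trmxK S12T !mulmxA.
Qed.

Lemma sdp_feas_ge0 C tau : sdp_feas SigmaT C tau -> 0 <= tau.
Proof.
move=> /sdp_feasP /(_ (delta_mx (Ordinal d0) 0)) h.
have s0 : 0 < sqnorm (delta_mx (Ordinal d0) 0 : 'cV[R]_d).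
  apply: sqnorm_gt0; apply/eqP => /matrixP/(_ (Ordinal d0) 0).
  by rewrite !mxE !eqxx => /eqP; rewrite oner_eq0.
by rewrite -(pmulr_lge0 _ s0) (le_trans (bias_ge0 _ _) h).
Qed.

Lemma linear_LB_le (A : 'M[R]_(d, n)) tau : sdp_feas SigmaT (A *m X) tau ->
  (LB mu X S12 r (fun y => A *m y) <= (r ^+ 2 * tau + variance A)%:E)%E.
Proof.
move=> f; have tau0 := sdp_feas_ge0 f; apply: ge_ereal_sup => _ [b /= br <-].
rewrite linear_risk lee_fin lerD2r; move/sdp_feasP: f => /(_ b) /le_trans; apply.
by rewrite mulrC ler_wpM2r.
Qed.

(** The bias is homogeneous of degree two: rescaling any direction to the sphere of radius [r] turns
    a bound on the ball into a Loewner constraint. *)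
Lemma linear_LB_feas (A : 'M[R]_(d, n)) l :
  (LB mu X S12 r (fun y => A *m y) <= l%:E)%E ->
  sdp_feas SigmaT (A *m X) ((l - variance A) / r ^+ 2).
Proof.
move=> Al; apply/sdp_feasP => b; have [->|b0] := eqVneq b 0.
  by rewrite /bias mulmx0 mxE sqnorm_dot /dot mulmx0 mxE mulr0.
have q0 := sqnorm_gt0 b0; pose c := r / Num.sqrt (sqnorm b).
have c2 : c ^+ 2 = r ^+ 2 / sqnorm b by rewrite expr_div_n sqr_sqrtr// ltW.
have : (risk mu X S12 (fun y => A *m y) (c *: b) <= l%:E)%E.
  apply: le_trans Al; apply: ereal_sup_ubound; exists (c *: b) => //=.
  by rewrite sqnormZ c2 mulrVK ?unitfE ?gt_eqF.
rewrite linear_risk lee_fin biasZ c2 -lerBrDr => h.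
have rq : 0 < r ^+ 2 / sqnorm b by rewrite divr_gt0// exprn_gt0.
rewrite -(ler_pM2l rq); apply: le_trans h _; rewrite le_eqVlt; apply/orP; left.
by apply/eqP; field; rewrite !lt0r_neq0.
Qed.

Hypothesis SXu : SigmaS X \in unitmx.

Let ss_mx (C : 'M[R]_d) : 'M[R]_(d, n) := C *m (n%:R^-1 *: (invmx (SigmaS X) *m X^T)).

Lemma ss_mx_beta_SS C : (fun y => C *m beta_SS X y) = (fun y => ss_mx C *m y).
Proof. by apply/funext => y; rewrite /beta_SS /ss_mx -[RHS]mulmxA -scalemxAl. Qed.

Lemma ss_mx_mulX C : ss_mx C *m X = C.
Proof.
rewrite /ss_mx -mulmxA -scalemxAl -mulmxA scalemxAr -/(SigmaS X).
by rewrite mulVmx// mulmx1.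
Qed.

Lemma SigmaS_sym : (SigmaS X)^T = SigmaS X.
Proof. by rewrite linearZ/= trmx_mul trmxK. Qed.

Lemma variance_ss_mx C : variance (ss_mx C) =
  sigma ^+ 2 / n%:R * \tr (S12 *m C *m invmx (SigmaS X) *m C^T *m S12).
Proof.
rewrite /variance -mulrA; congr (_ * _); rewrite -mxtraceZ; congr (\tr _).
have e : ss_mx C *m (ss_mx C)^T = n%:R^-1 *: (C *m invmx (SigmaS X) *m C^T).
  rewrite {2}/ss_mx trmx_mul linearZ/= trmx_mul trmxK trmx_inv SigmaS_sym.
  by rewrite -!scalemxAl -scalemxAr !mulmxA ss_mx_mulX.
by rewrite -[S12 *m ss_mx C *m _]mulmxA e -scalemxAr -scalemxAl !mulmxA.
Qed.

(** The Gauss-Markov argument: [D] annihilates [X], so its products with the transpose of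
    [ss_mx (A *m X)] vanish and the variance splits by Pythagoras. *)
Lemma variance_ss_mx_le A : variance (ss_mx (A *m X)) <= variance A.
Proof.
pose D := A - ss_mx (A *m X).
have DX : D *m X = 0 by rewrite mulmxBl ss_mx_mulX subrr.
have DA : D *m (ss_mx (A *m X))^T = 0.
  by rewrite /ss_mx trmx_mul linearZ/= trmx_mul trmxK -scalemxAl -scalemxAr !mulmxA DX !mul0mx scaler0.
have AE : A = ss_mx (A *m X) + D by rewrite addrC subrK.
rewrite /variance ler_wpM2l ?sqr_ge0//.
have -> : S12 *m A *m A^T *m S12 = S12 *m ss_mx (A *m X) *m (ss_mx (A *m X))^T *m S12 +
    (S12 *m D) *m (S12 *m D)^T.
  have AD : ss_mx (A *m X) *m D^T = 0 by apply: trmx_inj; rewrite trmx_mul trmxK DA trmx0.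
  have -> : S12 *m A *m A^T *m S12 = S12 *m (A *m A^T) *m S12 by rewrite !mulmxA.
  rewrite [(S12 *m D)^T]trmx_mul S12T.
  have -> : S12 *m ss_mx (A *m X) *m (ss_mx (A *m X))^T *m S12 +
      S12 *m D *m (D^T *m S12) =
      S12 *m (ss_mx (A *m X) *m (ss_mx (A *m X))^T + D *m D^T) *m S12.
    by rewrite mulmxDr mulmxDl !mulmxA.
  by congr (_ *m _ *m _); rewrite {1 2}AE linearD/= mulmxDl !mulmxDr AD DA addr0 add0r.
by rewrite mxtraceD lerDl mxtrace_gram_ge0.
Qed.

Lemma LB_le_sdp_obj C tau : sdp_feas SigmaT C tau ->
  (LB mu X S12 r (fun y => C *m beta_SS X y) <= (sdp_obj X S12 sigma r C tau)%:E)%E.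
Proof.
move=> f; rewrite ss_mx_beta_SS /sdp_obj -variance_ss_mx.
by apply: linear_LB_le; rewrite ss_mx_mulX.
Qed.

Lemma sdp_opt_le_LB C tau A : sdp_optimal X SigmaT S12 sigma r C tau ->
  ((sdp_obj X S12 sigma r C tau)%:E <= LB mu X S12 r (fun y => A *m y))%E.
Proof.
move=> [_ opt]; have : (LB mu X S12 r (fun y => A *m y) != -oo)%E.
  rewrite gt_eqF//; apply: (@lt_le_trans _ _ (risk mu X S12 (fun y => A *m y) 0)).
    by rewrite linear_risk ltNyr.
  apply: ereal_sup_ubound; exists 0 => //=.
  by rewrite sqnorm_dot /dot mulmx0 mxE sqr_ge0.
case E : (LB _ _ _ _ _) => [l| |] // _; last by rewrite leey.
(* [A] yields the feasible point [A X] with [tau = (l - variance A) / r^2], of objective at most [l]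
   because [ss_mx (A X)] has no larger variance. *)
have /linear_LB_feas /opt : (LB mu X S12 r (fun y => A *m y) <= l%:E)%E by rewrite E.
rewrite lee_fin => /le_trans; apply; rewrite /sdp_obj -variance_ss_mx.
rewrite mulrC mulfVK ?gt_eqF ?exprn_gt0//.
by rewrite -lerBrDl opprB addrC subrK variance_ss_mx_le.
Qed.

Lemma LB_sdp_optimal C tau : sdp_optimal X SigmaT S12 sigma r C tau ->
  LB mu X S12 r (fun y => C *m beta_SS X y) = RL mu X S12 r.
Proof.
move=> opt; apply/eqP; rewrite eq_le; apply/andP; split.
  apply: le_ereal_inf_tmp => _ [A _ <-].
  by apply: le_trans (LB_le_sdp_obj (proj1 opt)) _; exact: sdp_opt_le_LB.
rewrite ss_mx_beta_SS; apply: ereal_inf_lbound.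
by exists (ss_mx C).
Qed.

End LinearRisk.

(** * Common eigenbases *)

Section Spectral.
Context {R : realType}.

Lemma dot_mulr n m (B : 'M[R]_(n, m)) (x : 'cV[R]_n) (y : 'cV[R]_m) :
  dot x (B *m y) = dot (B^T *m x) y.
Proof. by rewrite /dot trmx_mul trmxK mulmxA. Qed.

Lemma dotDl n (u v w : 'cV[R]_n) : dot (v + w) u = dot v u + dot w u.
Proof. by rewrite dotC dotDr !(dotC u). Qed.

Lemma dot0r n (u : 'cV[R]_n) : dot u 0 = 0.
Proof. by rewrite /dot mulmx0 mxE. Qed.

Lemma continuous_sumr (T : topologicalType) (I : finType) (F : I -> T -> R) :
  (forall i, continuous (F i)) -> continuous (fun x => \sum_i F i x).
Proof.
move=> cF; elim: (index_enum I) => [|i s IH].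
  under eq_fun do rewrite big_nil.
  exact: cst_continuous.
under eq_fun do rewrite big_cons.
by move=> x; apply: cvgD; [exact: cF|exact: IH].
Qed.

Lemma continuous_quadratic n (A : 'M[R]_n) :
  continuous (fun x : 'rV[R]_n => dot x^T (A *m x^T)).
Proof.
have -> : (fun x : 'rV[R]_n => dot x^T (A *m x^T)) =
    (fun x => \sum_i \sum_j A i j * (x 0 i * x 0 j)).
  apply/funext => x; rewrite dotE; apply: eq_bigr => i _.
  rewrite [(A *m _) i 0]mxE mulr_sumr; apply: eq_bigr => j _; rewrite !mxE; ring.
apply: continuous_sumr => i; apply: continuous_sumr => j x.
apply: (@continuousM _ _ (fun=> A i j) (fun x : 'rV[R]_n => x 0 i * x 0 j)).
  exact: cst_continuous.
by apply: (@continuousM _ _ (fun x : 'rV[R]_n => x 0 i) (fun x : 'rV[R]_n => x 0 j));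
  exact: coord_continuous.
Qed.

(** The form attains its maximum on the compact unit sphere of [ker K], and homogeneity does the
    rest. The constraint [K] later allows a search inside an orthogonal complement or an
    eigenspace. *)
Lemma rayleigh_max n m (K : 'M[R]_(m, n)) (A : 'M[R]_n) :
  (exists2 x : 'cV[R]_n, x != 0 & K *m x = 0) ->
  exists u : 'cV[R]_n, [/\ sqnorm u = 1, K *m u = 0 &
    forall x, K *m x = 0 -> dot x (A *m x) <= dot u (A *m u) * sqnorm x].
Proof.
move=> [x0 x00 Kx0].
have unit (x : 'cV[R]_n) : x != 0 -> sqnorm ((Num.sqrt (sqnorm x))^-1 *: x) = 1.
  move=> /sqnorm_gt0 h; rewrite sqnormZ exprVn sqr_sqrtr ?ltW// mulVf//.
  by rewrite gt_eqF.
pose S : set 'rV[R]_n := [set x | sqnorm x^T = 1] `&` [set x | sqnorm (K *m x^T) = 0].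
have cS : compact S.
  have cB : compact [set x : 'rV[R]_n | forall i, x ord0 i \in `[-1, 1]%R].
    by apply: (@rV_compact R n (fun=> `[-1, 1]%classic)) => _; exact: segment_compact.
  apply: subclosed_compact cB _.
    apply: closedI.
      apply: (@closed_comp _ _ (fun x : 'rV[R]_n => sqnorm x^T) [set 1]).
        move=> x _; have -> : (fun x : 'rV[R]_n => sqnorm x^T) =
            fun x => dot x^T (1%:M *m x^T) by apply/funext => y; rewrite mul1mx.
        exact: continuous_quadratic.
      exact: closed_eq.
    apply: (@closed_comp _ _ (fun x : 'rV[R]_n => sqnorm (K *m x^T)) [set 0]).
      move=> x _; have -> : (fun x : 'rV[R]_n => sqnorm (K *m x^T)) =
          fun x => dot x^T ((K^T *m K) *m x^T).
        by apply/funext => y; rewrite sqnorm_mul /dot !mulmxA.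
      exact: continuous_quadratic.
    exact: closed_eq.
  move=> x [/= x1 _] i; rewrite in_itv/= -ler_norml -(@expr_le1 _ 2)//.
  rewrite real_normK ?num_real// -x1 sqnormE (bigD1 i)//= mxE lerDl.
  by apply: sumr_ge0 => j _; rewrite sqr_ge0.
have S0 : S !=set0.
  exists ((Num.sqrt (sqnorm x0))^-1 *: x0)^T; split => /=; rewrite trmxK ?unit//.
  by rewrite -scalemxAr Kx0 scaler0 sqnorm_dot dot0r.
have [u /set_mem[/= u1 Ku] umax] :=
  compact_EVT_max S0 cS (continuous_subspaceT (@continuous_quadratic n A)).
have sq0 (y : 'cV[R]_m) : sqnorm y = 0 -> y = 0.
  by move=> h; apply/eqP/contraT => /sqnorm_gt0; rewrite h ltxx.
exists u^T; split => // [|x Kx]; first exact: sq0.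
have [->|xn0] := eqVneq x 0; first by rewrite sqnorm_dot !dot0r mulr0 mulmx0 dot0r.
pose c := (Num.sqrt (sqnorm x))^-1.
have : dot (c *: x)^T^T (A *m (c *: x)^T^T) <= dot u^T (A *m u^T).
  apply: umax; apply/mem_set; split => /=; rewrite trmxK ?unit//.
  by rewrite -scalemxAr Kx scaler0 sqnorm_dot dot0r.
have s0 := sqnorm_gt0 xn0.
rewrite trmxK -scalemxAr dotZr dotZl mulrA -expr2 exprVn (sqr_sqrtr (sqnorm_ge0 x)).
by rewrite mulrC ler_pdivrMr.
Qed.

(** At a maximiser the residual [z] lies in the invariant subspace [ker K]; if nonzero, moving along
    [- z] would increase the Rayleigh quotient. *)
Lemma symmetric_eigenvector n m (K : 'M[R]_(m, n)) (A : 'M[R]_n) :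
  A^T = A -> (forall x : 'cV[R]_n, K *m x = 0 -> K *m (A *m x) = 0) ->
  (exists2 x : 'cV[R]_n, x != 0 & K *m x = 0) ->
  exists (u : 'cV[R]_n) (l : R), [/\ sqnorm u = 1, K *m u = 0 & A *m u = l *: u].
Proof.
move=> As Kinv Kne; have [u [u1 Ku umax]] := rayleigh_max A Kne.
pose l := dot u (A *m u); exists u, l; split => //.
pose z := l *: u - A *m u.
have Kz : K *m z = 0 by rewrite mulmxBr -scalemxAr Ku Kinv// scaler0 subrr.
suff z0 : z = 0 by apply/esym/eqP; rewrite -subr_eq0 -/z z0.
apply/eqP/contraT => /sqnorm_gt0 z0.
(* [2 * b] is the derivative at [0] of [t |-> l |u + t z|^2 - <u + t z, A (u + t z)>],
   which is minimal at [0]. *)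
set b := sqnorm z in z0.
pose g := l * b - dot z (A *m z).
have g0 : 0 <= g by rewrite subr_ge0 umax.
have q t : 0 <= 2 * t * b + t ^+ 2 * g.
  have := umax (u + t *: z); rewrite mulmxDr -scalemxAr Ku Kz scaler0 addr0 => /(_ erefl).
  rewrite -subr_ge0; congr (0 <= _).
  rewrite mulmxDr -scalemxAr sqnorm_dot !dotDl !dotDr !dotZl !dotZr -!sqnorm_dot u1.
  have zu : dot z u = dot u z by exact: dotC.
  have zAu : dot z (A *m u) = dot u (A *m z) by rewrite dot_mulr As dotC.
  have bE : b = l * dot u z - dot u (A *m z).
    rewrite /b sqnorm_dot {2}/z -scaleN1r dotDr !dotZr zAu zu; ring.
  rewrite zu zAu -/b -/l /g bE; ring.
have g1 : 0 < g + 1 by rewrite ltr_wpDl.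
(* Close to the minimiser [- b / g] of the quadratic; the [+ 1] covers [g = 0]. *)
have := q (- (b / (g + 1))).
have -> : 2 * - (b / (g + 1)) * b + (- (b / (g + 1))) ^+ 2 * g =
   - (b ^+ 2 / (g + 1) ^+ 2 * (g + 2)) by field; rewrite gt_eqF.
by rewrite oppr_ge0 leNgt mulr_gt0// ?divr_gt0 ?exprn_gt0// ltr_wpDl.
Qed.

Lemma kernel_nontrivial n k (K : 'M[R]_(k, n)) : (k < n)%nat ->
  exists2 x : 'cV[R]_n, x != 0 & K *m x = 0.
Proof.
move=> kn; have /rowV0Pn[v vK v0] : kermx K^T != 0.
  rewrite -mxrank_eq0 mxrank_ker mxrank_tr subn_eq0 -ltnNge.
  by rewrite (leq_ltn_trans (rank_leq_row K)).
exists v^T; first by rewrite -(eqtype.inj_eq trmx_inj) trmxK trmx0.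
by apply: trmx_inj; rewrite trmx_mul trmxK trmx0; exact/sub_kermxP.
Qed.

Lemma common_eigenbasis n (A B : 'M[R]_n) : A^T = A -> B^T = B -> A *m B = B *m A ->
  exists (v : 'I_n -> 'cV[R]_n) (l t : 'I_n -> R),
    [/\ forall i j, dot (v i) (v j) = if i == j then 1 else 0,
      forall i, A *m v i = l i *: v i & forall i, B *m v i = t i *: v i].
Proof.
move=> As Bs AB.
suff /(_ n (leqnn n))[v [l [t [ov Av Bv]]]] : forall k, (k <= n)%nat ->
    exists (v : nat -> 'cV[R]_n) (l t : nat -> R),
    [/\ forall i j, (i < k)%nat -> (j < k)%nat -> dot (v i) (v j) = if i == j then 1 else 0,
      forall i, (i < k)%nat -> A *m v i = l i *: v i &
      forall i, (i < k)%nat -> B *m v i = t i *: v i].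
  exists v, l, t; split=> [i j|i|i]; [exact: ov|exact: Av|exact: Bv].
elim=> [_|k IH kn]; first by exists (fun=> 0), (fun=> 0), (fun=> 0).
have [v [l [t [ov Av Bv]]]] := IH (ltnW kn).
(* Its kernel is the orthogonal complement of the vectors found so far, invariant under both
   matrices. *)
pose K := \matrix_(i < k, j < n) v i j 0.
have KP (x : 'cV[R]_n) : K *m x = 0 <-> forall i, (i < k)%nat -> dot (v i) x = 0.
  split=> [/matrixP h i ik|h].
    have := h (Ordinal ik) 0; rewrite !mxE dotE => Kx; rewrite -[RHS]Kx.
    by apply: eq_bigr => j _; rewrite mxE.
  apply/matrixP => i j; rewrite ord1 !mxE -[RHS](h i (ltn_ord i)) dotE.
  by apply: eq_bigr => a _; rewrite mxE.
have inv (C : 'M[R]_n) c : C^T = C -> (forall i, (i < k)%nat -> C *m v i = c i *: v i) ->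
    forall x : 'cV[R]_n, K *m x = 0 -> K *m (C *m x) = 0.
  move=> Cs Cv x Kx; have h := (KP _).1 Kx; apply: (KP _).2 => i ik.
  by rewrite dot_mulr Cs Cv// dotZl h// mulr0.
have [u1 [a [u1n Ku1 Au1]]] :=
  symmetric_eigenvector As (inv _ _ As Av) (kernel_nontrivial K kn).
(* Its kernel is the eigenspace of [A] for [a] within that complement; [B] preserves it since it
   commutes with [A], so an eigenvector of [B] there is a common one. *)
pose K2 := col_mx K (A - a%:M).
have K2P (x : 'cV[R]_n) : K2 *m x = 0 <-> K *m x = 0 /\ A *m x = a *: x.
  rewrite mul_col_mx mulmxBl mul_scalar_mx; split=> [/eqP|[-> ->]].
    by rewrite col_mx_eq0 => /andP[/eqP-> /eqP/subr0_eq ->].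
  by rewrite subrr col_mx0.
have [x K2x||u [b [un K2u Bu]]] := @symmetric_eigenvector _ _ K2 B Bs.
- have [Kx Ax] := (K2P _).1 K2x; apply: (K2P _).2; split; first exact: (inv _ _ Bs Bv).
  by rewrite mulmxA AB -mulmxA Ax -scalemxAr.
- exists u1; last exact: (K2P _).2.
  by apply/eqP => u10; move: u1n; rewrite u10 sqnorm_dot dot0r => /esym/eqP; rewrite oner_eq0.
exists (fun i => if i == k then u else v i), (fun i => if i == k then a else l i),
  (fun i => if i == k then b else t i).
have [Ku' Au] := (K2P _).1 K2u; have Ku := (KP _).1 Ku'.
have lek i : (i < k.+1)%nat = (i == k) || (i < k)%nat by rewrite ltnS leq_eqVlt.
split=> [i j|i|i]; rewrite !lek.
- have [->|ik] := eqVneq i k; have [->|jk] := eqVneq j k; rewrite ?eqxx//=.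
  + by move=> _ jk'; rewrite dotC; exact: Ku.
  + by move=> ik' _; rewrite (negPf ik); exact: Ku.
  + exact: ov.
- by have [->|ik] := eqVneq i k => //=; exact: Av.
- by have [->|ik] := eqVneq i k => //=; exact: Bv.
Qed.

(** The matrix [Q] of the vectors is square, so [Q Q^T = 1] gives [Q^T Q = 1], which is the
    expansion. *)
Lemma orthonormal_expansion n (v : 'I_n -> 'cV[R]_n) :
  (forall i j, dot (v i) (v j) = if i == j then 1 else 0) ->
  (forall x, x = \sum_i dot (v i) x *: v i) /\
  forall x y, dot x y = \sum_i dot (v i) x * dot (v i) y.
Proof.
move=> ov; pose Q := \matrix_(i < n, j < n) v i j 0.
have QQ : Q *m Q^T = 1%:M.
  apply/matrixP => i j; rewrite !mxE -[RHS]/((i == j)%:R).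
  rewrite (_ : (i == j)%:R = if i == j then 1 else 0); last by case: eqP.
  by rewrite -ov dotE; apply: eq_bigr => a _; rewrite !mxE.
have Qx x i : (Q *m x) i 0 = dot (v i) x.
  by rewrite mxE dotE; apply: eq_bigr => j _; rewrite mxE.
have e x : x = \sum_i dot (v i) x *: v i.
  rewrite -{1}[x]mul1mx -(mulmx1C QQ) -mulmxA; apply/matrixP => i j.
  rewrite ord1 mxE summxE; apply: eq_bigr => a _.
  by rewrite Qx !mxE mulrC.
split=> // x y; rewrite {1}(e y) dot_sumr; apply: eq_bigr => i _.
by rewrite dotZr dotC mulrC [dot x _]dotC.
Qed.

End Spectral.

(** * Boxes matching the semidefinite program *)

(* [g] maximises [\sum_i t i * (g i * s i / (g i + s i))] under [\sum_i g i <= rho],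
   and [tau] is the multiplier; [g i = s i * max (sqrt (t i / tau) - 1) 0]. *)
Lemma water_filling {R : realType} (I : finType) (t s : I -> R) (rho : R) :
  0 < rho -> (forall i, 0 <= t i) -> (forall i, 0 < s i) ->
  exists (g : I -> R) (tau : R), [/\ forall i, 0 <= g i, \sum_i g i <= rho,
    forall i, t i * (s i / (g i + s i)) ^+ 2 <= tau &
    rho * tau = \sum_i g i * (t i * (s i / (g i + s i)) ^+ 2)].
Proof.
move=> rho0 t0 s0.
have [/existsP[i0 ti0]|] := boolP [exists i, t i != 0]; last first.
  move=> /existsPn h; have tz i : t i = 0 by have /negPn/eqP := h i.
  exists (fun=> 0), 0; split => //.
  - by rewrite big1// ltW.
  - by move=> i; rewrite tz mul0r.
  - by rewrite mulr0 big1// => i _; rewrite mul0r.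
(* Here [x] stands for [1 / sqrt tau]. The total [h x] is continuous and zero at [0], and at [b] the
   single coordinate [i0] already contributes [rho]. *)
pose g x i := s i * Num.max (Num.sqrt (t i) * x - 1) 0.
pose h x := \sum_i g x i.
have ch : continuous h.
  apply: continuous_sumr => i x.
  apply: (@continuousM _ _ (fun=> s i) (fun x => Num.max (Num.sqrt (t i) * x - 1) 0)).
    exact: cst_continuous.
  apply: (@continuous_max _ _ (fun x => Num.sqrt (t i) * x - 1) (fun=> 0)); last first.
    exact: cst_continuous.
  apply: (@continuousB _ _ _ (fun x => Num.sqrt (t i) * x) (fun=> 1)); last first.
    exact: cst_continuous.
  by apply: (@continuousM _ _ (fun=> Num.sqrt (t i)) id); [exact: cst_continuous|].
have ti0' : 0 < Num.sqrt (t i0) by rewrite sqrtr_gt0 lt_neqAle eq_sym ti0 t0.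
have g0 x i : 0 <= g x i by rewrite mulr_ge0 ?(ltW (s0 i))// le_max lexx orbT.
pose b := (rho / s i0 + 1) / Num.sqrt (t i0).
have b0 : 0 <= b by rewrite divr_ge0 ?addr_ge0 ?divr_ge0 ?(ltW (s0 i0)) ?(ltW rho0) ?(ltW ti0').
have hb : rho <= h b.
  rewrite /h (bigD1 i0)//=; apply: (@le_trans _ _ (g b i0)).
    rewrite /g /b mulrCA mulfV ?gt_eqF// mulr1 addrK.
    rewrite max_l ?divr_ge0 ?(ltW (s0 i0)) ?(ltW rho0)//.
    by rewrite mulrC divfK// gt_eqF.
  by rewrite lerDl sumr_ge0.
have h0 : h 0 = 0.
  by rewrite /h big1// => i _; rewrite /g mulr0 sub0r max_r ?mulr0// oppr_le0.
have [x /andP[/= x0 xb] hx] : exists2 x, x \in `[0, b] & h x = rho.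
  apply: IVT => //; first exact: continuous_subspaceT.
  by rewrite h0 min_l ?max_r ?(le_trans (ltW rho0) hb)// hb ltW.
have {}x0 : 0 < x.
  rewrite lt_neqAle; apply/andP; split; last by move: x0; rewrite bnd_simp.
  by apply/eqP => x0'; move: hx; rewrite -x0' h0 => r0; move: rho0; rewrite -r0 ltxx.
exists (g x), (x ^- 2).
have E i : (t i * (s i / (g x i + s i)) ^+ 2 <= x ^- 2) /\
    (g x i * x ^- 2 = g x i * (t i * (s i / (g x i + s i)) ^+ 2)).
  have si := s0 i; rewrite /g; have [hle|hge] := leP (Num.sqrt (t i) * x - 1) 0.
    rewrite mulr0 !mul0r add0r mulfV ?gt_eqF// expr1n mulr1; split => //.
    rewrite -(sqr_sqrtr (t0 i)) -exprVn ler_pXn2r ?nnegrE ?invr_ge0 ?sqrtr_ge0 ?(ltW x0)//.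
    by rewrite -(ler_pM2r x0) mulVf ?gt_eqF// -subr_le0.
  have -> : s i * (Num.sqrt (t i) * x - 1) + s i = s i * (Num.sqrt (t i) * x) by ring.
  have tx : 0 < Num.sqrt (t i) * x by rewrite (lt_trans ltr01)// -subr_gt0.
  have ts : 0 < Num.sqrt (t i) by rewrite -(pmulr_lgt0 _ x0).
  have e : t i * (s i / (s i * (Num.sqrt (t i) * x))) ^+ 2 = x ^- 2.
    rewrite -{1}(sqr_sqrtr (t0 i)); field.
    by rewrite !gt_eqF.
  by rewrite e.
split => //.
- by rewrite -[X in X <= _]/(h x) hx.
- by move=> i; have [] := E i.
- by rewrite -{1}hx /h mulr_suml; apply: eq_bigr => i _; have [_ ->] := E i.
Qed.

Section LinearVersusNonlinear.
Context {R : realType}.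
Variables (n d : nat) (sigma r : R) (X : 'M[R]_(n, d)) (SigmaT S12 : 'M[R]_d).
Variables (mu : probability (n.-tuple R) R).
Hypothesis sigma0 : 0 < sigma.
Hypothesis gmu : iid_gaussian mu sigma.
Hypothesis r0 : 0 < r.
Hypothesis n0 : (0 < n)%nat.
Hypothesis S12T : S12^T = S12.
Hypothesis S12sq : S12 *m S12 = SigmaT.
Hypothesis SXu : SigmaS X \in unitmx.

Let nR : 0 < n%:R :> R. Proof. by rewrite ltr0n. Qed.

Let SigmaT_sym : SigmaT^T = SigmaT.
Proof. by rewrite -S12sq trmx_mul S12T. Qed.

Lemma sqnorm_S12 x : sqnorm (S12 *m x) = dot x (SigmaT *m x).
Proof. by rewrite sqnorm_mul S12T S12sq /dot mulmxA. Qed.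

Lemma dot_design x y : dot (X *m x) (X *m y) = n%:R * dot x (SigmaS X *m y).
Proof.
rewrite /SigmaS -scalemxAl dotZr mulrA mulfV ?gt_eqF// mul1r.
by rewrite [RHS]/dot !mulmxA -[x^T *m X^T]trmx_mul -mulmxA.
Qed.

Lemma sdp_trace C :
  \tr (S12 *m C *m invmx (SigmaS X) *m C^T *m S12) =
  \tr (C *m invmx (SigmaS X) *m C^T *m SigmaT).
Proof. by rewrite -!(mulmxA S12) mxtrace_mulC -!mulmxA S12sq !mulmxA. Qed.

Lemma SigmaS_def x : x != 0 -> 0 < dot x (SigmaS X *m x).
Proof.
move=> x0; rewrite -(pmulr_rgt0 _ nR) -dot_design; apply: sqnorm_gt0.
apply: contra x0 => /eqP Xx; rewrite -[x]mul1mx -(mulVmx SXu) -mulmxA.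
by rewrite /SigmaS -scalemxAl -mulmxA Xx mulmx0 scaler0 mulmx0.
Qed.

Lemma mxtrace_orthonormal (v : 'I_d -> 'cV[R]_d) (M : 'M[R]_d) :
  (forall i j, dot (v i) (v j) = if i == j then 1 else 0) ->
  \tr M = \sum_i dot (v i) (M *m v i).
Proof.
move=> /orthonormal_expansion[e _].
have {1}-> : M = M *m \sum_i v i *m (v i)^T.
  have -> : \sum_i v i *m (v i)^T = 1%:M; last by rewrite mulmx1.
  apply/matrixP => i j; have := e (delta_mx j 0) => /matrixP/(_ i 0).
  rewrite !mxE andbT !summxE => ->; apply: eq_bigr => k _.
  rewrite mxE [RHS]mxE big_ord1 mxE mulrC dotE (bigD1 j)//= big1.
    by rewrite mxE !eqxx mulr1 addr0.
  by move=> a aj; rewrite mxE (negPf aj) mulr0.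
rewrite mulmx_sumr raddf_sum/=; apply: eq_bigr => i _.
by rewrite mulmxA mxtrace_mulC /mxtrace big_ord1.
Qed.

Lemma sdp_lower_bound_commute : SigmaS X *m SigmaT = SigmaT *m SigmaS X ->
  exists C tau, sdp_feas SigmaT C tau /\
    forall est, measurable_estimator est ->
      ((4 / 5 * sdp_obj X S12 sigma r C tau)%:E <= LB mu X S12 r est)%E.
Proof.
move=> /(common_eigenbasis (SigmaS_sym X) SigmaT_sym)[v [l [t [ov Sv Tv]]]].
have [e pars] := orthonormal_expansion ov.
have vv i : dot (v i) (v i) = 1 by rewrite ov eqxx.
have v0 i : v i != 0.
  by apply/eqP => vi; move: (vv i); rewrite vi dot0r => /esym/eqP; rewrite oner_eq0.
have l0 i : 0 < l i by have := SigmaS_def (v0 i); rewrite Sv dotZr vv mulr1.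
have t0 i : 0 <= t i by have := sqnorm_ge0 (S12 *m v i); rewrite sqnorm_S12 Tv dotZr vv mulr1.
pose kappa i := n%:R * l i.
have k0 i : 0 < kappa i by rewrite mulr_gt0.
pose s2 i := sigma ^+ 2 / kappa i.
have s20 i : 0 < s2 i by rewrite divr_gt0// exprn_gt0.
have [g [tau [g0 gr gt gE]]] := water_filling (exprn_gt0 2 r0) t0 s20.
(* Shrinkage factors of the linear minimax estimator over the box with squared half-sides [g i]. *)
pose c i := g i / (g i + s2 i).
have gs0 i : 0 < g i + s2 i by rewrite ltr_wpDl.
have c1 i : 1 - c i = s2 i / (g i + s2 i).
  by rewrite /c; field; rewrite gt_eqF.
pose C := \sum_i c i *: (v i *m (v i)^T).
have Cs : C^T = C.
  rewrite /C linear_sum; apply: eq_bigr => i _.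
  by rewrite linearZ/= trmx_mul trmxK.
have Cv j : C *m v j = c j *: v j.
  rewrite /C mulmx_suml (bigD1 j)//= big1 => [|i ij].
    by rewrite addr0 -scalemxAl -mulmxA [(v j)^T *m v j]mx11_scalar -/(dot _ _) vv mulmx1.
  rewrite -scalemxAl -mulmxA [(v i)^T *m v j]mx11_scalar -/(dot _ _) ov (negPf ij).
  by rewrite raddf0 mulmx0 scaler0.
have T_quad x : dot x (SigmaT *m x) = \sum_i t i * dot (v i) x ^+ 2.
  rewrite pars; apply: eq_bigr => i _.
  by rewrite dot_mulr SigmaT_sym Tv dotZl; ring.
(* By the complementary slackness [gE], [r^2 tau] is the worst squared bias over the box; bias and
   variance of each coordinate then add up to its linear minimax risk. *)
have obj : sdp_obj X S12 sigma r C tau =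
    \sum_i t i * (g i * s2 i / (g i + s2 i)).
  rewrite /sdp_obj gE sdp_trace (mxtrace_orthonormal _ ov) mulr_sumr -big_split/=.
  apply: eq_bigr => i _; rewrite -!mulmxA Tv Cs -!scalemxAr Cv -!scalemxAr.
  have -> : invmx (SigmaS X) *m v i = (l i)^-1 *: v i.
    have vE : v i = (l i)^-1 *: (SigmaS X *m v i).
      by rewrite Sv scalerA mulVf ?scale1r// gt_eqF.
    by rewrite {1}vE -scalemxAr mulKmx.
  rewrite -!scalemxAr Cv !dotZr vv mulr1.
  have -> : sigma ^+ 2 / n%:R = s2 i * l i.
    by rewrite /s2 /kappa; field; rewrite !gt_eqF.
  rewrite /c; field; by rewrite !gt_eqF.
exists C, tau; split.
  apply/(sdp_feasP S12T S12sq) => b.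
  have -> : (b^T *m ((C - 1%:M)^T *m SigmaT *m (C - 1%:M)) *m b) 0 0 =
      dot ((C - 1%:M) *m b) (SigmaT *m ((C - 1%:M) *m b)).
    by rewrite /dot trmx_mul !mulmxA.
  rewrite T_quad sqnorm_dot pars mulr_sumr; apply: ler_sum => i _.
  rewrite dot_mulr linearB/= tr_scalar_mx Cs mulmxBl Cv mul1mx -{2}[v i]scale1r.
  rewrite -scalerBl dotZl -opprB c1 exprMn sqrrN -[dot _ b * dot _ b]expr2 mulrA.
  by rewrite ler_wpM2r ?sqr_ge0.
move=> est mest; rewrite obj mulr_sumr.
pose a i := Num.sqrt (g i).
have a2 i : a i ^+ 2 = g i by rewrite sqr_sqrtr.
have := @minimax_lower_bound R n d d sigma r X S12 mu est v v a kappa t sigma0 gmu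
  mest k0 (fun i => sqrtr_ge0 _) t0.
have s2E i : (sigma / Num.sqrt (kappa i)) ^+ 2 = s2 i.
  by rewrite expr_div_n sqr_sqrtr// ltW.
under eq_bigr do rewrite s2E a2.
apply.
- move=> i j; rewrite dot_design Sv dotZr ov; case: eqP => [->|_].
    by rewrite mulr1.
  by rewrite !mulr0.
- move=> theta ta; rewrite sqnorm_dot pars; apply: le_trans gr; apply: ler_sum => i _.
  rewrite dot_sumr (bigD1 i)//= big1 => [|j ji].
    by rewrite addr0 dotZr vv mulr1 -expr2 -a2 -real_normK ?num_real// ler_pXn2r ?nnegrE ?sqrtr_ge0.
  by rewrite dotZr ov eq_sym (negPf ji) mulr0.
- move=> b theta; rewrite sqnorm_S12 T_quad; apply: ler_sum => i _.
  rewrite le_eqVlt; apply/orP; left; apply/eqP; congr (_ * _ ^+ 2).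
  rewrite -(scaleN1r (\sum_j theta j *: v j)) dotDr dotZr mulN1r; congr (_ - _).
  rewrite dot_sumr (bigD1 i)//= big1 => [|j ji]; first by rewrite addr0 dotZr vv mulr1.
  by rewrite dotZr ov eq_sym (negPf ji) mulr0.
Qed.

Lemma cauchy_schwarz m (x y : 'cV[R]_m) : dot x y ^+ 2 <= sqnorm x * sqnorm y.
Proof.
have [->|y0] := eqVneq y 0.
  by rewrite !sqnorm_dot !dot0r expr0n/= mulr0.
have yp := sqnorm_gt0 y0.
have := sqnorm_ge0 (sqnorm y *: x + (- dot x y) *: y).
rewrite sqnorm_dot !dotDl !dotDr !dotZl !dotZr -!sqnorm_dot (dotC y x) => h.
rewrite -subr_ge0 -(pmulr_rge0 _ yp); apply: le_trans h _.
by rewrite le_eqVlt; apply/orP; left; apply/eqP; ring.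
Qed.

(** In a rank factorisation [c q^T], symmetry makes [c] a multiple of [q], and positivity gives the
    factor a square root. *)
Lemma rank1_psd : psd SigmaT -> \rank SigmaT = 1%nat ->
  exists2 w : 'cV[R]_d, w != 0 & SigmaT = w *m w^T.
Proof.
move=> [_ Tpos] rk; have := mulmx_base SigmaT.
move: (col_base SigmaT) (row_base SigmaT); rewrite rk => c q0 cq.
pose q := q0^T; have {}cq : SigmaT = c *m q^T by rewrite trmxK.
have T0 : SigmaT != 0 by rewrite -mxrank_eq0 rk.
have q0' : q != 0.
  by apply: contra T0 => /eqP q_eq0; rewrite cq q_eq0 trmx0 mulmx0.
have qp := sqnorm_gt0 q0'.
pose gam := dot c q / sqnorm q.
have cE : c = gam *: q.
  have : SigmaT *m q = SigmaT^T *m q by rewrite SigmaT_sym.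
  rewrite {2}cq trmx_mul trmxK cq -!mulmxA [q^T *m q]mx11_scalar [c^T *m q]mx11_scalar.
  rewrite !mul_mx_scalar -/(sqnorm q) -/(dot c q) => h.
  by rewrite /gam mulrC -scalerA -h scalerA mulVf ?scale1r// gt_eqF.
have {}cq : SigmaT = gam *: (q *m q^T) by rewrite cq cE scalemxAl.
have gam0 : 0 <= gam.
  have := Tpos q; rewrite cq.
  have -> : (q^T *m (gam *: (q *m q^T)) *m q) 0 0 = gam * sqnorm q ^+ 2.
    rewrite -scalemxAr -scalemxAl !mulmxA -(mulmxA (q^T *m q)) [q^T *m q]mx11_scalar -/(sqnorm q).
    by rewrite -scalar_mxM !mxE eqxx mulr1n expr2.
  by rewrite pmulr_lge0// exprn_gt0.
exists (Num.sqrt gam *: q).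
  apply: contra T0 => /eqP wq; rewrite cq -(sqr_sqrtr gam0) expr2 -scalerA.
  by rewrite scalemxAl wq mul0mx scaler0.
by rewrite linearZ/= -scalemxAr -scalemxAl scalerA -expr2 sqr_sqrtr.
Qed.

Lemma sdp_lower_bound_rank1 : psd SigmaT -> \rank SigmaT = 1%nat ->
  exists C tau, sdp_feas SigmaT C tau /\
    forall est, measurable_estimator est ->
      ((4 / 5 * sdp_obj X S12 sigma r C tau)%:E <= LB mu X S12 r est)%E.
Proof.
move=> Tpsd /(rank1_psd Tpsd)[w w0 Tw].
pose G := invmx (SigmaS X); pose k := sigma ^+ 2 / n%:R.
have k0 : 0 < k by rewrite divr_gt0// exprn_gt0.
have Gs : G^T = G by rewrite trmx_inv SigmaS_sym.
have SG (x : 'cV[R]_d) : SigmaS X *m (G *m x) = x by exact: mulKVmx.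
have Gpos (x : 'cV[R]_d) : x != 0 -> 0 < dot x (G *m x).
  move=> x0; rewrite -{1}(SG x) dotC; apply: SigmaS_def.
  by apply: contra x0 => /eqP Gx; rewrite -(SG x) Gx mulmx0.
pose M := (r ^+ 2)%:M + k *: G.
have Mx (x : 'cV[R]_d) : M *m x = r ^+ 2 *: x + k *: (G *m x).
  by rewrite mulmxDl mul_scalar_mx -scalemxAl.
have Mu : M \in unitmx.
  rewrite -row_free_unit -kermx_eq0; apply/rowV0P => y /sub_kermxP yM.
  apply/eqP/contraT => y0; have y0' : y^T != 0 by rewrite -(eqtype.inj_eq trmx_inj) trmxK trmx0.
  have : M *m y^T = 0.
    apply: trmx_inj; rewrite trmx_mul trmxK trmx0 linearD/= tr_scalar_mx linearZ/= Gs.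
    exact: yM.
  move=> My; have : 0 < dot y^T (M *m y^T).
    rewrite Mx dotDr !dotZr addr_gt0// mulr_gt0 ?exprn_gt0 ?Gpos//.
    exact: sqnorm_gt0.
  by rewrite My dot0r ltxx.
pose p := invmx M *m w.
have p0 : p != 0.
  by apply: contra w0 => /eqP p0; rewrite -(mulKVmx Mu w) -/p p0 mulmx0.
(* [a] minimises [r^2 |w - c|^2 + k <c, G c>] over [c], and [e] is the residual [w - a]. *)
pose e := k *: (G *m p); pose a := r ^+ 2 *: p.
have wE : w = a + e by rewrite -Mx mulKVmx.
have pe0 : 0 < dot p e by rewrite dotZr mulr_gt0// Gpos.
have e0 : e != 0 by apply/eqP => e0; move: pe0; rewrite e0 dot0r ltxx.
have ep := sqnorm_gt0 e0; have wp := sqnorm_gt0 w0.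
have we : dot w e = r ^+ 2 * dot p e + sqnorm e by rewrite wE dotDl dotZl -sqnorm_dot.
have we0 : 0 < dot w e by rewrite we addr_gt0// mulr_gt0// exprn_gt0.
(* The program depends on [C] only through [C^T w], here equal to [a]. The bias form is then
   [e e^T], with top eigenvalue [sqnorm e], the value taken for [tau]. *)
pose C := (sqnorm w)^-1 *: (w *m a^T).
have Cw : C^T *m w = a.
  rewrite linearZ/= trmx_mul trmxK -scalemxAl -mulmxA [w^T *m w]mx11_scalar.
  by rewrite mul_mx_scalar scalerA mulVf ?scale1r// gt_eqF.
have T_quad (x : 'cV[R]_d) : dot x (SigmaT *m x) = dot w x ^+ 2.
  by rewrite Tw -mulmxA [w^T *m x]mx11_scalar mul_mx_scalar dotZr (dotC x w) expr2.
have obj : sdp_obj X S12 sigma r C (sqnorm e) = r ^+ 2 * dot w e.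
  rewrite /sdp_obj sdp_trace -/k -/G Tw mulmxA mxtrace_mulC.
  have -> : w^T *m (C *m G *m C^T *m w) = (C^T *m w)^T *m (G *m (C^T *m w)).
    by rewrite trmx_mul trmxK !mulmxA.
  rewrite Cw /mxtrace big_ord1 -/(dot a (G *m a)).
  have -> : G *m a = (r ^+ 2 / k) *: e.
    by rewrite /a /e -scalemxAr scalerA divfK// gt_eqF.
  by rewrite we /a dotZl dotZr; field; rewrite gt_eqF.
exists C, (sqnorm e); split.
  apply/(sdp_feasP S12T S12sq) => b.
  have -> : (b^T *m ((C - 1%:M)^T *m SigmaT *m (C - 1%:M)) *m b) 0 0 =
      dot ((C - 1%:M) *m b) (SigmaT *m ((C - 1%:M) *m b)).
    by rewrite /dot trmx_mul !mulmxA.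
  rewrite T_quad dot_mulr linearB/= tr_scalar_mx mulmxBl Cw mul1mx wE opprD addrA subrr sub0r.
  rewrite -scaleN1r dotZl exprMn sqrrN expr1n mul1r; exact: cauchy_schwarz.
move=> est mest; rewrite obj.
pose f := Num.sqrt (sqnorm e); have f0 : 0 < f by rewrite sqrtr_gt0.
have f2 : f ^+ 2 = sqnorm e by rewrite sqr_sqrtr// ltW.
pose u := f^-1 *: e.
have uu : dot u u = 1 by rewrite dotZl dotZr -sqnorm_dot -f2; field; rewrite gt_eqF.
have wu0 : 0 < dot w u by rewrite dotZr mulr_gt0// invr_gt0.
pose kappa := sigma ^+ 2 * dot p e / sqnorm e.
have kappa0 : 0 < kappa by rewrite divr_gt0// mulr_gt0// exprn_gt0.
have Xu : dot (X *m u) (X *m u) = kappa.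
  rewrite dot_design -scalemxAr dotZl dotZr.
  have -> : SigmaS X *m e = k *: p by rewrite /e -scalemxAr SG.
  rewrite dotZr (dotC e p) /kappa -f2 /k; field; by rewrite !gt_eqF.
(* The loss sees an error only through its product with [w], so a single axis [u] already makes the
   loss hypothesis an equality. *)
have := @minimax_lower_bound R n d 1 sigma r X S12 mu est (fun=> u)
  (fun=> (dot w u)^-1 *: w) (fun=> r) (fun=> kappa) (fun=> dot w u ^+ 2)
  sigma0 gmu mest (fun=> kappa0) (fun=> ltW r0) (fun=> sqr_ge0 _).
rewrite big_ord1.
have -> : dot w u ^+ 2 * (r ^+ 2 * (sigma / Num.sqrt kappa) ^+ 2 /
    (r ^+ 2 + (sigma / Num.sqrt kappa) ^+ 2)) = r ^+ 2 * dot w e.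
  rewrite expr_div_n sqr_sqrtr ?(ltW kappa0)// /kappa /u dotZr -f2.
  have -> : r ^+ 2 + sigma ^+ 2 / (sigma ^+ 2 * dot p e / f ^+ 2) = dot w e / dot p e.
    by rewrite we -f2; field; rewrite !gt_eqF.
  by field; rewrite !gt_eqF.
apply.
- by move=> i j; rewrite !ord1 eqxx.
- move=> theta ta; rewrite big_ord1 sqnorm_dot dotZl dotZr uu mulr1 -expr2.
  rewrite -real_normK ?num_real// ler_pXn2r ?nnegrE ?(ltW r0)//; exact: ta.
- move=> b theta; rewrite !big_ord1 sqnorm_S12 T_quad le_eqVlt; apply/orP; left; apply/eqP.
  rewrite -(scaleN1r (theta ord0 *: u)) dotDr (dotZr (-1)) (dotZr (theta ord0)).
  rewrite dotZl -exprMn; congr (_ ^+ 2).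
  by field; rewrite gt_eqF.
Qed.

End LinearVersusNonlinear.

Theorem theorem2 (R : realType) (d nS : nat) (sigma r : R)
  (X : 'M[R]_(nS, d)) (SigmaT S12 : 'M[R]_d)
  (mu : probability (nS.-tuple R) R) (Cs : 'M[R]_d) (taus : R) :
  (0 < d)%N -> (0 < nS)%N -> 0 < sigma -> 0 < r ->
  SigmaS X \in unitmx ->
  psd SigmaT ->
  psd S12 -> S12 *m S12 = SigmaT ->
  iid_gaussian mu sigma ->
  sdp_optimal X SigmaT S12 sigma r Cs taus ->
  LB mu X S12 r (fun y => Cs *m beta_SS X y) = RL mu X S12 r /\
  ((SigmaS X *m SigmaT = SigmaT *m SigmaS X \/ \rank SigmaT = 1%N) ->
   (LB mu X S12 r (fun y => Cs *m beta_SS X y) <= (5%:R / 4%:R)%:E * RN mu X S12 r)%E).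
Proof.
move=> d0 n0 s0 r0 SXu Tpsd [S12T _] S12sq gmu opt; split.
  exact: (LB_sdp_optimal s0 gmu r0 d0 S12T S12sq SXu opt).
move=> h; have [C [tau [feas lower]]] : exists C tau, sdp_feas SigmaT C tau /\
    forall est, measurable_estimator est ->
      ((4 / 5 * sdp_obj X S12 sigma r C tau)%:E <= LB mu X S12 r est)%E.
  case: h => h; first exact: sdp_lower_bound_commute.
  exact: sdp_lower_bound_rank1.
(* Feasibility of the explicit point suffices: the optimal objective is at most its objective, which
   the lower bound controls. *)
apply: (@le_trans _ _ (sdp_obj X S12 sigma r C tau)%:E).
  apply: le_trans (LB_le_sdp_obj s0 gmu r d0 S12T S12sq SXu (proj1 opt)) _.
  by rewrite lee_fin; exact: (proj2 opt).
have RN_ge : ((4 / 5 * sdp_obj X S12 sigma r C tau)%:E <= RN mu X S12 r)%E.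
  by apply: le_ereal_inf_tmp => _ [est /= mest <-]; exact: lower.
have c0 : (0 <= (5%:R / 4%:R : R)%:E)%E by rewrite lee_fin divr_ge0.
apply: le_trans (lee_wpmul2l c0 RN_ge).
by rewrite -EFinM lee_fin le_eqVlt; apply/orP; left; apply/eqP; field.
Qed.
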